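(* Let $\beta>0$ and let $a,b\in C^\infty(\mathbb T;\mathbb R)$ satisfy $a,b\ge0$, $a\not\equiv0$, $b\not\equiv0$. There exist constants $C>0$ and $\tau_0>0$ such that $$\|(i\tau I-\mathcal A_d)^{-1}\|_{\mathcal L(\mathcal H)}\le C|\tau|\qquad\text{for all }\tau\in\mathbb R\text{ with }|\tau|\ge\tau_0.$$
   Context: $\mathbb T=\mathbb R/(2\pi\mathbb Z)$; functions are complex valued. Fourier convention: $\widehat v(k)=\frac1{2\pi}\int_{\mathbb T}v(x)e^{-ikx}dx$, $k\in\mathbb Z$. $\langle k\rangle=(1+k^2)^{1/2}$ and $\|v\|_{H^s}^2=2\pi\sum_k\langle k\rangle^{2s}|\widehat v(k)|^2$. Fourier multipliers: $\widehat{T_\beta v}(k)=-im_\beta(k)\widehat v(k)$ with $m_\beta(k)=\tanh(\beta k)/\beta$; $\widehat{P_\beta v}(k)=p_\beta(k)\widehat v(k)$ with $p_\beta(k)=\frac{\tanh(\beta k)}{\beta k}$ for $k\ne0$ and $p_\beta(0)=1$. Energy space: $\mathcal H=L^2(\mathbb T)\times H^{-1/2}(\mathbb T)$ with inner product $\langle(h,u),(\varphi,\psi)\rangle_{\mathcal H}=\langle h,\varphi\rangle_{L^2}+\langle P_\beta u,\psi\rangle_{H^{1/2},H^{-1/2}}=2\pi\sum_k\widehat h(k)\overline{\widehat\varphi(k)}+2\pi\sum_kp_\beta(k)\widehat u(k)\overline{\widehat\psi(k)}$. Damped generator: $\mathcal A_d(h,u)=(T_\beta u-a^2h,\,-h_x-b^2P_\beta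 u)$ with domain $D(\mathcal A_d)=H^{1/2}(\mathbb T)\times L^2(\mathbb T)$. Under the assumptions on $a,b$ one has $i\mathbb R\subset\rho(\mathcal A_d)$, so the resolvents above exist. *)

(* Defs.v *)
From Stdlib Require Import Reals ZArith Lra Lia.
From Stdlib Require Import FunctionalExtensionality ProofIrrelevance.
From Coquelicot Require Import Coquelicot.

Open Scope R_scope.

Definition smooth (f : R -> R) : Prop := forall n x, ex_derive_n f n x.

Record Cinf : Type := mkCinf {
  cinf_fun :> R -> R;
  cinf_smooth : smooth cinf_fun;
  cinf_periodic : forall x, cinf_fun (x + 2 * PI) = cinf_fun x }.

Lemma Cinf_ext (f g : Cinf) : (forall x, f x = g x) -> f = g.
Proof.
  intros H; destruct f as [f Hf Pf], g as [g Hg Pg]; simpl in H.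
  assert (E : f = g) by (apply functional_extensionality; exact H).
  subst g; f_equal; apply proof_irrelevance.
Qed.

Lemma Derive_n_S (f : R -> R) n x : Derive_n f (S n) x = Derive_n (Derive f) n x.
Proof.
  replace (S n) with (n + 1)%nat by lia.
  symmetry; exact (Derive_n_comp f n 1 x).
Qed.

Lemma ex_derive_n_step (f : R -> R) n :
  (forall x, ex_derive f x) -> (forall x, ex_derive_n (Derive f) n x) ->
  forall x, ex_derive_n f (S n) x.
Proof.
  intros H1 H2 x; destruct n as [|n]; [exact (H1 x)|].
  apply (ex_derive_ext (Derive_n (Derive f) n)).
  - intros y; symmetry; apply Derive_n_S.
  - exact (H2 x).
Qed.

Lemma smooth_ex_derive f : smooth f -> forall x, ex_derive f x.
Proof. intros H x; exact (H 1%nat x). Qed.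

Lemma smooth_Derive f : smooth f -> smooth (Derive f).
Proof.
  intros H [|n] x; [exact I|].
  apply (ex_derive_ext (Derive_n f (S n))).
  - intros y; apply Derive_n_S.
  - exact (H (S (S n)) x).
Qed.

Lemma smooth_scal_plus c f d g :
  smooth f -> smooth g -> smooth (fun x => c * f x + d * g x).
Proof.
  intros Hf Hg n x; apply ex_derive_n_plus;
    exists (mkposreal 1 Rlt_0_1); intros y _ k _; apply ex_derive_n_scal_l; auto.
Qed.

Lemma Derive_n_scal_plus c f d g n x : smooth f -> smooth g ->
  Derive_n (fun x => c * f x + d * g x) n x = c * Derive_n f n x + d * Derive_n g n x.
Proof.
  intros Hf Hg; rewrite Derive_n_plus, !Derive_n_scal_l; [reflexivity| |];
    exists (mkposreal 1 Rlt_0_1); intros y _ k _; apply ex_derive_n_scal_l; auto.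
Qed.

Lemma Derive_mult_fun f g : smooth f -> smooth g ->
  forall x, Derive (fun y => f y * g y) x = Derive f x * g x + f x * Derive g x.
Proof. intros Hf Hg x; apply Derive_mult; apply smooth_ex_derive; auto. Qed.


Lemma smooth_mult f g : smooth f -> smooth g -> smooth (fun x => f x * g x).
Proof.
  assert (K : forall n f g, smooth f -> smooth g ->
    forall m, (m <= n)%nat -> forall x, ex_derive_n (fun x => f x * g x) m x).
  { clear f g; induction n as [|n IH]; intros f g Hf Hg m Hm.
    - replace m with 0%nat by lia; intros x; exact I.
    - destruct m as [|m]; [intros x; exact I|].
      apply ex_derive_n_step.
      + intros x; apply ex_derive_mult; apply smooth_ex_derive; auto.
      + intros x; apply (ex_derive_n_ext (fun y => Derive f y * g y + f y * Derive g y)).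
        { intros y; symmetry; apply Derive_mult_fun; auto. }
        apply ex_derive_n_plus; exists (mkposreal 1 Rlt_0_1); intros y _ k Hk;
          apply IH; auto using smooth_Derive; lia. }
  intros Hf Hg n x; apply (K n); auto.
Qed.

Definition cinf_scal_plus (c : R) (f : Cinf) (d : R) (g : Cinf) : Cinf.
Proof.
  refine (mkCinf (fun x => c * f x + d * g x)
                 (smooth_scal_plus c f d g (cinf_smooth f) (cinf_smooth g)) _).
  intros x; now rewrite !cinf_periodic.
Defined.

Definition cinf_mult (f g : Cinf) : Cinf.
Proof.
  refine (mkCinf (fun x => f x * g x) (smooth_mult f g (cinf_smooth f) (cinf_smooth g)) _).
  intros x; now rewrite !cinf_periodic.
Defined.

Definition cinf_deriv (f : Cinf) : Cinf.
Proof.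
  refine (mkCinf (Derive f) (smooth_Derive f (cinf_smooth f)) _).
  intros x.
  rewrite <- (Derive_ext (fun y => f (y + 2 * PI)) f x (cinf_periodic f)).
  symmetry; exact (Derive_n_comp_trans f 1 x (2 * PI)).
Defined.

(** The family [A cos (k x) + B sin (k x)] is stable under differentiation. *)
Definition trig (k : Z) (A B x : R) : R := A * cos (IZR k * x) + B * sin (IZR k * x).

Lemma is_derive_trig k A B x :
  is_derive (trig k A B) x (trig k (IZR k * B) (- (IZR k * A)) x).
Proof. unfold trig; auto_derive; [exact I | ring]. Qed.

Lemma Derive_trig k A B x :
  Derive (trig k A B) x = trig k (IZR k * B) (- (IZR k * A)) x.
Proof. apply is_derive_unique, is_derive_trig. Qed.

Lemma smooth_trig k A B : smooth (trig k A B).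
Proof.
  intros n; revert A B; induction n as [|n IH]; intros A B; [intros x; exact I|].
  apply ex_derive_n_step.
  - intros x; eexists; apply is_derive_trig.
  - intros x; apply (ex_derive_n_ext (trig k (IZR k * B) (- (IZR k * A)))); auto.
    intros y; symmetry; apply Derive_trig.
Qed.

Lemma cos_sin_periodic_Z (k : Z) x :
  cos (IZR k * (x + 2 * PI)) = cos (IZR k * x) /\
  sin (IZR k * (x + 2 * PI)) = sin (IZR k * x).
Proof.
  destruct (Z_le_gt_dec 0 k) as [Hk|Hk].
  - replace (IZR k * (x + 2 * PI)) with (IZR k * x + 2 * INR (Z.to_nat k) * PI).
    + split; [apply cos_period | apply sin_period].
    + rewrite INR_IZR_INZ, Z2Nat.id by lia; ring.
  - replace (IZR k * x) with (IZR k * (x + 2 * PI) + 2 * INR (Z.to_nat (- k)) * PI).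
    + split; symmetry; [apply cos_period | apply sin_period].
    + rewrite INR_IZR_INZ, Z2Nat.id, opp_IZR by lia; ring.
Qed.

Definition cinf_trig (k : Z) (A B : R) : Cinf.
Proof.
  refine (mkCinf (trig k A B) (smooth_trig k A B) _).
  intros x; unfold trig; now destruct (cos_sin_periodic_Z k x) as [-> ->].
Defined.

Definition cinf_sqr (a : Cinf) : Cinf := cinf_mult a a.

Record test : Type := mkTest { tre : Cinf; tim : Cinf }.

Definition tval (phi : test) (x : R) : C := (tre phi x, tim phi x).

(** [c phi + psi] *)
Definition tlin (c : C) (phi psi : test) : test :=
  mkTest
    (cinf_scal_plus 1 (cinf_scal_plus (Re c) (tre phi) (- Im c) (tim phi)) 1 (tre psi))
    (cinf_scal_plus 1 (cinf_scal_plus (Re c) (tim phi) (Im c) (tre phi)) 1 (tim psi)).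

Definition tmul (a : Cinf) (phi : test) : test :=
  mkTest (cinf_mult a (tre phi)) (cinf_mult a (tim phi)).

Definition tderiv (phi : test) : test :=
  mkTest (cinf_deriv (tre phi)) (cinf_deriv (tim phi)).

(** [x |-> exp (i k x)] *)
Definition texp (k : Z) : test := mkTest (cinf_trig k 1 0) (cinf_trig k 0 1).

Lemma test_ext (phi psi : test) : (forall x, tval phi x = tval psi x) -> phi = psi.
Proof.
  intros H; destruct phi as [p q], psi as [p' q']; unfold tval in H; simpl in H.
  f_equal; apply Cinf_ext; intros x; specialize (H x); congruence.
Qed.

Lemma tval_tlin c phi psi x :
  tval (tlin c phi psi) x = (c * tval phi x + tval psi x)%C.
Proof. apply injective_projections; simpl; unfold Re, Im; ring. Qed.

Lemma tval_texp k x : tval (texp k) x = (cos (IZR k * x), sin (IZR k * x)).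
Proof. apply injective_projections; simpl; unfold trig; ring. Qed.

Definition ck_bound (N : nat) (f : R -> R) (M : R) : Prop :=
  forall j x, (j <= N)%nat -> Rabs (Derive_n f j x) <= M.

Definition test_bound (N : nat) (phi : test) (M : R) : Prop :=
  ck_bound N (tre phi) M /\ ck_bound N (tim phi) M.

Lemma Cinf_continuity (f : Cinf) x : continuity_pt f x.
Proof.
  apply continuity_pt_filterlim, (ex_derive_continuous (f : R -> R)).
  apply smooth_ex_derive, cinf_smooth.
Qed.

Lemma Cinf_bounded (f : Cinf) : exists M, 0 <= M /\ forall x, Rabs (f x) <= M.
Proof.
  pose proof PI_RGT_0 as Hpi.
  destruct (continuity_ab_maj (fun x => Rabs (f x)) 0 (2 * PI)) as [m [Hm _]]; [lra| |].
  { intros x _; apply (continuity_pt_comp f Rabs);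
      [apply Cinf_continuity | apply Rcontinuity_abs]. }
  exists (Rabs (f m)); split; [apply Rabs_pos|].
  assert (P : forall n x, f (x + 2 * INR n * PI) = f x).
  { induction n as [|n IH]; intros x; [simpl; f_equal; ring|].
    rewrite S_INR; replace (x + 2 * (INR n + 1) * PI) with ((x + 2 * INR n * PI) + 2 * PI)
      by ring; now rewrite cinf_periodic. }
  intros x; destruct (archimed (x / (2 * PI))) as [A1 A2].
  set (k := (up (x / (2 * PI)) - 1)%Z).
  set (y := x - IZR k * (2 * PI)).
  assert (E : x / (2 * PI) * (2 * PI) = x) by (field; lra).
  assert (Hy : 0 <= y <= 2 * PI).
  { unfold y, k; rewrite minus_IZR; split; nra. }
  replace (f x) with (f y); [exact (Hm y Hy)|].
  destruct (Z_le_gt_dec 0 k) as [Hk|Hk].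
  - rewrite <- (P (Z.to_nat k) y); f_equal; unfold y.
    rewrite INR_IZR_INZ, Z2Nat.id by lia; ring.
  - rewrite <- (P (Z.to_nat (- k)) x); f_equal; unfold y.
    rewrite INR_IZR_INZ, Z2Nat.id, opp_IZR by lia; ring.
Qed.

Lemma ck_bound_deriv N f M : ck_bound (S N) f M -> ck_bound N (Derive f) M.
Proof. intros H j x Hj; rewrite <- Derive_n_S; apply H; lia. Qed.

Lemma ck_bound_le N N' f M M' :
  (N' <= N)%nat -> M <= M' -> ck_bound N f M -> ck_bound N' f M'.
Proof. intros HN HM H j x Hj; apply Rle_trans with M; auto; apply H; lia. Qed.

Lemma ck_bound_exists N : forall f : Cinf, exists M, ck_bound N f M.
Proof.
  induction N as [|N IH]; intros f; destruct (Cinf_bounded f) as [M [HM0 HM]].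
  - exists M; intros j x Hj; replace j with 0%nat by lia; apply HM.
  - destruct (IH (cinf_deriv f)) as [M' HM'].
    exists (Rmax M M'); intros [|j] x Hj.
    + apply Rle_trans with M; [apply HM | apply Rmax_l].
    + rewrite Derive_n_S; apply Rle_trans with M'; [apply HM'; lia | apply Rmax_r].
Qed.

Lemma test_bound_exists N (phi : test) : exists M, test_bound N phi M.
Proof.
  destruct (ck_bound_exists N (tre phi)) as [M1 H1], (ck_bound_exists N (tim phi)) as [M2 H2].
  exists (Rmax M1 M2); split; [apply (ck_bound_le N N _ M1) | apply (ck_bound_le N N _ M2)];
    auto using Rmax_l, Rmax_r.
Qed.

Lemma test_bound_pos N phi M : test_bound N phi M -> 0 <= M.
Proof.
  intros [H _]; apply Rle_trans with (1 := Rabs_pos (tre phi 0)).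
  exact (H 0%nat 0 (Nat.le_0_l N)).
Qed.

Lemma ck_bound_mult N : forall a : Cinf, exists K, 0 <= K /\
  forall f M, smooth f -> ck_bound N f M -> ck_bound N (fun x => a x * f x) (K * M).
Proof.
  induction N as [|N IH]; intros a; destruct (Cinf_bounded a) as [A [HA0 HA]].
  - exists A; split; auto; intros f M Hf H j x Hj.
    replace j with 0%nat by lia; simpl; rewrite Rabs_mult.
    apply Rmult_le_compat; auto using Rabs_pos; exact (H 0%nat x (le_n _)).
  - destruct (IH a) as [K1 [HK1 P1]], (IH (cinf_deriv a)) as [K2 [HK2 P2]].
    exists (A + K1 + K2); split; [lra|]; intros f M Hf H j x Hj.
    assert (HM : 0 <= M).
    { apply Rle_trans with (1 := Rabs_pos (f x)); exact (H 0%nat x (Nat.le_0_l _)). }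
    destruct j as [|j].
    + simpl; rewrite Rabs_mult; apply Rle_trans with (A * M); [|nra].
      apply Rmult_le_compat; auto using Rabs_pos; exact (H 0%nat x (Nat.le_0_l _)).
    + rewrite Derive_n_S.
      rewrite (Derive_n_ext _ (fun y => 1 * (Derive a y * f y) + 1 * (a y * Derive f y))).
      2:{ intros y; rewrite (Derive_mult_fun a f); auto using cinf_smooth; ring. }
      pose proof (cinf_smooth a) as Ha.
      rewrite Derive_n_scal_plus by auto using smooth_mult, smooth_Derive.
      assert (B1 : Rabs (Derive_n (fun y => a y * Derive f y) j x) <= K1 * M).
      { apply P1; auto using smooth_Derive, ck_bound_deriv; lia. }
      assert (B2 : Rabs (Derive_n (fun y => Derive a y * f y) j x) <= K2 * M).
      { apply (P2 f M); auto; [|lia].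
        apply (ck_bound_le (S N) N f M M); auto; lra. }
      rewrite !Rmult_1_l; apply Rle_trans with (1 := Rabs_triang _ _); nra.
Qed.

Definition is_linear_form (v : test -> C) : Prop :=
  forall c phi psi, v (tlin c phi psi) = (c * v phi + v psi)%C.

(** Continuity for the Frechet topology of [C^oo(T; C)]: one [C^N] seminorm
    dominates the form. *)
Definition is_continuous_form (v : test -> C) : Prop :=
  exists N K, forall phi M, test_bound N phi M -> Cmod (v phi) <= K * M.

Record distr : Type := mkDistr {
  pairing :> test -> C;
  distr_linear : is_linear_form pairing;
  distr_continuous : is_continuous_form pairing }.

Lemma distr_ext (v w : distr) : (forall phi, v phi = w phi) -> v = w.
Proof.
  intros H; destruct v as [v Hv Cv], w as [w Hw Cw]; simpl in H.
  assert (E : v = w) by (apply functional_extensionality; exact H).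
  subst w; f_equal; apply proof_irrelevance.
Qed.

(** [c v + w] *)
Definition dlin (c : C) (v w : distr) : distr.
Proof.
  refine (mkDistr (fun phi => c * v phi + w phi)%C _ _).
  - intros d phi psi; rewrite !distr_linear; ring.
  - destruct (distr_continuous v) as [N [K H]], (distr_continuous w) as [N' [K' H']].
    exists (N + N')%nat, (Cmod c * K + K'); intros phi M [B1 B2].
    assert (L : forall n, (n <= N + N')%nat -> test_bound n phi M).
    { intros n Hn; split; apply (ck_bound_le (N + N') n _ M M); auto; lra. }
    apply Rle_trans with (1 := Cmod_triangle _ _); rewrite Cmod_mult.
    assert (H1 : Cmod (v phi) <= K * M) by (apply H, L; lia).
    assert (H2 : Cmod (w phi) <= K' * M) by (apply H', L; lia).
    pose proof (Cmod_ge_0 c); nra.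
Defined.

Definition dzero : distr.
Proof.
  refine (mkDistr (fun _ => 0%C) _ _).
  - intros c phi psi; ring.
  - exists 0%nat, 0; intros phi M _; rewrite Cmod_0; lra.
Defined.

Definition dscal (c : C) (v : distr) : distr := dlin c v dzero.
Definition dminus (v w : distr) : distr := dlin (RtoC (-1)) w v.

(** Product with a smooth real function: [<a v, phi> = <v, a phi>]. *)
Definition dmul (a : Cinf) (v : distr) : distr.
Proof.
  refine (mkDistr (fun phi => v (tmul a phi)) _ _).
  - intros c phi psi; rewrite <- distr_linear; f_equal; apply test_ext; intros x.
    rewrite tval_tlin; apply injective_projections; simpl; unfold Re, Im; ring.
  - destruct (distr_continuous v) as [N [K H]], (ck_bound_mult N a) as [Ka [HKa P]].
    exists N, (K * Ka); intros phi M [B1 B2]; rewrite Rmult_assoc; apply H.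
    split; apply P; auto using cinf_smooth.
Defined.

(** Distributional derivative: [<v_x, phi> = - <v, phi'>]. *)
Definition dderiv (v : distr) : distr.
Proof.
  refine (mkDistr (fun phi => - v (tderiv phi))%C _ _).
  - intros c phi psi.
    replace (tderiv (tlin c phi psi)) with (tlin c (tderiv phi) (tderiv psi)).
    { rewrite distr_linear; ring. }
    apply test_ext; intros x; rewrite tval_tlin; symmetry.
    assert (D : forall p q : Cinf, forall s t, Derive (fun y => s * p y + t * q y) x =
                s * Derive p x + t * Derive q x).
    { intros p q s t; apply (Derive_n_scal_plus s p t q 1 x); apply cinf_smooth. }
    destruct phi as [p q], psi as [p' q'].
    apply injective_projections; simpl.
    + rewrite (D (cinf_scal_plus (Re c) p (- Im c) q) p'); simpl.
      rewrite (D p q); unfold Re, Im; ring.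
    + rewrite (D (cinf_scal_plus (Re c) q (Im c) p) q'); simpl.
      rewrite (D q p); unfold Re, Im; ring.
  - destruct (distr_continuous v) as [N [K H]].
    exists (S N), K; intros phi M [B1 B2]; rewrite Cmod_opp; apply H.
    split; apply ck_bound_deriv; auto.
Defined.

(** Coefficient of a smooth function, [1/(2 pi) int phi(x) exp(-i k x) dx]. *)
Definition tfourier (phi : test) (k : Z) : C :=
  (/ (2 * PI) * RInt (fun x => Re (tval phi x * tval (texp (- k)) x)%C) 0 (2 * PI),
   / (2 * PI) * RInt (fun x => Im (tval phi x * tval (texp (- k)) x)%C) 0 (2 * PI)).

Definition fourier (v : distr) (k : Z) : C := (v (texp (- k)) / RtoC (2 * PI))%C.

(** Sums over [Z], used below only for absolutely convergent families. *)
Definition ex_sumZ (f : Z -> R) : Prop :=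
  ex_series (fun n => f (Z.of_nat (S n)) + f (- Z.of_nat (S n))%Z).

Definition sumZ (f : Z -> R) : R :=
  f 0%Z + Series (fun n => f (Z.of_nat (S n)) + f (- Z.of_nat (S n))%Z).

Definition CsumZ (f : Z -> C) : C :=
  (sumZ (fun k => Re (f k)), sumZ (fun k => Im (f k))).

Lemma Cmod_le_parts (z : C) : Cmod z <= Rabs (Re z) + Rabs (Im z).
Proof.
  pose proof (Rabs_pos (Re z)); pose proof (Rabs_pos (Im z)).
  unfold Cmod; rewrite <- (sqrt_pow2 (Rabs (Re z) + Rabs (Im z))) by lra.
  apply sqrt_le_1_alt; unfold Re, Im in *.
  rewrite <- (pow2_abs (fst z)), <- (pow2_abs (snd z)); nra.
Qed.

Lemma im_le_Cmod (z : C) : Rabs (Im z) <= Cmod z.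
Proof. apply Rle_trans with (2 := Rmax_Cmod z), Rmax_r. Qed.

Lemma Derive_n_trig_le k j : forall A B x,
  Rabs (Derive_n (trig k A B) j x) <= Rabs (IZR k) ^ j * (Rabs A + Rabs B).
Proof.
  induction j as [|j IH]; intros A B x.
  - simpl; unfold trig; apply Rle_trans with (1 := Rabs_triang _ _).
    rewrite !Rabs_mult.
    assert (Rabs (cos (IZR k * x)) <= 1) by (apply Rabs_le, COS_bound).
    assert (Rabs (sin (IZR k * x)) <= 1) by (apply Rabs_le, SIN_bound).
    pose proof (Rabs_pos A); pose proof (Rabs_pos B); nra.
  - rewrite Derive_n_S, (Derive_n_ext _ (trig k (IZR k * B) (- (IZR k * A))))
      by (intros y; apply Derive_trig).
    apply Rle_trans with (1 := IH _ _ _).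
    rewrite Rabs_Ropp, !Rabs_mult; simpl; apply Req_le; ring.
Qed.

Lemma texp_bound N k : test_bound N (texp k) ((1 + Rabs (IZR k)) ^ N).
Proof.
  pose proof (Rabs_pos (IZR k)) as H0.
  assert (P : forall j, (j <= N)%nat -> Rabs (IZR k) ^ j <= (1 + Rabs (IZR k)) ^ N).
  { intros j Hj; apply Rle_trans with ((1 + Rabs (IZR k)) ^ j).
    - apply pow_incr; lra.
    - apply Rle_pow; [lra | lia]. }
  split; intros j x Hj; simpl; apply Rle_trans with (1 := Derive_n_trig_le _ _ _ _ _);
    rewrite Rabs_R0, Rabs_R1; rewrite ?Rplus_0_l, ?Rplus_0_r, Rmult_1_r; auto.
Qed.

Lemma fourier_growth (v : distr) : exists N K, 0 <= K /\
  forall k, Cmod (fourier v k) <= K * (1 + Rabs (IZR k)) ^ N.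
Proof.
  pose proof PI_RGT_0 as Hpi.
  destruct (distr_continuous v) as [N [K H]].
  exists N, (Rabs K / (2 * PI)); split.
  { apply Rmult_le_pos; [apply Rabs_pos | apply Rlt_le, Rinv_0_lt_compat; lra]. }
  intros k; unfold fourier; rewrite Cmod_div by (intros E0; apply RtoC_inj in E0; lra).
  rewrite Cmod_R, (Rabs_pos_eq (2 * PI)) by lra.
  specialize (H (texp (- k)) _ (texp_bound N (- k))).
  rewrite opp_IZR, Rabs_Ropp in H.
  assert (Q : 0 <= (1 + Rabs (IZR k)) ^ N)
    by (apply pow_le; pose proof (Rabs_pos (IZR k)); lra).
  replace (Rabs K / (2 * PI) * (1 + Rabs (IZR k)) ^ N)
    with ((Rabs K * (1 + Rabs (IZR k)) ^ N) / (2 * PI)) by (field; lra).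
  apply Rmult_le_compat_r; [apply Rlt_le, Rinv_0_lt_compat; lra|].
  apply Rle_trans with (1 := H), Rmult_le_compat_r; auto using Rle_abs.
Qed.

Lemma Cinf_continuous (f : Cinf) x : continuous f x.
Proof. apply continuity_pt_filterlim, Cinf_continuity. Qed.

Lemma ex_RInt_Cinf (f : Cinf) a b : ex_RInt f a b.
Proof. apply (ex_RInt_continuous (V := R_CompleteNormedModule)); intros x _; apply Cinf_continuous. Qed.

Lemma RInt_lin_Cinf (f g h : Cinf) p q : (forall x, h x = p * f x + q * g x) ->
  RInt h 0 (2 * PI) = p * RInt f 0 (2 * PI) + q * RInt g 0 (2 * PI).
Proof.
  intros H; apply (is_RInt_unique (V := R_CompleteNormedModule)).
  apply (is_RInt_ext (fun x => p * f x + q * g x)); [intros x _; now rewrite H|].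
  apply (is_RInt_plus (V := R_NormedModule) (fun x => p * f x) (fun x => q * g x));
    apply (is_RInt_scal (V := R_NormedModule));
    apply (RInt_correct (V := R_CompleteNormedModule)), ex_RInt_Cinf.
Qed.

Definition trig_int (f : Cinf) (k : Z) (A B : R) : R :=
  RInt (cinf_mult f (cinf_trig k A B)) 0 (2 * PI).

Lemma RInt_Derive_Cinf (f : Cinf) : RInt (Derive f) 0 (2 * PI) = 0.
Proof.
  rewrite RInt_Derive.
  - pose proof (cinf_periodic f 0) as P; rewrite Rplus_0_l in P.
    apply Rminus_diag_eq; exact P.
  - intros x _; apply smooth_ex_derive, cinf_smooth.
  - intros x _; apply (Cinf_continuous (cinf_deriv f)).
Qed.

Lemma trig_int_parts f k A B :
  trig_int f k (IZR k * B) (- (IZR k * A)) = - trig_int (cinf_deriv f) k A B.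
Proof.
  pose proof (RInt_Derive_Cinf (cinf_mult f (cinf_trig k A B))) as H.
  unfold trig_int in *.
  change (RInt (cinf_deriv (cinf_mult f (cinf_trig k A B))) 0 (2 * PI) = 0) in H.
  rewrite (RInt_lin_Cinf (cinf_mult (cinf_deriv f) (cinf_trig k A B))
    (cinf_mult f (cinf_trig k (IZR k * B) (- (IZR k * A)))) _ 1 1) in H; [lra|].
  intros x; simpl; rewrite (Derive_mult_fun f (trig k A B));
    auto using cinf_smooth, smooth_trig; rewrite Derive_trig; ring.
Qed.

Lemma trig_int_scal f k c A B : trig_int f k (c * A) (c * B) = c * trig_int f k A B.
Proof.
  unfold trig_int.
  rewrite (RInt_lin_Cinf (cinf_mult f (cinf_trig k A B)) (cinf_mult f (cinf_trig k A B)) _ c 0);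
    [ring|].
  intros x; simpl; unfold trig; ring.
Qed.

Lemma trig_int_decay k j : forall (f : Cinf) M A B, ck_bound j f M ->
  Rabs (IZR k) ^ j * Rabs (trig_int f k A B) <= 2 * PI * (M * (Rabs A + Rabs B)).
Proof.
  pose proof PI_RGT_0 as Hpi.
  induction j as [|j IH]; intros f M A B H.
  - simpl; rewrite Rmult_1_l; unfold trig_int.
    replace (2 * PI * (M * (Rabs A + Rabs B)))
      with ((2 * PI - 0) * (M * (Rabs A + Rabs B))) by ring.
    apply abs_RInt_le_const; [lra | apply ex_RInt_Cinf |].
    intros x _; simpl; rewrite Rabs_mult.
    apply Rmult_le_compat; try apply Rabs_pos.
    + exact (H 0%nat x (le_n _)).
    + pose proof (Derive_n_trig_le k 0 A B x) as T; simpl in T; lra.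
  - replace (Rabs (IZR k) ^ S j * Rabs (trig_int f k A B))
      with (Rabs (IZR k) ^ j * Rabs (trig_int (cinf_deriv f) k (- B) A)).
    + replace (Rabs A + Rabs B) with (Rabs (- B) + Rabs A) by (rewrite Rabs_Ropp; ring).
      apply IH, ck_bound_deriv, H.
    + rewrite <- (Rabs_Ropp (trig_int (cinf_deriv f) k (- B) A)), <- trig_int_parts.
      replace (- (IZR k * - B)) with (IZR k * B) by ring.
      rewrite trig_int_scal, Rabs_mult; simpl; ring.
Qed.

Lemma tfourier_parts phi k :
  tfourier phi k =
  (/ (2 * PI) * (trig_int (tre phi) (- k) 1 0 - trig_int (tim phi) (- k) 0 1),
   / (2 * PI) * (trig_int (tre phi) (- k) 0 1 + trig_int (tim phi) (- k) 1 0)).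
Proof.
  unfold tfourier, trig_int.
  f_equal; f_equal.
  - rewrite (RInt_ext _ (cinf_scal_plus 1 (cinf_mult (tre phi) (cinf_trig (- k) 1 0))
                                        (-1) (cinf_mult (tim phi) (cinf_trig (- k) 0 1)))).
    + rewrite (RInt_lin_Cinf (cinf_mult (tre phi) (cinf_trig (- k) 1 0)) (cinf_mult (tim phi) (cinf_trig (- k) 0 1)) _ 1 (-1)) by reflexivity; apply Rminus_diag_uniq; ring.
    + intros x _; simpl; ring.
  - rewrite (RInt_ext _ (cinf_scal_plus 1 (cinf_mult (tre phi) (cinf_trig (- k) 0 1))
                                        1 (cinf_mult (tim phi) (cinf_trig (- k) 1 0)))).
    + rewrite (RInt_lin_Cinf (cinf_mult (tre phi) (cinf_trig (- k) 0 1)) (cinf_mult (tim phi) (cinf_trig (- k) 1 0)) _ 1 1) by reflexivity; apply Rminus_diag_uniq; ring.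
    + intros x _; simpl; ring.
Qed.

Lemma tfourier_decay phi k j M : test_bound j phi M ->
  Rabs (IZR k) ^ j * Cmod (tfourier phi k) <= 4 * M.
Proof.
  pose proof PI_RGT_0 as Hpi.
  intros [H1 H2]; set (q := Rabs (IZR k) ^ j).
  assert (Hq : 0 <= q) by (apply pow_le, Rabs_pos).
  assert (D : forall (f : Cinf) A B, ck_bound j f M -> Rabs A + Rabs B = 1 ->
    q * Rabs (trig_int f (- k) A B) <= 2 * PI * M).
  { intros f A B Hf E; pose proof (trig_int_decay (- k) j f M A B Hf) as T.
    rewrite E, opp_IZR, Rabs_Ropp, Rmult_1_r in T; exact T. }
  assert (E1 : Rabs 1 + Rabs 0 = 1) by (rewrite Rabs_R0, Rabs_R1; ring).
  assert (E2 : Rabs 0 + Rabs 1 = 1) by (rewrite Rabs_R0, Rabs_R1; ring).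
  pose proof (D _ _ _ H1 E1) as B1; pose proof (D _ _ _ H1 E2) as B2.
  pose proof (D _ _ _ H2 E1) as B3; pose proof (D _ _ _ H2 E2) as B4.
  rewrite tfourier_parts.
  apply Rle_trans with (q * / (2 * PI) *
    (Rabs (trig_int (tre phi) (- k) 1 0) + Rabs (trig_int (tim phi) (- k) 0 1) +
     (Rabs (trig_int (tre phi) (- k) 0 1) + Rabs (trig_int (tim phi) (- k) 1 0)))).
  - rewrite Rmult_assoc; apply Rmult_le_compat_l; auto.
    apply Rle_trans with (1 := Cmod_le_parts _); simpl.
    rewrite !Rabs_mult, (Rabs_pos_eq (/ (2 * PI)))
      by (apply Rlt_le, Rinv_0_lt_compat; lra).
    rewrite <- Rmult_plus_distr_l; apply Rmult_le_compat_l;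
      [apply Rlt_le, Rinv_0_lt_compat; lra|].
    apply Rplus_le_compat; [|apply Rabs_triang].
    apply Rle_trans with (1 := Rabs_triang _ _); rewrite Rabs_Ropp; lra.
  - replace (4 * M) with (/ (2 * PI) * (4 * (2 * PI * M))) by (field; lra).
    rewrite (Rmult_comm q), Rmult_assoc; apply Rmult_le_compat_l;
      [apply Rlt_le, Rinv_0_lt_compat; lra|]; lra.
Qed.

Definition qZ (k : Z) : R := / (1 + IZR k ^ 2).

Lemma qZ_pos k : 0 <= qZ k.
Proof. apply Rlt_le, Rinv_0_lt_compat; pose proof (pow2_ge_0 (IZR k)); lra. Qed.

Lemma ex_sumZ_qZ : ex_sumZ qZ.
Proof.
  unfold ex_sumZ.
  apply (ex_series_le (V := R_CompleteNormedModule) _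
           (fun n => 4 * (/ INR (S n) - / INR (S (S n))))).
  - intros n; change (Rabs (qZ (Z.of_nat (S n)) + qZ (- Z.of_nat (S n))%Z) <=
      4 * (/ INR (S n) - / INR (S (S n)))).
    rewrite Rabs_pos_eq by (pose proof (qZ_pos (Z.of_nat (S n)));
                            pose proof (qZ_pos (- Z.of_nat (S n))); lra).
    rewrite (S_INR (S n)).
    unfold qZ; rewrite opp_IZR, <- INR_IZR_INZ.
    set (t := INR (S n)).
    assert (Ht : 1 <= t) by (unfold t; rewrite S_INR; pose proof (pos_INR n); lra).
    replace ((- t) ^ 2) with (t ^ 2) by ring.
    replace (4 * (/ t - / (t + 1))) with (4 * / (t * (t + 1))) by (field; lra).
    assert (I : / (1 + t ^ 2) <= 2 * / (t * (t + 1))); [|lra].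
    apply (Rmult_le_reg_l (1 + t ^ 2)); [nra|].
    rewrite Rinv_r by nra.
    apply (Rmult_le_reg_r (t * (t + 1))); [nra|].
    rewrite Rmult_assoc, (Rmult_assoc 2), Rinv_l by nra; nra.
  - apply (ex_series_scal 4 (fun n => / INR (S n) - / INR (S (S n)))).
    exists 1; change (is_lim_seq (sum_n (fun n => / INR (S n) - / INR (S (S n)))) 1).
    apply (is_lim_seq_ext (fun n => 1 - / (INR n + 2))).
    + intros n; rewrite sum_n_Reals; induction n as [|n IH].
      * simpl; lra.
      * rewrite tech5, <- IH, !S_INR; pose proof (pos_INR n); field; lra.
    + replace (Finite 1) with (Rbar_minus (Finite 1) (Finite 0)) by (simpl; f_equal; ring).
      apply is_lim_seq_minus'; [apply is_lim_seq_const|].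
      change (Finite 0) with (Rbar_inv p_infty).
      apply is_lim_seq_inv; [|discriminate].
      apply (is_lim_seq_plus INR (fun _ => 2) p_infty 2);
        [apply is_lim_seq_INR | apply is_lim_seq_const | reflexivity].
Qed.

Lemma ex_sumZ_dominated f c : (forall k, Rabs (f k) <= c * qZ k) -> ex_sumZ f.
Proof.
  intros H.
  apply (ex_series_le (V := R_CompleteNormedModule) _
    (fun n => c * (qZ (Z.of_nat (S n)) + qZ (- Z.of_nat (S n))))).
  - intros n; change (Rabs (f (Z.of_nat (S n)) + f (- Z.of_nat (S n))%Z) <=
      c * (qZ (Z.of_nat (S n)) + qZ (- Z.of_nat (S n)))).
    apply Rle_trans with (1 := Rabs_triang _ _).
    rewrite Rmult_plus_distr_l; apply Rplus_le_compat; apply H.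
  - apply (ex_series_scal_l (V := R_NormedModule) c), ex_sumZ_qZ.
Qed.

Lemma sumZ_dominated f c :
  (forall k, Rabs (f k) <= c * qZ k) -> Rabs (sumZ f) <= c * sumZ qZ.
Proof.
  intros H; unfold sumZ.
  apply Rle_trans with (1 := Rabs_triang _ _).
  rewrite Rmult_plus_distr_l; apply Rplus_le_compat; [apply H|].
  rewrite <- Series_scal_l.
  assert (T : forall n, Rabs (f (Z.of_nat (S n)) + f (- Z.of_nat (S n))%Z) <=
              c * (qZ (Z.of_nat (S n)) + qZ (- Z.of_nat (S n)))).
  { intros n; apply Rle_trans with (1 := Rabs_triang _ _).
    rewrite Rmult_plus_distr_l; apply Rplus_le_compat; apply H. }
  assert (E : ex_series (fun n => c * (qZ (Z.of_nat (S n)) + qZ (- Z.of_nat (S n))))).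
  { apply (ex_series_scal_l (V := R_NormedModule) c), ex_sumZ_qZ. }
  apply Rle_trans with (1 := Series_Rabs _
    (ex_series_le (V := R_CompleteNormedModule) _ _
      (fun n => Rle_trans _ _ _ (Req_le _ _ (Rabs_Rabsolu _)) (T n)) E)).
  apply Series_le; auto; intros n; split; [apply Rabs_pos | apply T].
Qed.

Lemma sumZ_ext f g : (forall k, f k = g k) -> sumZ f = sumZ g.
Proof.
  intros H; unfold sumZ; rewrite H; f_equal; apply Series_ext; intros n; now rewrite !H.
Qed.

Lemma sumZ_lin c d f g h : ex_sumZ f -> ex_sumZ g -> ex_sumZ h ->
  sumZ (fun k => c * f k + d * g k + h k) = c * sumZ f + d * sumZ g + sumZ h.
Proof.
  intros Hf Hg Hh; unfold sumZ.
  rewrite (Series_ext _ (fun n =>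
    (c * (f (Z.of_nat (S n)) + f (- Z.of_nat (S n))%Z) +
     d * (g (Z.of_nat (S n)) + g (- Z.of_nat (S n))%Z)) +
    (h (Z.of_nat (S n)) + h (- Z.of_nat (S n))%Z))) by (intros n; ring).
  rewrite Series_plus, Series_plus, !Series_scal_l; [ring| | | |]; auto.
  1, 2: apply (ex_series_scal_l (V := R_NormedModule)); auto.
  apply (ex_series_plus (V := R_NormedModule));
    apply (ex_series_scal_l (V := R_NormedModule)); auto.
Qed.

Definition bounded_symbol (s : Z -> C) : Prop := exists B, forall k, Cmod (s k) <= B.

Definition multiplier_form (s : Z -> C) (v : distr) (phi : test) : C :=
  (RtoC (2 * PI) * CsumZ (fun k => s k * fourier v k * tfourier phi (- k)))%C.

Lemma multiplier_dominated s v : bounded_symbol s -> exists N K, 0 <= K /\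
  forall phi M, test_bound N phi M -> forall k,
  Cmod (s k * fourier v k * tfourier phi (- k)) <= K * M * qZ k.
Proof.
  intros [B HB]; destruct (fourier_growth v) as [N [K [HK H]]].
  assert (HB0 : 0 <= B) by (apply Rle_trans with (1 := Cmod_ge_0 _) (2 := HB 0%Z)).
  exists (N + 2)%nat, (B * K * 2 ^ N * 8).
  assert (H2 : 1 <= 2 ^ N) by (apply pow_R1_Rle; lra).
  assert (HBK : 0 <= B * K) by (apply Rmult_le_pos; auto).
  split; [apply Rmult_le_pos; [apply Rmult_le_pos; lra | lra]|].
  intros phi M HM k; rewrite !Cmod_mult.
  pose proof (test_bound_pos _ _ _ HM) as HM0.
  assert (S1 : Cmod (s k) * Cmod (fourier v k) <= B * K * (1 + Rabs (IZR k)) ^ N).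
  { rewrite Rmult_assoc; apply Rmult_le_compat; auto using Cmod_ge_0. }
  apply Rle_trans with (B * K * (1 + Rabs (IZR k)) ^ N * Cmod (tfourier phi (- k))).
  { apply Rmult_le_compat_r; auto using Cmod_ge_0. }
  assert (G : (1 + Rabs (IZR k)) ^ N * Cmod (tfourier phi (- k)) <= 2 ^ N * (8 * M * qZ k)).
  2:{ replace (B * K * 2 ^ N * 8 * M * qZ k) with (B * K * (2 ^ N * (8 * M * qZ k))) by ring.
      rewrite (Rmult_assoc (B * K)); apply Rmult_le_compat_l; auto. }
  unfold qZ; destruct (Z.eq_dec k 0) as [->|Hk].
  - replace (1 + Rabs 0) with 1 by (rewrite Rabs_R0; ring).
    rewrite pow1, Rmult_1_l.
    assert (T : Rabs (IZR (- 0)) ^ 0 * Cmod (tfourier phi (- 0)) <= 4 * M).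
    { apply tfourier_decay; destruct HM as [M1 M2].
      split; apply (ck_bound_le (N + 2) 0 _ M M); auto; try lia; lra. }
    simpl pow in T at 1; rewrite Rmult_1_l in T.
    apply Rle_trans with (1 := T).
    replace (1 + 0 ^ 2) with 1 by ring; rewrite Rinv_1; nra.
  - pose proof (tfourier_decay phi (- k) (N + 2) M HM) as T.
    rewrite opp_IZR, Rabs_Ropp in T.
    set (r := Rabs (IZR k)) in *.
    assert (Hr : 1 <= r).
    { unfold r; rewrite <- abs_IZR; apply IZR_le; lia. }
    replace (IZR k ^ 2) with (r ^ 2) by apply pow2_abs.
    set (F := Cmod (tfourier phi (- k))) in *.
    assert (HF : 0 <= F) by apply Cmod_ge_0.
    rewrite pow_add in T.
    assert (P : (1 + r) ^ N <= 2 ^ N * r ^ N).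
    { rewrite <- Rpow_mult_distr; apply pow_incr; lra. }
    apply (Rmult_le_reg_r (1 + r ^ 2)); [nra|].
    replace (2 ^ N * (8 * M * / (1 + r ^ 2)) * (1 + r ^ 2)) with (2 ^ N * (8 * M))
      by (field; nra).
    apply Rle_trans with (2 ^ N * r ^ N * F * (2 * r ^ 2)).
    + apply Rmult_le_compat; [| nra | | nra].
      * apply Rmult_le_pos; auto; apply pow_le; lra.
      * apply Rmult_le_compat_r; auto.
    + replace (2 ^ N * r ^ N * F * (2 * r ^ 2)) with (2 ^ N * (2 * (r ^ N * r ^ 2 * F))) by ring.
      apply Rmult_le_compat_l; lra.
Qed.

Lemma tfourier_tlin c phi psi k :
  tfourier (tlin c phi psi) k = (c * tfourier phi k + tfourier psi k)%C.
Proof.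
  assert (L : forall (f g h : Cinf) p q m A B,
    trig_int (cinf_scal_plus 1 (cinf_scal_plus p f q g) 1 h) m A B =
    p * trig_int f m A B + q * trig_int g m A B + trig_int h m A B).
  { intros f g h p q m A B; unfold trig_int.
    rewrite (RInt_lin_Cinf (cinf_mult (cinf_scal_plus p f q g) (cinf_trig m A B))
      (cinf_mult h (cinf_trig m A B)) _ 1 1) by (intros x; simpl; ring).
    rewrite (RInt_lin_Cinf (cinf_mult f (cinf_trig m A B))
      (cinf_mult g (cinf_trig m A B)) _ p q) by (intros x; simpl; ring).
    ring. }
  rewrite !tfourier_parts; simpl tre; simpl tim; rewrite !L.
  apply injective_projections; simpl; unfold Re, Im; ring.
Qed.

Lemma multiplier_linear s v : bounded_symbol s -> is_linear_form (multiplier_form s v).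
Proof.
  intros Hs c phi psi; destruct (multiplier_dominated s v Hs) as [N [K [HK H]]].
  destruct (test_bound_exists N phi) as [M1 H1], (test_bound_exists N psi) as [M2 H2].
  specialize (H phi M1 H1) as D1; specialize (H psi M2 H2) as D2; clear H.
  unfold multiplier_form.
  set (f := fun k => (s k * fourier v k * tfourier phi (- k))%C) in *.
  set (g := fun k => (s k * fourier v k * tfourier psi (- k))%C) in *.
  assert (F1 : ex_sumZ (fun k => Re (f k))) by (eapply ex_sumZ_dominated; intros k;
    apply Rle_trans with (1 := re_le_Cmod _), D1).
  assert (F2 : ex_sumZ (fun k => Im (f k))) by (eapply ex_sumZ_dominated; intros k;
    apply Rle_trans with (1 := im_le_Cmod _), D1).
  assert (G1 : ex_sumZ (fun k => Re (g k))) by (eapply ex_sumZ_dominated; intros k;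
    apply Rle_trans with (1 := re_le_Cmod _), D2).
  assert (G2 : ex_sumZ (fun k => Im (g k))) by (eapply ex_sumZ_dominated; intros k;
    apply Rle_trans with (1 := im_le_Cmod _), D2).
  assert (E : forall k, (s k * fourier v k * tfourier (tlin c phi psi) (- k) = c * f k + g k)%C).
  { intros k; rewrite tfourier_tlin; unfold f, g; ring. }
  unfold CsumZ.
  rewrite (sumZ_ext _ (fun k => Re c * Re (f k) + - Im c * Im (f k) + Re (g k)))
    by (intros k; rewrite E; simpl; unfold Re, Im; ring).
  rewrite (sumZ_ext (fun k => Im (s k * fourier v k * tfourier (tlin c phi psi) (- k))%C)
    (fun k => Re c * Im (f k) + Im c * Re (f k) + Im (g k)))
    by (intros k; rewrite E; simpl; unfold Re, Im; ring).
  rewrite !sumZ_lin by auto.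
  apply injective_projections; simpl; unfold Re, Im; ring.
Qed.

Lemma multiplier_continuous s v :
  bounded_symbol s -> is_continuous_form (multiplier_form s v).
Proof.
  pose proof PI_RGT_0 as Hpi.
  intros Hs; destruct (multiplier_dominated s v Hs) as [N [K [HK H]]].
  exists N, (2 * PI * (2 * K * sumZ qZ)); intros phi M HM.
  specialize (H phi M HM); unfold multiplier_form.
  rewrite Cmod_mult, Cmod_R, Rabs_pos_eq by lra.
  rewrite (Rmult_assoc (2 * PI)); apply Rmult_le_compat_l; [lra|].
  apply Rle_trans with (1 := Cmod_le_parts _).
  assert (S1 := sumZ_dominated (fun k => Re (s k * fourier v k * tfourier phi (- k))%C)
    (K * M) (fun k => Rle_trans _ _ _ (re_le_Cmod _) (H k))).
  assert (S2 := sumZ_dominated (fun k => Im (s k * fourier v k * tfourier phi (- k))%C)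
    (K * M) (fun k => Rle_trans _ _ _ (im_le_Cmod _) (H k))).
  apply Rle_trans with (1 := Rplus_le_compat _ _ _ _ S1 S2), Req_le; ring.
Qed.

(** The distribution whose [k]-th Fourier coefficient is [s k * fourier v k]
    (see [fourier_multiplier]). *)
Definition dmultiplier (s : Z -> C) (Hs : bounded_symbol s) (v : distr) : distr :=
  mkDistr (multiplier_form s v) (multiplier_linear s v Hs) (multiplier_continuous s v Hs).

Lemma RInt_trig (m : Z) A B :
  RInt (trig m A B) 0 (2 * PI) = if Z.eq_dec m 0 then 2 * PI * A else 0.
Proof.
  destruct (Z.eq_dec m 0) as [->|Hm].
  - rewrite (RInt_ext _ (fun _ => A)).
    + rewrite RInt_const; change ((2 * PI - 0) * A = 2 * PI * A); ring.
    + intros x _; unfold trig; rewrite Rmult_0_l, cos_0, sin_0; apply Rminus_diag_uniq; ring.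
  - assert (Hm' : IZR m <> 0) by (apply not_0_IZR; auto).
    rewrite (RInt_ext _ (Derive (cinf_trig m (- (B / IZR m)) (A / IZR m)))).
    + apply RInt_Derive_Cinf.
    + intros x _; simpl; rewrite Derive_trig; unfold trig; apply Rminus_diag_uniq; field; auto.
Qed.

Lemma tfourier_texp j k :
  tfourier (texp j) k = RtoC (if Z.eq_dec j k then 1 else 0).
Proof.
  pose proof PI_RGT_0 as Hpi.
  unfold tfourier.
  rewrite (RInt_ext _ (trig (j - k) 1 0)).
  2:{ intros x _; rewrite !tval_texp; unfold trig; simpl.
      replace (IZR (j - k) * x) with (IZR j * x + IZR (- k) * x)
        by (rewrite minus_IZR, opp_IZR; ring).
      rewrite cos_plus; apply Rminus_diag_uniq; ring. }
  rewrite (RInt_ext (fun x => Im (tval (texp j) x * tval (texp (- k)) x)%C) (trig (j - k) 0 1)).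
  2:{ intros x _; rewrite !tval_texp; unfold trig; simpl.
      replace (IZR (j - k) * x) with (IZR j * x + IZR (- k) * x)
        by (rewrite minus_IZR, opp_IZR; ring).
      rewrite sin_plus; apply Rminus_diag_uniq; ring. }
  rewrite !RInt_trig.
  destruct (Z.eq_dec (j - k) 0), (Z.eq_dec j k); try lia;
    apply injective_projections; simpl; field; lra.
Qed.

Lemma Series_single (a : nat -> R) m : (forall n, n <> m -> a n = 0) -> Series a = a m.
Proof.
  intros H; apply is_series_unique.
  change (is_lim_seq (sum_n a) (a m)).
  apply (is_lim_seq_ext_loc (fun _ => a m)); [|apply is_lim_seq_const].
  exists m; intros n Hn; rewrite sum_n_Reals.
  assert (Z0 : forall p, (p < m)%nat -> sum_f_R0 a p = 0).
  { induction p as [|p IH]; intros Hp; simpl; [apply H; lia|].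
    rewrite IH, H by lia; ring. }
  induction Hn as [|n Hn IH].
  - destruct m as [|m]; simpl; [reflexivity|]; rewrite Z0 by lia; ring.
  - simpl; rewrite <- IH, (H (S n)) by lia; ring.
Qed.

Lemma sumZ_single (f : Z -> R) k : (forall j, j <> k -> f j = 0) -> sumZ f = f k.
Proof.
  intros H; unfold sumZ; destruct (Z.eq_dec k 0) as [->|Hk].
  - rewrite (Series_single _ 0); [|].
    { rewrite (H (Z.of_nat 1)), (H (- Z.of_nat 1)%Z) by lia; ring. }
    intros n _; rewrite !H by lia; ring.
  - rewrite (H 0%Z) by auto.
    rewrite (Series_single _ (Z.to_nat (Z.abs k) - 1)).
    + replace (S (Z.to_nat (Z.abs k) - 1)) with (Z.to_nat (Z.abs k)) by lia.
      rewrite Z2Nat.id by lia.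
      destruct (Z_lt_ge_dec k 0) as [Hk'|Hk'].
      * rewrite (H (Z.abs k)) by lia; replace (- Z.abs k)%Z with k by lia; ring.
      * rewrite (H (- Z.abs k)%Z) by lia; replace (Z.abs k) with k by lia; ring.
    + intros n Hn; rewrite !H by lia; ring.
Qed.

Lemma fourier_multiplier s Hs v k :
  fourier (dmultiplier s Hs v) k = (s k * fourier v k)%C.
Proof.
  pose proof PI_RGT_0 as Hpi.
  assert (Hpi' : RtoC (2 * PI) <> 0%C) by (intros E0; apply RtoC_inj in E0; lra).
  unfold fourier at 1; simpl; unfold multiplier_form.
  replace (CsumZ _) with (s k * fourier v k)%C; [field; auto|].
  assert (E : forall j, j <> k ->
    (s j * fourier v j * tfourier (texp (- k)) (- j) = 0)%C).
  { intros j Hj; rewrite tfourier_texp; destruct (Z.eq_dec (- k) (- j)); [lia|]; ring. }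
  assert (E' : (s k * fourier v k * tfourier (texp (- k)) (- k) = s k * fourier v k)%C).
  { rewrite tfourier_texp; destruct (Z.eq_dec (- k) (- k)); [|lia]; ring. }
  unfold CsumZ; rewrite !(sumZ_single _ k), E'.
  - apply injective_projections; reflexivity.
  - intros j Hj; now rewrite E.
  - intros j Hj; now rewrite E.
Qed.

Lemma tanh_bound x : Rabs (tanh x) <= 1.
Proof.
  pose proof (exp_pos x); pose proof (exp_pos (- x)).
  assert (E : tanh x = (exp x - exp (- x)) / (exp x + exp (- x)))
    by (unfold tanh, sinh, cosh; field; lra).
  rewrite E; unfold Rdiv; rewrite Rabs_mult, Rabs_inv, (Rabs_pos_eq (_ + _)) by lra.
  apply (Rmult_le_reg_r (exp x + exp (- x))); [lra|].
  rewrite Rmult_assoc, Rinv_l, Rmult_1_r, Rmult_1_l by lra.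
  apply Rabs_le; lra.
Qed.

Definition m_beta (beta : R) (k : Z) : R := tanh (beta * IZR k) / beta.

Definition p_beta (beta : R) (k : Z) : R :=
  if Z.eq_dec k 0 then 1 else tanh (beta * IZR k) / (beta * IZR k).

Definition T_symbol (beta : R) (k : Z) : C := (- Ci * RtoC (m_beta beta k))%C.
Definition P_symbol (beta : R) (k : Z) : C := RtoC (p_beta beta k).

Lemma T_symbol_bounded beta : bounded_symbol (T_symbol beta).
Proof.
  exists (Rabs (/ beta)); intros k; unfold T_symbol, m_beta, Rdiv.
  rewrite Cmod_mult, Cmod_opp, Cmod_R, Rabs_mult.
  replace (Cmod Ci) with 1
    by (symmetry; transitivity (sqrt 1); [|apply sqrt_1];
        unfold Cmod, Ci; simpl; f_equal; ring).
  pose proof (tanh_bound (beta * IZR k)); pose proof (Rabs_pos (/ beta)); nra.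
Qed.

Lemma P_symbol_bounded beta : bounded_symbol (P_symbol beta).
Proof.
  exists (1 + Rabs (/ beta)); intros k; unfold P_symbol, p_beta, Rdiv.
  pose proof (Rabs_pos (/ beta)) as Hb.
  rewrite Cmod_R; destruct (Z.eq_dec k 0) as [_|Hk]; [rewrite Rabs_R1; lra|].
  rewrite Rabs_mult, Rinv_mult, Rabs_mult.
  assert (Hk1 : 1 <= Rabs (IZR k)) by (rewrite <- abs_IZR; apply IZR_le; lia).
  assert (Hk2 : Rabs (/ IZR k) <= 1).
  { rewrite Rabs_inv; rewrite <- Rinv_1; apply Rinv_le_contravar; lra. }
  pose proof (tanh_bound (beta * IZR k)) as Ht.
  pose proof (Rabs_pos (/ IZR k)); pose proof (Rabs_pos (tanh (beta * IZR k))).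
  assert (Rabs (/ beta) * Rabs (/ IZR k) <= Rabs (/ beta)) by nra.
  assert (0 <= Rabs (/ beta) * Rabs (/ IZR k)) by (apply Rmult_le_pos; auto); nra.
Qed.

Definition T_op (beta : R) : distr -> distr :=
  dmultiplier (T_symbol beta) (T_symbol_bounded beta).

Definition P_op (beta : R) : distr -> distr :=
  dmultiplier (P_symbol beta) (P_symbol_bounded beta).

(** [v] belongs to [H^s(T)]; [Rpower (1 + k^2) s] is [<k>^(2 s)].  A function
    [v] is identified with the distribution [phi |-> int v phi], and [L^2(T)] is
    [H^0(T)] (Parseval, Riesz-Fischer). *)
Definition sobolev (s : R) (v : distr) : Prop :=
  ex_sumZ (fun k => Rpower (1 + IZR k ^ 2) s * Cmod (fourier v k) ^ 2).

Definition L2 : distr -> Prop := sobolev 0.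

Definition state : Type := (distr * distr)%type.

Definition sscal (c : C) (x : state) : state := (dscal c (fst x), dscal c (snd x)).
Definition sminus (x y : state) : state := (dminus (fst x) (fst y), dminus (snd x) (snd y)).

Definition energy_space (x : state) : Prop := L2 (fst x) /\ sobolev (- (1 / 2)) (snd x).

Definition energy_inner (beta : R) (x y : state) : C :=
  (RtoC (2 * PI) * CsumZ (fun k => fourier (fst x) k * Cconj (fourier (fst y) k)) +
   RtoC (2 * PI) * CsumZ (fun k =>
     RtoC (p_beta beta k) * fourier (snd x) k * Cconj (fourier (snd y) k)))%C.

Definition energy_norm (beta : R) (x : state) : R := sqrt (Re (energy_inner beta x x)).

Definition Ad_domain (x : state) : Prop := sobolev (1 / 2) (fst x) /\ L2 (snd x).

(** [A_d (h, u) = (T_beta u - a^2 h, - h_x - b^2 P_beta u)]; the formula makes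
    sense for all distributions, the domain is [Ad_domain]. *)
Definition Ad (beta : R) (a b : Cinf) (x : state) : state :=
  (dminus (T_op beta (snd x)) (dmul (cinf_sqr a) (fst x)),
   dminus (dscal (RtoC (-1)) (dderiv (fst x))) (dmul (cinf_sqr b) (P_op beta (snd x)))).

(** [Res] is the two-sided inverse of [lambda I - A_d : D(A_d) -> H]; only its
    values on the energy space matter. *)
Definition is_resolvent (beta : R) (a b : Cinf) (lambda : C) (Res : state -> state) : Prop :=
  (forall x, energy_space x ->
     Ad_domain (Res x) /\ sminus (sscal lambda (Res x)) (Ad beta a b (Res x)) = x) /\
  (forall y, Ad_domain y -> Res (sminus (sscal lambda y) (Ad beta a b y)) = y).

(** Operator norm on the energy space, [+oo] for an unbounded operator. *)
Definition op_norm (beta : R) (Res : state -> state) : Rbar :=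
  Lub_Rbar (fun r => exists x, energy_space x /\ energy_norm beta x <= 1 /\
                               r = energy_norm beta (Res x)).

(* Main.v *)
Require Import Defs.
From Stdlib Require Import Reals ZArith Lra Lia.
From Stdlib Require Import FunctionalExtensionality ClassicalEpsilon.
From Coquelicot Require Import Coquelicot.
Open Scope R_scope.

(** The undamped system is dispersive: oscillations of frequency [tau] have wave
    numbers of size [beta tau^2] and group velocity of size [1 / tau], so they
    need a time of order [tau] to go round the circle and meet the set where
    [a] is positive.  The bound [K |tau|] expresses this, and it is proved by a
    multiplier identity for the Fourier coefficients of a solution [(h, u)] of
    [(i tau - A_d) (h, u) = (f, g)].

    Pairing the system with [(h, P u)] ([energy_identity]) gives, in the real
    part, that [|a h|^2 + |b P u|^2] is at most the product of the norms of the
    data and of the solution, and, in the imaginary part, that the two halves of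
    the energy agree up to the same product divided by [tau]; hence it is enough
    to bound [h].  Let [q] be periodic with [q' = a^2 - m], [m > 0] the mean of
    [a^2].  Integrating by parts in [<h_x, q h>] yields
    [m |h|^2 = |a h|^2 + 2 Re <h_x, q h>] ([Re_ip_multiplier]).  Here [h_x] is
    [g - i tau u - b^2 P u], and since [beta T] is [- i sgn(D)] up to a smoothing
    operator, [i u] is [beta sgn(D) (f - i tau h - a^2 h)] up to a smoothing
    error ([u_of_h]).  The dangerous term [tau^2 Re (i <sgn(D) h, q h>)] is a
    multiple of [tau^2 <[q, sgn(D)] h, h>]; the kernel of the commutator lives
    on pairs of frequencies of opposite sign, so it is smoothing ([nrm_comm]), and
    the weak norms of [h] that remain gain the factor [1 / tau] through the
    equations ([jinv_h_bound], [jinv_u_bound]).  The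
    term [tau <sgn(D) a^2 h, q h>] costs [tau |a h|^2] and another commutator,
    which the dissipation pays for.  [multiplier_estimate] collects these bounds
    and [absorption] closes the estimate; [apriori] extends it to the whole
    domain by truncation.

    The resolvent is then constructed by continuation.  In terms of
    [y = P^(1/2) u] the operator [lambda - A_d] is a diagonal skew-adjoint
    operator plus [lambda] plus a bounded nonnegative damping ([full_op]).  It is
    onto for large [Re lambda], where the damping is a small perturbation, then
    for all [Re lambda > 0] by dissipativity, then on the imaginary axis by the
    a priori estimate; each step is an instance of [perturb_onto].

    The passage between distributions and sequences rests on [fourier_inj]:
    averages of a test function against powers of [(1 + cos) / 2] are
    trigonometric polynomials and converge in every [C^N] norm.  It turns
    multiplication by a smooth function into a convolution ([fourier_dmul]). *)

(** * Sums over the integers *)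

Fixpoint zsum (n : nat) (f : Z -> R) : R :=
  match n with
  | O => f 0%Z
  | S m => zsum m f + (f (Z.of_nat (S m)) + f (- Z.of_nat (S m))%Z)
  end.

Lemma zsum_ext n f g : (forall k, f k = g k) -> zsum n f = zsum n g.
Proof. intros H; induction n as [|n IH]; simpl; [apply H | now rewrite IH, !H]. Qed.

Lemma zsum_plus n f g : zsum n (fun k => f k + g k) = zsum n f + zsum n g.
Proof. induction n as [|n IH]; cbn [zsum]; [reflexivity | rewrite IH; ring]. Qed.

Lemma zsum_scal n c f : zsum n (fun k => c * f k) = c * zsum n f.
Proof. induction n as [|n IH]; cbn [zsum]; [reflexivity | rewrite IH; ring]. Qed.

Lemma zsum_le n f g : (forall k, f k <= g k) -> zsum n f <= zsum n g.
Proof.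
  intros H; induction n as [|n IH]; cbn [zsum]; [apply H|].
  pose proof (H (Z.of_nat (S n))); pose proof (H (- Z.of_nat (S n))%Z); lra.
Qed.

Lemma zsum_ge_0 n f : (forall k, 0 <= f k) -> 0 <= zsum n f.
Proof.
  intros H; induction n as [|n IH]; cbn [zsum]; [apply H|].
  pose proof (H (Z.of_nat (S n))); pose proof (H (- Z.of_nat (S n))%Z); lra.
Qed.

Lemma zsum_term n f k : (forall k, 0 <= f k) -> (Z.abs k <= Z.of_nat n)%Z -> f k <= zsum n f.
Proof.
  intros H; induction n as [|n IH]; intros Hk; cbn [zsum].
  - replace k with 0%Z by lia; lra.
  - pose proof (H (Z.of_nat (S n))); pose proof (H (- Z.of_nat (S n))%Z).
    pose proof (zsum_ge_0 n f H).
    destruct (Z_le_gt_dec (Z.abs k) (Z.of_nat n)) as [E|E]; [specialize (IH E); lra|].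
    assert (k = Z.of_nat (S n) \/ k = (- Z.of_nat (S n))%Z) as [->| ->] by lia; lra.
Qed.

Lemma zsum_sum_n n f :
  zsum (S n) f = f 0%Z + sum_n (fun m => f (Z.of_nat (S m)) + f (- Z.of_nat (S m))%Z) n.
Proof.
  rewrite sum_n_Reals; induction n as [|n IH]; [reflexivity|].
  change (zsum (S (S n)) f) with (zsum (S n) f + (f (Z.of_nat (S (S n))) + f (- Z.of_nat (S (S n)))%Z)).
  rewrite IH, tech5; ring.
Qed.

Lemma zsum_lim f : ex_sumZ f -> is_lim_seq (fun n => zsum n f) (sumZ f).
Proof.
  intros H; apply is_lim_seq_incr_1.
  apply (is_lim_seq_ext (fun n => f 0%Z +
    sum_n (fun m => f (Z.of_nat (S m)) + f (- Z.of_nat (S m))%Z) n)).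
  { intros n; symmetry; apply zsum_sum_n. }
  apply (is_lim_seq_plus' (fun _ => f 0%Z)); [apply is_lim_seq_const|].
  exact (Series_correct _ H).
Qed.

Lemma zsum_lim_ex f (l : R) : is_lim_seq (fun n => zsum n f) l -> ex_sumZ f /\ sumZ f = l.
Proof.
  intros H.
  assert (E : is_series (fun m => f (Z.of_nat (S m)) + f (- Z.of_nat (S m))%Z) (l - f 0%Z)).
  { change (is_lim_seq (sum_n (fun m => f (Z.of_nat (S m)) + f (- Z.of_nat (S m))%Z)) (l - f 0%Z)).
    apply (is_lim_seq_ext (fun n => zsum (S n) f - f 0%Z)).
    { intros n; rewrite zsum_sum_n; ring. }
    apply is_lim_seq_minus'; [|apply is_lim_seq_const].
    now apply (is_lim_seq_incr_1 (fun n => zsum n f)). }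
  split; [exists (l - f 0%Z); exact E|].
  unfold sumZ; rewrite (is_series_unique _ _ E); ring.
Qed.

Lemma zsum_incr f n : (forall k, 0 <= f k) -> zsum n f <= zsum (S n) f.
Proof.
  intros H; cbn [zsum].
  pose proof (H (Z.of_nat (S n))); pose proof (H (- Z.of_nat (S n))%Z); lra.
Qed.

Lemma zsum_le_sumZ f n : (forall k, 0 <= f k) -> ex_sumZ f -> zsum n f <= sumZ f.
Proof.
  intros H E; apply (is_lim_seq_incr_compare (fun n => zsum n f)); [now apply zsum_lim|].
  intros m; now apply zsum_incr.
Qed.

Lemma sumZ_bounded f M : (forall k, 0 <= f k) -> (forall n, zsum n f <= M) ->
  ex_sumZ f /\ sumZ f <= M.
Proof.
  intros H B.
  destruct (ex_finite_lim_seq_incr (fun n => zsum n f) M) as [l Hl]; auto.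
  { intros n; now apply zsum_incr. }
  destruct (zsum_lim_ex f l Hl) as [E ->]; split; auto.
  exact (is_lim_seq_le (fun n => zsum n f) (fun _ => M) l M B Hl (is_lim_seq_const M)).
Qed.

Lemma sumZ_ge_0 f : (forall k, 0 <= f k) -> ex_sumZ f -> 0 <= sumZ f.
Proof. intros H E; apply Rle_trans with (2 := zsum_le_sumZ f 0 H E), H. Qed.

Lemma sumZ_term f k : (forall k, 0 <= f k) -> ex_sumZ f -> f k <= sumZ f.
Proof.
  intros H E; apply Rle_trans with (2 := zsum_le_sumZ f (Z.to_nat (Z.abs k)) H E).
  apply zsum_term; auto; lia.
Qed.

Lemma ex_sumZ_ext f g : (forall k, f k = g k) -> ex_sumZ f -> ex_sumZ g.
Proof. intros H; apply ex_series_ext; intros n; now rewrite !H. Qed.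

Lemma ex_sumZ_plus f g : ex_sumZ f -> ex_sumZ g -> ex_sumZ (fun k => f k + g k).
Proof.
  intros Hf Hg; destruct (zsum_lim_ex (fun k => f k + g k) (sumZ f + sumZ g)); auto.
  apply (is_lim_seq_ext (fun n => zsum n f + zsum n g)).
  { intros n; now rewrite zsum_plus. }
  apply is_lim_seq_plus'; now apply zsum_lim.
Qed.

Lemma sumZ_plus f g : ex_sumZ f -> ex_sumZ g -> sumZ (fun k => f k + g k) = sumZ f + sumZ g.
Proof.
  intros Hf Hg; destruct (zsum_lim_ex (fun k => f k + g k) (sumZ f + sumZ g)); auto.
  apply (is_lim_seq_ext (fun n => zsum n f + zsum n g)).
  { intros n; now rewrite zsum_plus. }
  apply is_lim_seq_plus'; now apply zsum_lim.
Qed.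

Lemma ex_sumZ_scal c f : ex_sumZ f -> ex_sumZ (fun k => c * f k).
Proof.
  intros Hf; destruct (zsum_lim_ex (fun k => c * f k) (c * sumZ f)); auto.
  apply (is_lim_seq_ext (fun n => c * zsum n f)).
  { intros n; now rewrite zsum_scal. }
  apply (is_lim_seq_scal_l _ c (sumZ f)); now apply zsum_lim.
Qed.

Lemma sumZ_scal c f : sumZ (fun k => c * f k) = c * sumZ f.
Proof.
  unfold sumZ; rewrite <- (Series_ext (fun n => c * (f (Z.of_nat (S n)) + f (- Z.of_nat (S n))%Z)))
    by (intros n; ring).
  rewrite Series_scal_l; ring.
Qed.

Lemma ex_sumZ_le f g : (forall k, Rabs (f k) <= g k) -> ex_sumZ g -> ex_sumZ f.
Proof.
  intros H E; unfold ex_sumZ in *; refine (ex_series_le (V := R_CompleteNormedModule) _ _ _ E).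
  intros n; apply Rle_trans with (1 := Rabs_triang _ _); apply Rplus_le_compat; apply H.
Qed.

Lemma sumZ_le f g : (forall k, f k <= g k) -> ex_sumZ f -> ex_sumZ g -> sumZ f <= sumZ g.
Proof.
  intros H Ef Eg.
  apply (is_lim_seq_le (fun n => zsum n f) (fun n => zsum n g) (sumZ f) (sumZ g));
    auto using zsum_lim, zsum_le.
Qed.

Lemma zsum_opp_arg n f : zsum n (fun k => f (- k)%Z) = zsum n f.
Proof.
  induction n as [|n IH]; cbn [zsum]; [reflexivity|].
  rewrite IH, Z.opp_involutive; ring.
Qed.

Lemma zsum_succ_arg n f :
  zsum n (fun k => f (k + 1)%Z) + f (- Z.of_nat n)%Z = zsum n f + f (Z.of_nat n + 1)%Z.
Proof.
  induction n as [|n IH]; cbn [zsum]; [simpl; ring|].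
  replace (- Z.of_nat (S n) + 1)%Z with (- Z.of_nat n)%Z by lia.
  replace (Z.of_nat n + 1)%Z with (Z.of_nat (S n)) in IH by lia.
  lra.
Qed.

(** Shifting by one moves a single term across each end of a symmetric sum; other
    shifts follow by iteration and reflection. *)
Lemma zsum_shift_le f M : (forall k, 0 <= f k) -> (forall n, zsum n f <= M) ->
  forall (j : Z) n, zsum n (fun k => f (k + j)%Z) <= M.
Proof.
  assert (U : forall g M, (forall k, 0 <= g k) -> (forall n, zsum n g <= M) ->
    forall n, zsum n (fun k => g (k + 1)%Z) <= M).
  { intros g L Hg B n; pose proof (zsum_succ_arg n g) as E.
    pose proof (B (S n)) as B'; cbn [zsum] in B'.
    replace (Z.of_nat n + 1)%Z with (Z.of_nat (S n)) in E by lia.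
    pose proof (Hg (- Z.of_nat n)%Z); pose proof (Hg (- Z.of_nat (S n))%Z); lra. }
  assert (P : forall i g M, (forall k, 0 <= g k) -> (forall n, zsum n g <= M) ->
    forall n, zsum n (fun k => g (k + Z.of_nat i)%Z) <= M).
  { induction i as [|i IH]; intros g L Hg B n.
    - rewrite (zsum_ext _ _ g); auto; intros k; f_equal; lia.
    - rewrite (zsum_ext _ _ (fun k => g (k + 1 + Z.of_nat i)%Z)).
      + apply (U (fun k => g (k + Z.of_nat i)%Z)); auto.
      + intros k; f_equal; lia. }
  intros Hf B j n; destruct (Z_le_gt_dec 0 j) as [Hj|Hj].
  - rewrite <- (Z2Nat.id j Hj); apply (P _ f M); auto.
  - rewrite <- zsum_opp_arg.
    rewrite (zsum_ext _ _ (fun k => (fun i => f (- i)%Z) (k + Z.of_nat (Z.to_nat (- j)))%Z)).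
    + apply (P _ (fun i => f (- i)%Z)); auto; intros m; rewrite zsum_opp_arg; auto.
    + intros k; f_equal; lia.
Qed.

Lemma ex_sumZ_shift f j : (forall k, 0 <= f k) -> ex_sumZ f ->
  ex_sumZ (fun k => f (k + j)%Z) /\ sumZ (fun k => f (k + j)%Z) <= sumZ f.
Proof.
  intros H E; apply sumZ_bounded; auto; apply zsum_shift_le; auto.
  intros n; now apply zsum_le_sumZ.
Qed.

Lemma ex_sumZ_reflect f k : (forall k, 0 <= f k) -> ex_sumZ f ->
  ex_sumZ (fun j => f (k - j)%Z) /\ sumZ (fun j => f (k - j)%Z) <= sumZ f.
Proof.
  intros H E; apply sumZ_bounded; auto; intros n.
  rewrite <- zsum_opp_arg.
  rewrite (zsum_ext _ _ (fun i => f (i + k)%Z)) by (intros i; f_equal; lia).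
  apply zsum_shift_le; auto; intros m; now apply zsum_le_sumZ.
Qed.

Lemma ex_sumZ_zsum (F : Z -> Z -> R) n : (forall j, ex_sumZ (fun k => F k j)) ->
  ex_sumZ (fun k => zsum n (F k)) /\
  sumZ (fun k => zsum n (F k)) = zsum n (fun j => sumZ (fun k => F k j)).
Proof.
  intros H; induction n as [|n [IH1 IH2]]; cbn [zsum]; [split; auto|].
  assert (E := ex_sumZ_plus _ _ (H (Z.of_nat (S n))) (H (- Z.of_nat (S n))%Z)).
  split; [now apply ex_sumZ_plus|].
  rewrite sumZ_plus, IH2, sumZ_plus; auto.
Qed.

(** A finite sum over [j] commutes with the sum over [k], and the total bounds
    every such finite sum. *)
Lemma tonelli_le (F : Z -> Z -> R) : (forall k j, 0 <= F k j) ->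
  (forall k, ex_sumZ (F k)) -> ex_sumZ (fun k => sumZ (F k)) ->
  (forall j, ex_sumZ (fun k => F k j)) /\ ex_sumZ (fun j => sumZ (fun k => F k j)) /\
  sumZ (fun j => sumZ (fun k => F k j)) <= sumZ (fun k => sumZ (F k)).
Proof.
  intros H R1 R2.
  assert (C1 : forall j, ex_sumZ (fun k => F k j)).
  { intros j; apply (ex_sumZ_le _ (fun k => sumZ (F k))); auto.
    intros k; rewrite Rabs_pos_eq by auto; now apply (sumZ_term (F k)). }
  split; auto; apply sumZ_bounded.
  - intros j; now apply sumZ_ge_0.
  - intros n; destruct (ex_sumZ_zsum F n C1) as [E <-]; apply sumZ_le; auto.
    intros k; now apply zsum_le_sumZ.
Qed.

Lemma tonelli (F : Z -> Z -> R) : (forall k j, 0 <= F k j) ->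
  (forall k, ex_sumZ (F k)) -> ex_sumZ (fun k => sumZ (F k)) ->
  sumZ (fun j => sumZ (fun k => F k j)) = sumZ (fun k => sumZ (F k)).
Proof.
  intros H R1 R2; destruct (tonelli_le F H R1 R2) as [C1 [C2 L]].
  destruct (tonelli_le (fun j k => F k j)) as [_ [_ L']]; auto.
  apply Rle_antisym; auto.
Qed.

(** Splitting [F] as [(|F| + F) - |F|] reduces the signed case to the
    nonnegative one. *)
Lemma fubini (F : Z -> Z -> R) :
  (forall k, ex_sumZ (fun j => Rabs (F k j))) ->
  ex_sumZ (fun k => sumZ (fun j => Rabs (F k j))) ->
  sumZ (fun j => sumZ (fun k => F k j)) = sumZ (fun k => sumZ (F k)).
Proof.
  intros R1 R2.
  assert (HA : forall k j, 0 <= Rabs (F k j)) by (intros; apply Rabs_pos).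
  destruct (tonelli_le (fun k j => Rabs (F k j)) HA R1 R2) as [C1 [C2 _]].
  pose proof (tonelli (fun k j => Rabs (F k j)) HA R1 R2) as TA.
  set (G := fun k j => Rabs (F k j) + F k j).
  assert (HG : forall k j, 0 <= G k j).
  { intros k j; unfold G; pose proof (Rle_abs (- F k j)); rewrite Rabs_Ropp in *; lra. }
  assert (RF : forall k, ex_sumZ (F k)).
  { intros k; apply (ex_sumZ_le _ (fun j => Rabs (F k j))); auto; intros; lra. }
  assert (CF : forall j, ex_sumZ (fun k => F k j)).
  { intros j; apply (ex_sumZ_le _ (fun k => Rabs (F k j))); auto; intros; lra. }
  assert (RG : forall k, ex_sumZ (G k)) by (intros k; now apply ex_sumZ_plus).
  assert (LE : forall f, ex_sumZ f -> ex_sumZ (fun k => Rabs (f k)) ->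
    Rabs (sumZ f) <= sumZ (fun k => Rabs (f k))).
  { intros f E1 E2; apply Rabs_le; split.
    - assert (- sumZ (fun k => Rabs (f k)) = sumZ (fun k => -1 * Rabs (f k))) as ->
        by (rewrite sumZ_scal; ring).
      apply sumZ_le; auto using ex_sumZ_scal.
      intros k; pose proof (Rle_abs (- f k)); rewrite Rabs_Ropp in *; lra.
    - apply sumZ_le; auto; intros k; apply Rle_abs. }
  assert (RF2 : ex_sumZ (fun k => sumZ (F k))).
  { apply (ex_sumZ_le _ (fun k => sumZ (fun j => Rabs (F k j)))); auto. }
  assert (CF2 : ex_sumZ (fun j => sumZ (fun k => F k j))).
  { apply (ex_sumZ_le _ (fun j => sumZ (fun k => Rabs (F k j)))); auto. }
  assert (SG : forall k, sumZ (G k) = sumZ (fun j => Rabs (F k j)) + sumZ (F k))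
    by (intros k; now apply sumZ_plus).
  assert (RG2 : ex_sumZ (fun k => sumZ (G k))).
  { apply (ex_sumZ_ext (fun k => sumZ (fun j => Rabs (F k j)) + sumZ (F k))); auto.
    now apply ex_sumZ_plus. }
  pose proof (tonelli G HG RG RG2) as TG.
  rewrite (sumZ_ext (fun k => sumZ (G k)) _ SG), sumZ_plus in TG by auto.
  rewrite (sumZ_ext (fun j => sumZ (fun k => G k j))
    (fun j => sumZ (fun k => Rabs (F k j)) + sumZ (fun k => F k j))) in TG
    by (intros j; now apply (sumZ_plus (fun k => Rabs (F k j)) (fun k => F k j))).
  rewrite sumZ_plus in TG by auto.
  lra.
Qed.

(** * Square-summable sequences and kernel operators *)

Lemma seq_ext (v w : Z -> C) : (forall k, v k = w k) -> v = w.
Proof. apply functional_extensionality. Qed.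

Definition cabs (f : Z -> C) : Prop := ex_sumZ (fun k => Cmod (f k)).

Lemma cabs_ext f g : (forall k, f k = g k) -> cabs f -> cabs g.
Proof. intros H; apply ex_sumZ_ext; intros k; now rewrite H. Qed.

Lemma cabs_le f g : (forall k, Cmod (f k) <= g k) -> ex_sumZ g -> cabs f.
Proof.
  intros H; apply ex_sumZ_le; intros k; rewrite Rabs_pos_eq by apply Cmod_ge_0; auto.
Qed.

Lemma cabs_re f : cabs f -> ex_sumZ (fun k => Re (f k)).
Proof. apply ex_sumZ_le; intros k; apply re_le_Cmod. Qed.

Lemma cabs_im f : cabs f -> ex_sumZ (fun k => Im (f k)).
Proof. apply ex_sumZ_le; intros k; apply im_le_Cmod. Qed.

Lemma cabs_scal c f : cabs f -> cabs (fun k => c * f k)%C.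
Proof.
  intros Hf; apply (cabs_le _ (fun k => Cmod c * Cmod (f k)));
    [intros k; rewrite Cmod_mult; lra | now apply ex_sumZ_scal].
Qed.

Lemma CsumZ_ext f g : (forall k, f k = g k) -> CsumZ f = CsumZ g.
Proof. intros H; unfold CsumZ; f_equal; apply sumZ_ext; intros k; now rewrite H. Qed.

Lemma CsumZ_plus f g : cabs f -> cabs g ->
  CsumZ (fun k => f k + g k)%C = (CsumZ f + CsumZ g)%C.
Proof.
  intros Hf Hg; apply injective_projections; simpl.
  - now rewrite <- sumZ_plus by auto using cabs_re.
  - now rewrite <- sumZ_plus by auto using cabs_im.
Qed.

Lemma CsumZ_scal c f : cabs f -> CsumZ (fun k => c * f k)%C = (c * CsumZ f)%C.
Proof.
  intros Hf; pose proof (cabs_re f Hf); pose proof (cabs_im f Hf).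
  apply injective_projections; simpl.
  - rewrite (sumZ_ext _ (fun k => Re c * Re (f k) + - Im c * Im (f k)))
      by (intros k; simpl; unfold Re, Im; ring).
    rewrite sumZ_plus, !sumZ_scal by now apply ex_sumZ_scal.
    unfold Re, Im; ring.
  - rewrite (sumZ_ext _ (fun k => Re c * Im (f k) + Im c * Re (f k)))
      by (intros k; simpl; unfold Re, Im; ring).
    rewrite sumZ_plus, !sumZ_scal by now apply ex_sumZ_scal.
    unfold Re, Im; ring.
Qed.

Lemma CsumZ_conj f : CsumZ (fun k => Cconj (f k)) = Cconj (CsumZ f).
Proof.
  apply injective_projections; simpl; [reflexivity|].
  rewrite (sumZ_ext _ (fun k => -1 * Im (f k))) by (intros k; unfold Im; simpl; ring).
  rewrite sumZ_scal; ring.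
Qed.

Lemma CsumZ_RtoC f : CsumZ (fun k => RtoC (f k)) = RtoC (sumZ f).
Proof.
  apply injective_projections; simpl; [reflexivity|].
  rewrite (sumZ_ext _ (fun k => 0 * 0)) by (intros k; simpl; ring).
  rewrite sumZ_scal; ring.
Qed.

(** Rotating the sum onto the positive axis turns its modulus into a sum of
    real parts. *)
Lemma Cmod_CsumZ_le f : cabs f -> Cmod (CsumZ f) <= sumZ (fun k => Cmod (f k)).
Proof.
  intros Hf; set (z := CsumZ f).
  destruct (Req_dec (Cmod z) 0) as [E|E].
  { rewrite E; apply sumZ_ge_0; auto using Cmod_ge_0. }
  set (c := (Cconj z / RtoC (Cmod z))%C).
  assert (E' : RtoC (Cmod z) <> 0%C) by (intros A; apply RtoC_inj in A; auto).
  assert (Hc : Cmod c = 1).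
  { unfold c; rewrite Cmod_div, Cmod_conj, Cmod_R, Rabs_pos_eq by auto using Cmod_ge_0.
    field; auto. }
  assert (Hz : RtoC (Cmod z) = (c * z)%C).
  { transitivity (RtoC (Cmod z ^ 2) / RtoC (Cmod z))%C.
    - rewrite RtoC_pow; field; auto.
    - unfold c; rewrite Cmod2_conj; field; auto. }
  rewrite <- (re_RtoC (Cmod z)), Hz; unfold z; rewrite <- CsumZ_scal by auto.
  change (sumZ (fun k => Re (c * f k)%C) <= sumZ (fun k => Cmod (f k))); apply sumZ_le; auto.
  - intros k; apply Rle_trans with (1 := Rle_abs _), Rle_trans with (1 := re_le_Cmod _).
    rewrite Cmod_mult, Hc; lra.
  - now apply (cabs_re (fun k => (c * f k)%C)), cabs_scal.
Qed.

Lemma CsumZ_fubini (F : Z -> Z -> C) :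
  (forall k, cabs (F k)) -> ex_sumZ (fun k => sumZ (fun j => Cmod (F k j))) ->
  CsumZ (fun j => CsumZ (fun k => F k j)) = CsumZ (fun k => CsumZ (F k)).
Proof.
  intros R1 R2.
  assert (D : forall P : C -> R, (forall z, Rabs (P z) <= Cmod z) ->
    sumZ (fun j => sumZ (fun k => P (F k j))) = sumZ (fun k => sumZ (fun j => P (F k j)))).
  { intros P HP; apply (fubini (fun k j => P (F k j))).
    - intros k; apply (ex_sumZ_le _ (fun j => Cmod (F k j))); [|apply R1].
      intros j; rewrite Rabs_Rabsolu; apply HP.
    - apply (ex_sumZ_le _ (fun k => sumZ (fun j => Cmod (F k j)))); auto.
      intros k.
      assert (E : ex_sumZ (fun j => Rabs (P (F k j)))).
      { apply (ex_sumZ_le _ (fun j => Cmod (F k j))); [|apply R1].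
        intros j; rewrite Rabs_Rabsolu; apply HP. }
      rewrite Rabs_pos_eq by (apply sumZ_ge_0; auto; intros; apply Rabs_pos).
      apply sumZ_le; [intros j; apply HP | auto | apply R1]. }
  apply injective_projections; simpl.
  - exact (D Re re_le_Cmod).
  - exact (D Im im_le_Cmod).
Qed.

Definition l2 (v : Z -> C) : Prop := ex_sumZ (fun k => Cmod (v k) ^ 2).

Definition nrm (v : Z -> C) : R := sqrt (sumZ (fun k => Cmod (v k) ^ 2)).

Definition ip (v w : Z -> C) : C := CsumZ (fun k => v k * Cconj (w k))%C.

Definition vadd (v w : Z -> C) : Z -> C := fun k => (v k + w k)%C.

Definition dg (m : Z -> C) (v : Z -> C) : Z -> C := fun k => (m k * v k)%C.

Definition vscal (c : C) : (Z -> C) -> Z -> C := dg (fun _ => c).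

Lemma l2_le v w (c : R) : (forall k, Cmod (v k) <= c * Cmod (w k)) -> l2 w -> l2 v.
Proof.
  intros H Hw; apply (ex_sumZ_le _ (fun k => c ^ 2 * Cmod (w k) ^ 2)).
  - intros k; rewrite Rabs_pos_eq by apply pow2_ge_0.
    rewrite <- Rpow_mult_distr; apply pow_incr; split; auto using Cmod_ge_0.
  - now apply ex_sumZ_scal.
Qed.

Lemma l2_prod v w : l2 v -> l2 w -> ex_sumZ (fun k => Cmod (v k) * Cmod (w k)).
Proof.
  intros Hv Hw.
  apply (ex_sumZ_le _ (fun k => Cmod (v k) ^ 2 + Cmod (w k) ^ 2)); [|now apply ex_sumZ_plus].
  intros k; pose proof (Cmod_ge_0 (v k)); pose proof (Cmod_ge_0 (w k)).
  rewrite Rabs_pos_eq by nra; nra.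
Qed.

Lemma nrm_ge_0 v : 0 <= nrm v.
Proof. apply sqrt_pos. Qed.

Lemma nrm_sqr v : l2 v -> nrm v ^ 2 = sumZ (fun k => Cmod (v k) ^ 2).
Proof.
  intros H; unfold nrm; rewrite pow2_sqrt; auto.
  apply sumZ_ge_0; auto; intros k; apply pow2_ge_0.
Qed.

Lemma nrm_le_of_zsum v M : 0 <= M -> (forall n, zsum n (fun k => Cmod (v k) ^ 2) <= M ^ 2) ->
  l2 v /\ nrm v <= M.
Proof.
  intros HM H; destruct (sumZ_bounded (fun k => Cmod (v k) ^ 2) (M ^ 2)) as [E L]; auto.
  { intros k; apply pow2_ge_0. }
  split; auto; unfold nrm; rewrite <- (sqrt_pow2 M) by auto; now apply sqrt_le_1_alt.
Qed.

Lemma zsum_le_nrm v n : l2 v -> zsum n (fun k => Cmod (v k) ^ 2) <= nrm v ^ 2.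
Proof.
  intros H; rewrite nrm_sqr by auto; apply (zsum_le_sumZ (fun k => Cmod (v k) ^ 2)); auto.
  intros k; apply pow2_ge_0.
Qed.

Lemma nrm_term v k : l2 v -> Cmod (v k) <= nrm v.
Proof.
  intros H.
  rewrite <- (sqrt_pow2 (Cmod (v k))) by apply Cmod_ge_0; unfold nrm.
  apply sqrt_le_1_alt, (sumZ_term (fun k => Cmod (v k) ^ 2)); auto.
  intros j; apply pow2_ge_0.
Qed.

(** The quadratic polynomial [sum (x |v| - |w|)^2] in [x] is nonnegative. *)
Lemma cauchy_schwarz v w : l2 v -> l2 w ->
  sumZ (fun k => Cmod (v k) * Cmod (w k)) <= nrm v * nrm w.
Proof.
  intros Hv Hw; set (X := sumZ _).
  pose proof (nrm_sqr v Hv) as A; pose proof (nrm_sqr w Hw) as B.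
  pose proof (nrm_ge_0 v); pose proof (nrm_ge_0 w).
  set (a := nrm v) in *; set (b := nrm w) in *.
  assert (HX : 0 <= X).
  { apply sumZ_ge_0; [|now apply l2_prod].
    intros k; apply Rmult_le_pos; apply Cmod_ge_0. }
  assert (Q : forall x, 0 <= x ^ 2 * a ^ 2 + - 2 * x * X + b ^ 2).
  { intros x; rewrite A, B; unfold X; rewrite <- sumZ_lin; auto using l2_prod.
    apply sumZ_ge_0.
    - intros k; replace (x ^ 2 * _ + _ + _) with ((x * Cmod (v k) - Cmod (w k)) ^ 2) by ring.
      apply pow2_ge_0.
    - apply ex_sumZ_plus; auto; apply ex_sumZ_plus; apply ex_sumZ_scal; auto using l2_prod. }
  destruct (Req_dec a 0) as [E|E].
  - rewrite E in *; destruct (Req_dec X 0) as [E'|E']; [lra|].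
    specialize (Q ((b ^ 2 + 1) / (2 * X))).
    replace (((b ^ 2 + 1) / (2 * X)) ^ 2 * 0 ^ 2 + - 2 * ((b ^ 2 + 1) / (2 * X)) * X + b ^ 2)
      with (- 1) in Q by (field; auto); lra.
  - specialize (Q (X / a ^ 2)).
    replace ((X / a ^ 2) ^ 2 * a ^ 2 + - 2 * (X / a ^ 2) * X + b ^ 2)
      with (((a * b) ^ 2 - X ^ 2) / a ^ 2) in Q by (field; auto).
    assert (0 < a ^ 2) by nra.
    assert (X ^ 2 <= (a * b) ^ 2).
    { apply (Rmult_le_compat_l (a ^ 2)) in Q; [|lra].
      replace (a ^ 2 * (((a * b) ^ 2 - X ^ 2) / a ^ 2)) with ((a * b) ^ 2 - X ^ 2) in Q
        by (field; auto); lra. }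
    assert (0 <= a * b) by nra; nra.
Qed.

Lemma ip_cabs v w : l2 v -> l2 w -> cabs (fun k => v k * Cconj (w k))%C.
Proof.
  intros Hv Hw; apply (cabs_le _ (fun k => Cmod (v k) * Cmod (w k))); [|now apply l2_prod].
  intros k; rewrite Cmod_mult, Cmod_conj; lra.
Qed.

Lemma ip_le v w : l2 v -> l2 w -> Cmod (ip v w) <= nrm v * nrm w.
Proof.
  intros Hv Hw; apply Rle_trans with (2 := cauchy_schwarz v w Hv Hw).
  apply Rle_trans with (1 := Cmod_CsumZ_le _ (ip_cabs v w Hv Hw)), Req_le, sumZ_ext.
  intros k; now rewrite Cmod_mult, Cmod_conj.
Qed.

Lemma l2_add v w : l2 v -> l2 w -> l2 (vadd v w).
Proof.
  intros Hv Hw; unfold vadd.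
  apply (ex_sumZ_le _ (fun k => 2 * Cmod (v k) ^ 2 + 2 * Cmod (w k) ^ 2)).
  - intros k; rewrite Rabs_pos_eq by apply pow2_ge_0.
    pose proof (Cmod_triangle (v k) (w k)); pose proof (Cmod_ge_0 (v k + w k)).
    apply Rle_trans with ((Cmod (v k) + Cmod (w k)) ^ 2); [apply pow_incr; lra|].
    pose proof (pow2_ge_0 (Cmod (v k) - Cmod (w k))); lra.
  - apply ex_sumZ_plus; now apply ex_sumZ_scal.
Qed.

Lemma nrm_add v w : l2 v -> l2 w -> nrm (vadd v w) <= nrm v + nrm w.
Proof.
  intros Hv Hw; pose proof (nrm_ge_0 v); pose proof (nrm_ge_0 w).
  apply nrm_le_of_zsum; [lra|]; intros n.
  apply Rle_trans with (sumZ (fun k => 1 * Cmod (v k) ^ 2 + 2 * (Cmod (v k) * Cmod (w k)) +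
    Cmod (w k) ^ 2)).
  - apply Rle_trans with (zsum n (fun k => 1 * Cmod (v k) ^ 2 + 2 * (Cmod (v k) * Cmod (w k)) +
    Cmod (w k) ^ 2)).
    + apply zsum_le; intros k; unfold vadd.
      pose proof (Cmod_triangle (v k) (w k)); pose proof (Cmod_ge_0 (v k + w k)).
      apply Rle_trans with ((Cmod (v k) + Cmod (w k)) ^ 2); [apply pow_incr; lra | lra].
    + apply (zsum_le_sumZ (fun k => 1 * Cmod (v k) ^ 2 + 2 * (Cmod (v k) * Cmod (w k)) +
        Cmod (w k) ^ 2)).
      * intros k; pose proof (Cmod_ge_0 (v k)); pose proof (Cmod_ge_0 (w k)); nra.
      * apply ex_sumZ_plus; auto; apply ex_sumZ_plus; apply ex_sumZ_scal; auto using l2_prod.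
  - rewrite sumZ_lin, <- !nrm_sqr by auto using l2_prod.
    pose proof (cauchy_schwarz v w Hv Hw); lra.
Qed.

Lemma l2_dg m v (B : R) : (forall k, Cmod (m k) <= B) -> l2 v -> l2 (dg m v).
Proof.
  intros HB; apply (l2_le _ _ B); intros k; unfold dg; rewrite Cmod_mult.
  apply Rmult_le_compat_r; auto using Cmod_ge_0.
Qed.

Lemma nrm_le v w (c : R) : 0 <= c -> (forall k, Cmod (v k) <= c * Cmod (w k)) -> l2 w ->
  nrm v <= c * nrm w.
Proof.
  intros Hc H Hw; pose proof (nrm_ge_0 w); apply nrm_le_of_zsum; [nra|]; intros n.
  apply Rle_trans with (zsum n (fun k => c ^ 2 * Cmod (w k) ^ 2)).
  - apply zsum_le; intros k; rewrite <- Rpow_mult_distr; apply pow_incr.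
    split; auto using Cmod_ge_0.
  - rewrite zsum_scal, Rpow_mult_distr; apply Rmult_le_compat_l; [apply pow2_ge_0|].
    now apply zsum_le_nrm.
Qed.

Lemma nrm_dg m v (B : R) : (forall k, Cmod (m k) <= B) -> l2 v -> nrm (dg m v) <= B * nrm v.
Proof.
  intros HB; apply nrm_le.
  - apply Rle_trans with (1 := Cmod_ge_0 _) (2 := HB 0%Z).
  - intros k; unfold dg; rewrite Cmod_mult; apply Rmult_le_compat_r; auto using Cmod_ge_0.
Qed.

Lemma l2_scal c v : l2 v -> l2 (vscal c v).
Proof. apply (l2_dg _ _ (Cmod c)); intros; lra. Qed.

Lemma nrm_scal c v : nrm (vscal c v) = Cmod c * nrm v.
Proof.
  unfold nrm, vscal, dg.
  rewrite (sumZ_ext _ (fun k => Cmod c ^ 2 * Cmod (v k) ^ 2))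
    by (intros k; rewrite Cmod_mult; ring).
  rewrite sumZ_scal, sqrt_mult_alt, sqrt_pow2; auto using Cmod_ge_0, pow2_ge_0.
Qed.

Lemma ip_add_l v v' w : l2 v -> l2 v' -> l2 w -> ip (vadd v v') w = (ip v w + ip v' w)%C.
Proof.
  intros; unfold ip; rewrite <- CsumZ_plus by auto using ip_cabs.
  apply CsumZ_ext; intros k; unfold vadd; ring.
Qed.

Lemma ip_scal_l c v w : l2 v -> l2 w -> ip (vscal c v) w = (c * ip v w)%C.
Proof.
  intros; unfold ip; rewrite <- CsumZ_scal by auto using ip_cabs.
  apply CsumZ_ext; intros k; unfold vscal, dg; ring.
Qed.

Lemma ip_conj v w : ip w v = Cconj (ip v w).
Proof.
  unfold ip; rewrite <- CsumZ_conj; apply CsumZ_ext; intros k.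
  rewrite Cmult_conj, Cconj_conj; ring.
Qed.

Lemma ip_self v : l2 v -> ip v v = RtoC (nrm v ^ 2).
Proof.
  intros H; rewrite nrm_sqr by auto; rewrite <- CsumZ_RtoC; apply CsumZ_ext; intros k.
  now rewrite Cmod2_conj.
Qed.

Lemma ip_dg (m : Z -> R) v w : ip (dg (fun k => RtoC (m k)) v) w = ip v (dg (fun k => RtoC (m k)) w).
Proof.
  apply CsumZ_ext; intros k; unfold dg; rewrite Cmult_conj.
  replace (Cconj (RtoC (m k))) with (RtoC (m k)); [ring|].
  apply injective_projections; simpl; ring.
Qed.

Definition kop (K : Z -> Z -> C) (v : Z -> C) : Z -> C :=
  fun k => CsumZ (fun j => K k j * v j)%C.

(** Domination by a summable convolution kernel, under which kernel operators are
    bounded on square-summable sequences. *)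
Definition kernel_le (K : Z -> Z -> C) (alpha : Z -> R) : Prop :=
  ex_sumZ alpha /\ forall k j, Cmod (K k j) <= alpha (k - j)%Z.

Lemma kernel_ge_0 K alpha : kernel_le K alpha -> forall m, 0 <= alpha m.
Proof.
  intros [_ H] m; specialize (H m 0%Z); rewrite Z.sub_0_r in H.
  apply Rle_trans with (1 := Cmod_ge_0 _) (2 := H).
Qed.

Lemma l2_bounded_cabs alpha k v : (forall m, 0 <= alpha m) -> ex_sumZ alpha -> l2 v ->
  ex_sumZ (fun j => alpha (k - j)%Z * Cmod (v j)).
Proof.
  intros H0 E Hv; destruct (ex_sumZ_reflect alpha k H0 E) as [E' _].
  apply (ex_sumZ_le _ (fun j => nrm v * alpha (k - j)%Z)); [|now apply ex_sumZ_scal].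
  intros j; pose proof (Cmod_ge_0 (v j)); rewrite Rabs_pos_eq by (apply Rmult_le_pos; auto).
  rewrite Rmult_comm; apply Rmult_le_compat_r; auto using nrm_term.
Qed.

Lemma kernel_cabs K alpha v k : kernel_le K alpha -> l2 v -> cabs (fun j => K k j * v j)%C.
Proof.
  intros HK Hv; pose proof (kernel_ge_0 K alpha HK) as H0; destruct HK as [E HK].
  apply (cabs_le _ (fun j => alpha (k - j)%Z * Cmod (v j))).
  - intros j; rewrite Cmod_mult; apply Rmult_le_compat_r; auto using Cmod_ge_0.
  - now apply l2_bounded_cabs.
Qed.

(** Schur test: Cauchy-Schwarz for the weights [alpha (k - j)], then exchange of
    the two sums. *)
Lemma schur_conv alpha v : (forall m, 0 <= alpha m) -> ex_sumZ alpha -> l2 v ->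
  l2 (fun k => RtoC (sumZ (fun j => alpha (k - j)%Z * Cmod (v j)))) /\
  nrm (fun k => RtoC (sumZ (fun j => alpha (k - j)%Z * Cmod (v j)))) <= sumZ alpha * nrm v.
Proof.
  intros H0 E Hv; set (A := sumZ alpha).
  assert (HA : 0 <= A) by now apply sumZ_ge_0.
  pose proof (nrm_ge_0 v) as Hn.
  set (F := fun k j => alpha (k - j)%Z * Cmod (v j) ^ 2).
  assert (F0 : forall k j, 0 <= F k j)
    by (intros; apply Rmult_le_pos; auto using pow2_ge_0).
  assert (FC : forall j, ex_sumZ (fun k => F k j) /\ sumZ (fun k => F k j) <= A * Cmod (v j) ^ 2).
  { intros j; destruct (ex_sumZ_shift alpha (- j) H0 E) as [E1 E2].
    split.
    - apply (ex_sumZ_ext (fun k => Cmod (v j) ^ 2 * alpha (k + - j)%Z)); [|now apply ex_sumZ_scal].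
      intros k; apply Rmult_comm.
    - rewrite (sumZ_ext _ (fun k => Cmod (v j) ^ 2 * alpha (k + - j)%Z))
        by (intros k; apply Rmult_comm).
      rewrite sumZ_scal, Rmult_comm; apply Rmult_le_compat_r; auto using pow2_ge_0. }
  assert (C2 : ex_sumZ (fun j => sumZ (fun k => F k j)) /\
               sumZ (fun j => sumZ (fun k => F k j)) <= A * nrm v ^ 2).
  { rewrite nrm_sqr, <- sumZ_scal by auto.
    assert (X : ex_sumZ (fun j => sumZ (fun k => F k j))).
    { apply (ex_sumZ_le _ (fun j => A * Cmod (v j) ^ 2)); [|now apply ex_sumZ_scal].
      intros j; rewrite Rabs_pos_eq by (apply sumZ_ge_0; auto; apply FC); apply FC. }
    split; auto; apply sumZ_le; auto; [intros j; apply FC | now apply ex_sumZ_scal]. }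
  destruct C2 as [C2 C3].
  destruct (tonelli_le (fun j k => F k j)) as [R1 [R2 R3]]; auto; [intros j; apply FC|].
  apply nrm_le_of_zsum; [nra|]; intros n.
  apply Rle_trans with (sumZ (fun k => A * sumZ (F k))).
  2:{ rewrite sumZ_scal; simpl in R3; unfold F in *.
      replace ((A * nrm v) ^ 2) with (A * (A * nrm v ^ 2)) by ring.
      apply Rmult_le_compat_l; auto; lra. }
  apply Rle_trans with (zsum n (fun k => A * sumZ (F k))).
  2:{ apply zsum_le_sumZ; [|now apply ex_sumZ_scal].
      intros k; apply Rmult_le_pos; auto; apply sumZ_ge_0; auto. }
  apply zsum_le; intros k.
  destruct (ex_sumZ_reflect alpha k H0 E) as [E1 E2].
  assert (S0 : 0 <= sumZ (fun j => alpha (k - j)%Z * Cmod (v j))).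
  { apply sumZ_ge_0; [|now apply l2_bounded_cabs].
    intros j; apply Rmult_le_pos; auto using Cmod_ge_0. }
  rewrite Cmod_R, Rabs_pos_eq by auto.
  (* the factors of the Cauchy-Schwarz inequality *)
  set (x := fun j => RtoC (sqrt (alpha (k - j)%Z))).
  set (y := fun j => RtoC (sqrt (alpha (k - j)%Z) * Cmod (v j))).
  assert (X1 : forall j, Cmod (x j) = sqrt (alpha (k - j)%Z)).
  { intros j; unfold x; rewrite Cmod_R, Rabs_pos_eq; auto using sqrt_pos. }
  assert (Y1 : forall j, Cmod (y j) = sqrt (alpha (k - j)%Z) * Cmod (v j)).
  { intros j; unfold y; rewrite Cmod_R, Rabs_pos_eq; auto.
    apply Rmult_le_pos; auto using sqrt_pos, Cmod_ge_0. }
  assert (X2 : forall j, Cmod (x j) ^ 2 = alpha (k - j)%Z).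
  { intros j; rewrite X1, pow2_sqrt; auto. }
  assert (Y2 : forall j, Cmod (y j) ^ 2 = F k j).
  { intros j; rewrite Y1, Rpow_mult_distr, pow2_sqrt; auto. }
  assert (Hx : l2 x) by (apply (ex_sumZ_ext (fun j => alpha (k - j)%Z)); auto).
  assert (Hy : l2 y) by (apply (ex_sumZ_ext (F k)); auto).
  pose proof (cauchy_schwarz x y Hx Hy) as CS.
  rewrite (sumZ_ext _ (fun j => alpha (k - j)%Z * Cmod (v j))) in CS.
  2:{ intros j; rewrite X1, Y1, <- Rmult_assoc, sqrt_sqrt; auto. }
  apply Rle_trans with ((nrm x * nrm y) ^ 2); [apply pow_incr; auto|].
  rewrite Rpow_mult_distr, !nrm_sqr by auto.
  rewrite (sumZ_ext _ _ X2), (sumZ_ext _ _ Y2).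
  apply Rmult_le_compat_r; auto; apply sumZ_ge_0; auto; apply R1.
Qed.

Lemma kop_dominated K alpha v : kernel_le K alpha -> l2 v -> forall k,
  Cmod (kop K v k) <= Cmod (RtoC (sumZ (fun j => alpha (k - j)%Z * Cmod (v j)))).
Proof.
  intros HK Hv k; pose proof (kernel_ge_0 K alpha HK) as H0.
  pose proof (kernel_cabs K alpha v k HK Hv) as E; destruct HK as [Ea HK].
  rewrite Cmod_R; apply Rle_trans with (2 := Rle_abs _).
  apply Rle_trans with (1 := Cmod_CsumZ_le _ E); apply sumZ_le; auto using l2_bounded_cabs.
  intros j; rewrite Cmod_mult; apply Rmult_le_compat_r; auto using Cmod_ge_0.
Qed.

Lemma l2_kop K alpha v : kernel_le K alpha -> l2 v -> l2 (kop K v).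
Proof.
  intros HK Hv; pose proof (kernel_ge_0 K alpha HK) as H0.
  destruct (schur_conv alpha v H0 (proj1 HK) Hv) as [S1 S2].
  apply (l2_le _ _ 1 (fun k => Rle_trans _ _ _ (kop_dominated K alpha v HK Hv k)
    (Req_le _ _ (eq_sym (Rmult_1_l _)))) S1).
Qed.

Lemma nrm_kop K alpha v : kernel_le K alpha -> l2 v -> nrm (kop K v) <= sumZ alpha * nrm v.
Proof.
  intros HK Hv; pose proof (kernel_ge_0 K alpha HK) as H0.
  destruct (schur_conv alpha v H0 (proj1 HK) Hv) as [S1 S2].
  apply Rle_trans with (2 := S2); rewrite <- (Rmult_1_l (nrm (fun k => RtoC _))).
  apply nrm_le; auto; [lra|].
  intros k; rewrite Rmult_1_l; now apply kop_dominated.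
Qed.

Lemma kop_adjoint K alpha v w : kernel_le K alpha -> l2 v -> l2 w ->
  ip (kop K v) w = ip v (kop (fun k j => Cconj (K j k)) w).
Proof.
  intros HK Hv Hw; pose proof (kernel_ge_0 K alpha HK) as H0.
  set (F := fun k j => (K k j * v j * Cconj (w k))%C).
  assert (R1 : forall k, cabs (F k)).
  { intros k; apply (cabs_ext (fun j => Cconj (w k) * (K k j * v j))%C); [intros j; unfold F; ring|].
    now apply cabs_scal, (kernel_cabs K alpha). }
  destruct (schur_conv alpha v H0 (proj1 HK) Hv) as [S1 _].
  assert (E : forall k, ex_sumZ (fun j => alpha (k - j)%Z * Cmod (v j)))
    by (intros k; apply l2_bounded_cabs; auto; apply HK).
  assert (R2 : ex_sumZ (fun k => sumZ (fun j => Cmod (F k j)))).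
  { apply (ex_sumZ_le _ (fun k => Cmod (RtoC (sumZ (fun j => alpha (k - j)%Z * Cmod (v j)))) *
      Cmod (w k))); [|now apply l2_prod].
    intros k; rewrite Rabs_pos_eq by (apply sumZ_ge_0; auto using Cmod_ge_0; apply R1).
    rewrite Cmod_R; apply Rle_trans with (2 := Rmult_le_compat_r _ _ _ (Cmod_ge_0 _) (Rle_abs _)).
    rewrite Rmult_comm, <- sumZ_scal; apply sumZ_le; [|apply R1|apply ex_sumZ_scal, E].
    intros j; unfold F; rewrite !Cmod_mult, Cmod_conj, Rmult_comm.
    apply Rmult_le_compat_l; auto using Cmod_ge_0.
    apply Rmult_le_compat_r; auto using Cmod_ge_0; apply HK. }
  transitivity (CsumZ (fun k => CsumZ (F k))).
  - apply CsumZ_ext; intros k; unfold kop; rewrite Cmult_comm, <- CsumZ_scal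
      by now apply (kernel_cabs K alpha).
    apply CsumZ_ext; intros j; unfold F; ring.
  - rewrite <- CsumZ_fubini by auto.
    apply CsumZ_ext; intros j; unfold kop; rewrite <- CsumZ_conj, <- CsumZ_scal.
    + apply CsumZ_ext; intros k; unfold F; rewrite Cmult_conj, Cconj_conj; ring.
    + apply (cabs_le _ (fun k => alpha (k - j)%Z * Cmod (w k))).
      * intros k; rewrite Cmod_conj, Cmod_mult, Cmod_conj.
        apply Rmult_le_compat_r; auto using Cmod_ge_0; apply HK.
      * apply (ex_sumZ_ext (fun k => (fun m => alpha (- m)%Z) (j - k)%Z * Cmod (w k))).
        { intros k; do 2 f_equal; lia. }
        apply (l2_bounded_cabs (fun m => alpha (- m)%Z)); auto.
        destruct (ex_sumZ_reflect alpha 0 H0 (proj1 HK)) as [E1 _].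
        apply (ex_sumZ_ext (fun j0 => alpha (0 - j0)%Z)); auto; intros m; f_equal; lia.
Qed.

Lemma kop_add K alpha v w : kernel_le K alpha -> l2 v -> l2 w ->
  kop K (vadd v w) = vadd (kop K v) (kop K w).
Proof.
  intros HK Hv Hw; apply seq_ext; intros k; unfold kop, vadd.
  rewrite <- CsumZ_plus by now apply (kernel_cabs K alpha).
  apply CsumZ_ext; intros j; ring.
Qed.

Lemma kop_scal K alpha c v : kernel_le K alpha -> l2 v -> kop K (vscal c v) = vscal c (kop K v).
Proof.
  intros HK Hv; apply seq_ext; intros k; unfold kop, vscal, dg.
  rewrite <- CsumZ_scal by now apply (kernel_cabs K alpha).
  apply CsumZ_ext; intros j; ring.
Qed.

(** * Distributions are determined by their Fourier coefficients *)

Definition cinf_const (c : R) : Cinf := cinf_trig 0 c 0.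

Lemma cinf_const_val c x : cinf_const c x = c.
Proof. simpl; unfold trig; rewrite Rmult_0_l, cos_0, sin_0; ring. Qed.

Lemma Cinf_periodic_Z (f : Cinf) (m : Z) x : f (x + IZR m * (2 * PI)) = f x.
Proof.
  assert (P : forall n x, f (x + INR n * (2 * PI)) = f x).
  { induction n as [|n IH]; intros y; [f_equal; simpl; ring|].
    rewrite S_INR; replace (y + (INR n + 1) * (2 * PI)) with ((y + INR n * (2 * PI)) + 2 * PI)
      by ring; now rewrite cinf_periodic. }
  destruct (Z_le_gt_dec 0 m) as [Hm|Hm].
  - rewrite <- (P (Z.to_nat m) x), INR_IZR_INZ, Z2Nat.id by lia; reflexivity.
  - rewrite <- (P (Z.to_nat (- m)) (x + _)), INR_IZR_INZ, Z2Nat.id, opp_IZR by lia; f_equal; ring.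
Qed.

Lemma Derive_cinf_scal_plus c f d g x :
  Derive (cinf_scal_plus c f d g) x = c * Derive f x + d * Derive g x.
Proof. apply (Derive_n_scal_plus c f d g 1 x); apply cinf_smooth. Qed.

Lemma Derive_cinf_mult f g x :
  Derive (cinf_mult f g) x = Derive f x * g x + f x * Derive g x.
Proof. apply Derive_mult_fun; apply cinf_smooth. Qed.

Lemma Derive_cinf_trig k A B x :
  Derive (cinf_trig k A B) x = cinf_trig k (IZR k * B) (- (IZR k * A)) x.
Proof. apply Derive_trig. Qed.

(** [bump x0 x] is [(1 + cos (x - x0)) / 2] and [bsin x0 x] is [sin (x - x0)], both
    written through characters. *)
Definition bump (x0 : R) : Cinf :=
  cinf_scal_plus (/ 2) (cinf_const 1) (/ 2) (cinf_trig 1 (cos x0) (sin x0)).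

Definition bsin (x0 : R) : Cinf := cinf_trig 1 (- sin x0) (cos x0).

Fixpoint bpow (x0 : R) (n : nat) : Cinf :=
  match n with
  | O => cinf_const 1
  | S m => cinf_mult (bump x0) (bpow x0 m)
  end.

Lemma bump_val x0 x : bump x0 x = (1 + cos (x - x0)) / 2.
Proof.
  unfold bump; cbn [cinf_fun cinf_scal_plus]; rewrite cinf_const_val.
  simpl; unfold trig; rewrite !Rmult_1_l, cos_minus; field.
Qed.

Lemma bsin_val x0 x : bsin x0 x = sin (x - x0).
Proof. simpl; unfold trig; rewrite Rmult_1_l, sin_minus; ring. Qed.

Lemma bsin_sqr x0 x : bsin x0 x * bsin x0 x = 4 * bump x0 x * (1 - bump x0 x).
Proof.
  rewrite bsin_val, bump_val; pose proof (sin2_cos2 (x - x0)) as E; unfold Rsqr in E.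
  field_simplify; nra.
Qed.

Lemma bump_bounds x0 x : 0 <= bump x0 x <= 1.
Proof. rewrite bump_val; pose proof (COS_bound (x - x0)); lra. Qed.

Lemma bpow_ge_0 x0 n x : 0 <= bpow x0 n x.
Proof.
  induction n as [|n IH]; cbn [bpow]; [rewrite cinf_const_val; lra|].
  pose proof (bump_bounds x0 x); simpl in *; nra.
Qed.

Lemma Derive_bump x0 x : Derive (bump x0) x = - / 2 * bsin x0 x.
Proof.
  unfold bump; rewrite Derive_cinf_scal_plus; unfold cinf_const; rewrite !Derive_cinf_trig.
  simpl; unfold trig; ring.
Qed.

Lemma Derive_bsin x0 x : Derive (bsin x0) x = 2 * bump x0 x - 1.
Proof.
  rewrite bump_val, cos_minus; unfold bsin; rewrite Derive_cinf_trig.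
  simpl; unfold trig; rewrite !Rmult_1_l; field.
Qed.

Lemma Derive_bpow_S x0 n x :
  Derive (bpow x0 (S n)) x = - (INR (S n) / 2) * bpow x0 n x * bsin x0 x.
Proof.
  induction n as [|n IH]; cbn [bpow] in *; rewrite Derive_cinf_mult, Derive_bump.
  - unfold cinf_const at 2; rewrite Derive_cinf_trig; simpl; unfold trig; field.
  - rewrite IH, !S_INR; cbn [cinf_mult cinf_fun]; field.
Qed.

(** The integral of [bpow x0 n] over a period, by the Wallis recursion; it does
    not depend on [x0]. *)
Fixpoint bmass (n : nat) : R :=
  match n with
  | O => 2 * PI
  | S m => bmass m * ((2 * INR m + 1) / (2 * INR m + 2))
  end.

Lemma bmass_pos n : 0 < bmass n.
Proof.
  pose proof PI_RGT_0; induction n as [|n IH]; cbn [bmass]; [lra|].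
  pose proof (pos_INR n); apply Rmult_lt_0_compat; auto; apply Rdiv_lt_0_compat; lra.
Qed.

Lemma RInt_cinf_const c : RInt (cinf_const c) 0 (2 * PI) = 2 * PI * c.
Proof. exact (RInt_trig 0 c 0). Qed.

(** The derivative of [bpow n * bsin] is [(2 n + 2) bpow (n + 1) - (2 n + 1) bpow n]
    and has integral zero. *)
Lemma RInt_bpow x0 n : RInt (bpow x0 n) 0 (2 * PI) = bmass n.
Proof.
  induction n as [|n IH]; [exact (eq_trans (RInt_cinf_const 1) (Rmult_1_r _))|].
  pose proof (RInt_Derive_Cinf (cinf_mult (bpow x0 n) (bsin x0))) as E.
  change (RInt (cinf_deriv (cinf_mult (bpow x0 n) (bsin x0))) 0 (2 * PI) = 0) in E.
  rewrite (RInt_lin_Cinf (bpow x0 (S n)) (bpow x0 n) _ (2 * INR n + 2) (- (2 * INR n + 1))) in E.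
  - cbn [bmass]; rewrite IH in E; pose proof (pos_INR n).
    apply (Rmult_eq_reg_l (2 * INR n + 2)); [|lra].
    transitivity ((2 * INR n + 1) * bmass n); [lra | field; lra].
  - intros x; change (Derive (cinf_mult (bpow x0 n) (bsin x0)) x =
      (2 * INR n + 2) * (bump x0 x * bpow x0 n x) + - (2 * INR n + 1) * bpow x0 n x).
    rewrite Derive_cinf_mult, Derive_bsin.
    destruct n as [|n].
    + cbn [bpow]; unfold cinf_const at 1; rewrite Derive_cinf_trig, cinf_const_val.
      simpl; unfold trig; ring.
    + rewrite Derive_bpow_S.
      transitivity (- (INR (S n) / 2) * bpow x0 n x * (bsin x0 x * bsin x0 x) +
        bpow x0 (S n) x * (2 * bump x0 x - 1)); [ring|].
      rewrite bsin_sqr; change (bpow x0 (S n) x) with (bump x0 x * bpow x0 n x); field.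
Qed.

Lemma one_minus_cos_lower z : Rabs z <= PI -> Rmin (z ^ 2 / 4) (/ 4) <= 1 - cos z.
Proof.
  intros Hz.
  assert (Hlow : forall t, 0 <= t <= 1 -> t ^ 2 / 4 <= 1 - cos t).
  { intros t Ht; pose proof PI2_1 as HP.
    destruct (pre_cos_bound t 0) as [_ U]; [lra | lra |].
    assert (U' : cos t <= 1 - t ^ 2 / 2 + t ^ 4 / 24).
    { apply Rle_trans with (1 := U), Req_le; unfold cos_approx, cos_term; simpl; field. }
    assert (t ^ 4 <= t ^ 2) by (replace (t ^ 4) with (t ^ 2 * t ^ 2) by ring; assert (0 <= t ^ 2 <= 1) by (simpl; nra); nra).
    pose proof (pow2_ge_0 t); lra. }
  assert (E : cos z = cos (Rabs z)).
  { unfold Rabs; destruct (Rcase_abs z); [now rewrite cos_neg | reflexivity]. }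
  rewrite E, <- (pow2_abs z); pose proof (Rabs_pos z).
  destruct (Rle_dec (Rabs z) 1) as [H1|H1].
  - apply Rle_trans with (1 := Rmin_l _ _); apply Hlow; lra.
  - apply Rle_trans with (1 := Rmin_r _ _).
    pose proof (Hlow 1 ltac:(lra)) as H2; pose proof PI2_1.
    assert (cos (Rabs z) <= cos 1) by (apply cos_decr_1; lra).
    lra.
Qed.

(** A Lipschitz function has the modulus of continuity [e + K d^2 / e] for every
    [e], and [1 - bump] is comparable to the square of the distance. *)
Lemma Cinf_modulus (f : Cinf) : exists K, 0 <= K /\ forall e x0 x, 0 < e ->
  Rabs (f x - f x0) <= e + K / e * (1 - bump x0 x).
Proof.
  pose proof PI_RGT_0 as Hpi; pose proof PI_4 as Hpi4.
  destruct (ck_bound_exists 1 f) as [M HM].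
  exists (32 * M ^ 2); split; [pose proof (pow2_ge_0 M); lra|]; intros e x0 x He.
  (* move [x] into the period centred at [x0] *)
  destruct (archimed ((x - x0 + PI) / (2 * PI))) as [A1 A2].
  set (m := up ((x - x0 + PI) / (2 * PI))) in *.
  set (y := x + IZR (- (m - 1)) * (2 * PI)).
  rewrite <- (Cinf_periodic_Z f (- (m - 1)) x), <- (Cinf_periodic_Z (bump x0) (- (m - 1)) x).
  fold y; rewrite bump_val.
  assert (Hy : Rabs (y - x0) <= PI).
  { assert (E : (x - x0 + PI) / (2 * PI) * (2 * PI) = x - x0 + PI) by (field; lra).
    apply Rabs_le; unfold y; rewrite opp_IZR, minus_IZR; nra. }
  clearbody y; pose proof (one_minus_cos_lower _ Hy) as Low.
  destruct (MVT_gen f x0 y (Derive f)) as [c [_ E]].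
  { intros t _; apply Derive_correct, smooth_ex_derive, cinf_smooth. }
  { intros t _; apply Cinf_continuity. }
  rewrite E, Rabs_mult.
  pose proof (HM 1%nat c (le_n _) : Rabs (Derive f c) <= M) as Hc; pose proof (Rabs_pos (Derive f c)).
  rewrite <- (pow2_abs (y - x0)) in Low; set (z := Rabs (y - x0)) in *; set (k := 1 - cos (y - x0)) in *.
  assert (Hz : 0 <= z) by apply Rabs_pos.
  assert (Hk : z ^ 2 <= 64 * k).
  { unfold Rmin in Low; destruct (Rle_dec (z ^ 2 / 4) (/ 4)) in Low; nra. }
  apply Rle_trans with (M * z); [now apply Rmult_le_compat_r|].
  apply (Rmult_le_reg_l e); auto.
  replace (e * (e + 32 * M ^ 2 / e * (1 - (1 + cos (y - x0)) / 2))) with (e ^ 2 + M ^ 2 / 4 * (64 * k))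
    by (unfold k; field; lra).
  apply Rle_trans with (e ^ 2 + M ^ 2 / 4 * z ^ 2); [pose proof (pow2_ge_0 (e - M * z / 2)); nra|].
  apply Rplus_le_compat_l, Rmult_le_compat_l; auto; pose proof (pow2_ge_0 M); lra.
Qed.

(** [avg n f] is the convolution [x0 |-> int (bpow x0 n) f], expanded by the
    addition formula so that it is visibly a trigonometric polynomial. *)
Fixpoint avg (n : nat) (f : Cinf) : Cinf :=
  match n with
  | O => cinf_const (RInt f 0 (2 * PI))
  | S m =>
      cinf_scal_plus (/ 2) (avg m f) (/ 2)
        (cinf_scal_plus 1 (cinf_mult (cinf_trig 1 1 0) (avg m (cinf_mult (cinf_trig 1 1 0) f)))
                        1 (cinf_mult (cinf_trig 1 0 1) (avg m (cinf_mult (cinf_trig 1 0 1) f))))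
  end.

Lemma RInt_Cinf_ext (f g : Cinf) : (forall x, f x = g x) ->
  RInt f 0 (2 * PI) = RInt g 0 (2 * PI).
Proof. intros H; apply RInt_ext; intros x _; apply H. Qed.

Lemma avg_val n : forall f x0, avg n f x0 = RInt (cinf_mult (bpow x0 n) f) 0 (2 * PI).
Proof.
  induction n as [|n IH]; intros f x0.
  - cbn [avg bpow]; rewrite cinf_const_val; apply RInt_Cinf_ext; intros x.
    cbn [cinf_mult cinf_fun]; rewrite cinf_const_val; ring.
  - cbn [avg]; set (fc := cinf_mult (cinf_trig 1 1 0) f); set (fs := cinf_mult (cinf_trig 1 0 1) f).
    change (/ 2 * avg n f x0 + / 2 * (1 * (trig 1 1 0 x0 * avg n fc x0) +
      1 * (trig 1 0 1 x0 * avg n fs x0)) = RInt (cinf_mult (bpow x0 (S n)) f) 0 (2 * PI)).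
    rewrite !IH.
    rewrite (RInt_lin_Cinf (cinf_mult (bpow x0 n) f)
      (cinf_scal_plus (cos x0) (cinf_mult (bpow x0 n) fc) (sin x0) (cinf_mult (bpow x0 n) fs))
      (cinf_mult (bpow x0 (S n)) f) (/ 2) (/ 2)).
    + rewrite (RInt_lin_Cinf (cinf_mult (bpow x0 n) fc) (cinf_mult (bpow x0 n) fs)
        (cinf_scal_plus _ _ _ _) (cos x0) (sin x0)) by reflexivity.
      unfold trig; rewrite !Rmult_1_l; ring.
    + intros x; cbn [bpow cinf_mult cinf_fun cinf_scal_plus]; rewrite bump_val, cos_minus.
      simpl; unfold trig; rewrite !Rmult_1_l; field.
Qed.

Lemma RInt_cinf_scal_plus c f d g : RInt (cinf_scal_plus c f d g) 0 (2 * PI) =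
  c * RInt f 0 (2 * PI) + d * RInt g 0 (2 * PI).
Proof. now apply RInt_lin_Cinf. Qed.

Lemma avg_lin n c f d g x :
  avg n (cinf_scal_plus c f d g) x = c * avg n f x + d * avg n g x.
Proof.
  rewrite !avg_val; apply RInt_lin_Cinf; intros y; simpl; ring.
Qed.

(** In the addition formula for [avg (n + 1)] the derivatives of the outer and of
    the inner factors [cos] and [sin] cancel. *)
Lemma avg_deriv n : forall f x, Derive (avg n f) x = avg n (cinf_deriv f) x.
Proof.
  induction n as [|n IH]; intros f x; cbn [avg].
  - unfold cinf_const at 1; rewrite Derive_cinf_trig, cinf_const_val.
    change (RInt (cinf_deriv f) 0 (2 * PI)) with (RInt (Derive f) 0 (2 * PI)).
    rewrite RInt_Derive_Cinf; simpl; unfold trig; ring.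
  - rewrite !Derive_cinf_scal_plus, !Derive_cinf_mult, !IH, !Derive_cinf_trig.
    set (C1 := cinf_trig 1 1 0); set (S1 := cinf_trig 1 0 1).
    assert (EC : cinf_deriv (cinf_mult C1 f) =
      cinf_scal_plus 1 (cinf_mult C1 (cinf_deriv f)) (-1) (cinf_mult S1 f)).
    { apply Cinf_ext; intros y; change (Derive (cinf_mult C1 f) y = 1 * (C1 y * Derive f y) + -1 * (S1 y * f y)).
      rewrite Derive_cinf_mult; unfold C1, S1; rewrite Derive_cinf_trig.
      simpl; unfold trig; ring. }
    assert (ES : cinf_deriv (cinf_mult S1 f) =
      cinf_scal_plus 1 (cinf_mult S1 (cinf_deriv f)) 1 (cinf_mult C1 f)).
    { apply Cinf_ext; intros y; change (Derive (cinf_mult S1 f) y = 1 * (S1 y * Derive f y) + 1 * (C1 y * f y)).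
      rewrite Derive_cinf_mult; unfold C1, S1; rewrite Derive_cinf_trig.
      simpl; unfold trig; ring. }
    rewrite EC, ES, !avg_lin.
    cbn [cinf_scal_plus cinf_mult cinf_fun]; unfold C1, S1; cbn [cinf_trig cinf_fun]; unfold trig.
    rewrite !Rmult_1_l; ring.
Qed.

(** The order [(m + 1)^2 - 1] of the kernel makes the choice [e = 1 / (m + 1)]
    in the modulus of continuity balance both terms. *)
Definition order (m : nat) : nat := (m * m + 2 * m)%nat.

Definition approx_error (m : nat) (f : Cinf) : Cinf :=
  cinf_scal_plus 1 f (- / bmass (order m)) (avg (order m) f).

Lemma approx_error_le (f : Cinf) : exists K, 0 <= K /\ forall m x,
  Rabs (approx_error m f x) <= K / (INR m + 1).
Proof.
  pose proof PI_RGT_0 as Hpi.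
  destruct (Cinf_modulus f) as [K [HK H]]; exists (1 + K); split; [lra|]; intros m x0.
  set (n := order m); pose proof (bmass_pos n) as Hm; pose proof (pos_INR m) as Hn.
  assert (En : INR n + 1 = (INR m + 1) ^ 2).
  { unfold n, order; rewrite plus_INR, !mult_INR; simpl; ring. }
  set (e := / (INR m + 1)).
  assert (He : 0 < e) by (apply Rinv_0_lt_compat; lra).
  assert (Ee : (INR m + 1) * e = 1) by (apply Rinv_r; lra).
  set (rem := cinf_scal_plus 1 f (- f x0) (cinf_const 1)).
  assert (E : RInt (cinf_mult (bpow x0 n) rem) 0 (2 * PI) = avg n f x0 - f x0 * bmass n).
  { rewrite (RInt_lin_Cinf (cinf_mult (bpow x0 n) f) (bpow x0 n) _ 1 (- f x0)).
    - rewrite RInt_bpow, avg_val; match goal with |- ?u = ?w => change (@eq R u w) end; ring.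
    - intros x; unfold rem; cbn [cinf_scal_plus cinf_mult cinf_fun]; rewrite cinf_const_val; ring. }
  assert (B : Rabs (RInt (cinf_mult (bpow x0 n) rem) 0 (2 * PI)) <=
    (e + K / e) * bmass n + - (K / e) * bmass (S n)).
  { rewrite <- !(RInt_bpow x0), <- RInt_cinf_scal_plus.
    apply Rle_trans with (1 := abs_RInt_le (cinf_mult (bpow x0 n) rem) 0 (2 * PI) ltac:(lra) (ex_RInt_Cinf _ _ _)).
    apply RInt_le; [lra | | apply ex_RInt_Cinf |].
    - apply (ex_RInt_continuous (V := R_CompleteNormedModule)); intros x _.
      apply continuity_pt_filterlim, (continuity_pt_comp (cinf_mult (bpow x0 n) rem) Rabs);
        [apply Cinf_continuity | apply Rcontinuity_abs].
    - intros x _; cbn [cinf_mult cinf_fun cinf_scal_plus bpow].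
      pose proof (bpow_ge_0 x0 n x) as P; rewrite Rabs_mult, (Rabs_pos_eq _ P).
      specialize (H e x0 x He); unfold rem; cbn [cinf_scal_plus cinf_fun]; rewrite cinf_const_val.
      replace (1 * f x + - f x0 * 1) with (f x - f x0) by ring.
      apply (Rmult_le_compat_l (bpow x0 n x)) in H; auto; lra. }
  rewrite E in B; cbn [bmass] in B; unfold approx_error; fold n; cbn [cinf_scal_plus cinf_fun].
  replace (1 * f x0 + - / bmass n * avg n f x0) with (- (/ bmass n * (avg n f x0 - f x0 * bmass n)))
    by (field; lra).
  assert (Hi : 0 < / bmass n) by now apply Rinv_0_lt_compat.
  rewrite Rabs_Ropp, Rabs_mult, (Rabs_pos_eq (/ bmass n)) by lra.
  apply (Rmult_le_compat_l (/ bmass n)) in B; [|lra]; apply Rle_trans with (1 := B).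
  replace (2 * INR n + 2) with (2 * (INR n + 1)) by ring.
  replace (2 * INR n + 1) with (2 * (INR n + 1) - 1) by ring; rewrite En.
  apply Rle_trans with (e + K / 2 * e).
  - apply Req_le; unfold e; field; lra.
  - unfold Rdiv; fold e; nra.
Qed.

(** Averages commute with derivatives, so the uniform bound applies to each
    derivative in turn. *)
Lemma approx_error_ck N : forall f : Cinf, exists K, 0 <= K /\ forall m,
  ck_bound N (approx_error m f) (K / (INR m + 1)).
Proof.
  induction N as [|N IH]; intros f; destruct (approx_error_le f) as [K [HK H]].
  - exists K; split; auto; intros m j x Hj; replace j with 0%nat by lia; apply H.
  - destruct (IH (cinf_deriv f)) as [K' [HK' H']]; exists (K + K'); split; [lra|].
    intros m j x Hj; pose proof (pos_INR m).
    assert (I : 0 <= / (INR m + 1)) by (apply Rlt_le, Rinv_0_lt_compat; lra).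
    unfold Rdiv; rewrite Rmult_plus_distr_r.
    assert (0 <= K * / (INR m + 1)) by now apply Rmult_le_pos.
    assert (0 <= K' * / (INR m + 1)) by now apply Rmult_le_pos.
    destruct j as [|j].
    + specialize (H m x); unfold Rdiv in H; change (Derive_n ?g 0 x) with (g x); lra.
    + rewrite Derive_n_S.
      specialize (H' m j x ltac:(lia)); unfold Rdiv in H'.
      rewrite (Derive_n_ext _ (approx_error m (cinf_deriv f))); [lra|].
      intros y; unfold approx_error; rewrite Derive_cinf_scal_plus, avg_deriv; reflexivity.
Qed.

Inductive trigpoly : Cinf -> Prop :=
| trigpoly_trig k A B : trigpoly (cinf_trig k A B)
| trigpoly_lin c f d g : trigpoly f -> trigpoly g -> trigpoly (cinf_scal_plus c f d g).

Lemma trigpoly_mult k A B f : trigpoly f -> trigpoly (cinf_mult (cinf_trig k A B) f).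
Proof.
  induction 1 as [j A' B'|c f d g _ Hf _ Hg].
  - replace (cinf_mult (cinf_trig k A B) (cinf_trig j A' B')) with
      (cinf_scal_plus 1 (cinf_trig (k + j) ((A * A' - B * B') / 2) ((A * B' + B * A') / 2))
                      1 (cinf_trig (k - j) ((A * A' + B * B') / 2) ((B * A' - A * B') / 2))).
    + apply trigpoly_lin; apply trigpoly_trig.
    + apply Cinf_ext; intros x; simpl; unfold trig.
      rewrite plus_IZR, minus_IZR, Rmult_plus_distr_r, Rmult_minus_distr_r.
      rewrite cos_plus, sin_plus, cos_minus, sin_minus; field.
  - replace (cinf_mult (cinf_trig k A B) (cinf_scal_plus c f d g)) with
      (cinf_scal_plus c (cinf_mult (cinf_trig k A B) f) d (cinf_mult (cinf_trig k A B) g)).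
    + now apply trigpoly_lin.
    + apply Cinf_ext; intros x; simpl; ring.
Qed.

Lemma trigpoly_avg n : forall f, trigpoly (avg n f).
Proof.
  induction n as [|n IH]; intros f; cbn [avg]; [apply trigpoly_trig|].
  repeat apply trigpoly_lin; auto using trigpoly_mult.
Qed.

Definition treal (f : Cinf) : test := mkTest f (cinf_const 0).

Lemma tval_treal f x : tval (treal f) x = RtoC (f x).
Proof. unfold tval, treal; simpl tre; simpl tim; now rewrite cinf_const_val. Qed.

Lemma treal_trig k A B : treal (cinf_trig k A B) =
  tlin ((RtoC A - Ci * RtoC B) / 2)%C (texp k)
    (tlin ((RtoC A + Ci * RtoC B) / 2)%C (texp (- k)) (treal (cinf_const 0))).
Proof.
  apply test_ext; intros x; rewrite !tval_tlin, !tval_texp, !tval_treal, cinf_const_val, opp_IZR.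
  replace (- IZR k * x) with (- (IZR k * x)) by ring; rewrite cos_neg, sin_neg.
  simpl; unfold trig; apply injective_projections; simpl; field.
Qed.

Lemma treal_lin c f d g : treal (cinf_scal_plus c f d g) =
  tlin (RtoC c) (treal f) (tlin (RtoC d) (treal g) (treal (cinf_const 0))).
Proof.
  apply test_ext; intros x; rewrite !tval_tlin, !tval_treal, cinf_const_val.
  simpl; rewrite RtoC_plus, !RtoC_mult; ring.
Qed.

Lemma distr_zero (v : distr) : v (treal (cinf_const 0)) = 0%C.
Proof.
  assert (E : treal (cinf_const 0) = tlin (RtoC 1) (treal (cinf_const 0)) (treal (cinf_const 0))).
  { apply test_ext; intros x; rewrite tval_tlin, !tval_treal, cinf_const_val; ring. }
  pose proof (distr_linear v (RtoC 1) (treal (cinf_const 0)) (treal (cinf_const 0))) as L.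
  rewrite <- E in L.
  set (z := v (treal (cinf_const 0))) in *.
  transitivity (RtoC 1 * z + z - z)%C; [ring | rewrite <- L; ring].
Qed.

Lemma distr_treal_lin (v : distr) c f d g : v (treal (cinf_scal_plus c f d g)) =
  (RtoC c * v (treal f) + RtoC d * v (treal g))%C.
Proof. rewrite treal_lin, !distr_linear, distr_zero; ring. Qed.

(** A distribution that kills the characters kills the averages of a test
    function, and these converge to it in every [C^N] seminorm. *)
Lemma distr_kills (v : distr) : (forall k, v (texp k) = 0%C) -> forall phi, v phi = 0%C.
Proof.
  intros H.
  assert (P : forall f, trigpoly f -> v (treal f) = 0%C).
  { induction 1 as [k A B|c f d g _ Hf _ Hg].
    - rewrite treal_trig, !distr_linear, !H, distr_zero; ring.
    - rewrite distr_treal_lin, Hf, Hg; ring. }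
  assert (Q : forall f, v (treal f) = 0%C).
  { intros f; destruct (distr_continuous v) as [N [K HN]].
    destruct (approx_error_ck N f) as [L [HL B]].
    assert (G : forall n, Cmod (v (treal f)) <= K * (L / (INR n + 1))).
    { intros n; pose proof (distr_treal_lin v 1 f (- / bmass (order n)) (avg (order n) f)) as E.
      fold (approx_error n f) in E; rewrite (P _ (trigpoly_avg (order n) f)) in E.
      replace (v (treal f)) with (v (treal (approx_error n f))) by (rewrite E; ring).
      apply HN; split; [apply B|].
      intros j x _; unfold cinf_const; simpl tim.
      pose proof (Derive_n_trig_le 0 j 0 0 x) as T.
      change (cinf_fun (cinf_trig 0 0 0)) with (trig 0 0 0).
      rewrite Rabs_R0, Rplus_0_r, Rmult_0_r in T; apply Rle_trans with (1 := T).
      apply Rmult_le_pos; auto; apply Rlt_le, Rinv_0_lt_compat; pose proof (pos_INR n); lra. }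
    apply Cmod_eq_0, Rle_antisym; [|apply Cmod_ge_0].
    apply Rnot_lt_le; intros A; set (c := Cmod (v (treal f))) in *.
    destruct (archimed (K * L / c)) as [A1 _].
    assert (A2 : IZR (up (K * L / c)) <= INR (Z.to_nat (Z.abs (up (K * L / c))))).
    { rewrite INR_IZR_INZ, Z2Nat.id by lia; apply IZR_le; lia. }
    specialize (G (Z.to_nat (Z.abs (up (K * L / c))))).
    set (n := Z.to_nat _) in *; pose proof (pos_INR n).
    assert (c * (INR n + 1) <= K * L).
    { apply (Rmult_le_compat_r (INR n + 1)) in G; [|lra].
      replace (K * (L / (INR n + 1)) * (INR n + 1)) with (K * L) in G by (field; lra); lra. }
    assert (K * L < c * (INR n + 1)).
    { replace (K * L) with (c * (K * L / c)) by (field; lra); apply Rmult_lt_compat_l; lra. }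
    lra. }
  intros phi.
  replace phi with (tlin Ci (treal (tim phi)) (treal (tre phi))).
  - rewrite distr_linear, !Q; ring.
  - apply test_ext; intros x; rewrite tval_tlin, !tval_treal.
    apply injective_projections; simpl; ring.
Qed.

Lemma fourier_dlin c v w k : fourier (dlin c v w) k = (c * fourier v k + fourier w k)%C.
Proof. unfold fourier; simpl; unfold Cdiv; ring. Qed.

Lemma fourier_inj v w : (forall k, fourier v k = fourier w k) -> v = w.
Proof.
  pose proof PI_RGT_0 as Hpi.
  assert (Hpi' : RtoC (2 * PI) <> 0%C) by (intros E0; apply RtoC_inj in E0; lra).
  intros H; apply distr_ext; intros phi.
  assert (E : dlin (RtoC (-1)) w v phi = 0%C).
  { apply distr_kills; intros k; replace k with (- - k)%Z by lia.
    transitivity (fourier (dlin (RtoC (-1)) w v) (- k) * RtoC (2 * PI))%C.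
    - unfold fourier; field; auto.
    - rewrite fourier_dlin, H; ring. }
  simpl in E; transitivity (RtoC (-1) * w phi + v phi + w phi)%C; [ring | rewrite E; ring].
Qed.

Lemma fourier_dscal c v k : fourier (dscal c v) k = (c * fourier v k)%C.
Proof. unfold dscal; rewrite fourier_dlin; unfold fourier at 2; simpl; unfold Cdiv; ring. Qed.

Lemma fourier_dminus v w k : fourier (dminus v w) k = (fourier v k - fourier w k)%C.
Proof. unfold dminus; rewrite fourier_dlin; ring. Qed.

Lemma fourier_dderiv v k : fourier (dderiv v) k = (Ci * RtoC (IZR k) * fourier v k)%C.
Proof.
  unfold fourier; simpl.
  assert (E : tderiv (texp (- k)) = tlin (- (Ci * RtoC (IZR k)))%C (texp (- k)) (treal (cinf_const 0))).
  { apply test_ext; intros x; rewrite tval_tlin, tval_texp, tval_treal, cinf_const_val.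
    unfold tval; simpl; rewrite !Derive_trig; unfold trig; rewrite opp_IZR.
    apply injective_projections; simpl; ring. }
  rewrite E, distr_linear, distr_zero; unfold Cdiv; ring.
Qed.

Definition one_symbol : Z -> C := fun _ => RtoC 1.

Lemma one_symbol_bounded : bounded_symbol one_symbol.
Proof. exists 1; intros k; unfold one_symbol; rewrite Cmod_1; lra. Qed.

(** The series defines a distribution, and it has the same Fourier coefficients
    as [v]. *)
Lemma distr_expansion (v : distr) phi :
  v phi = (RtoC (2 * PI) * CsumZ (fun k => fourier v k * tfourier phi (- k)))%C.
Proof.
  assert (E : dmultiplier one_symbol one_symbol_bounded v = v).
  { apply fourier_inj; intros k; rewrite fourier_multiplier; unfold one_symbol; ring. }
  rewrite <- E at 1; simpl; unfold multiplier_form; f_equal.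
  apply CsumZ_ext; intros k; unfold one_symbol; ring.
Qed.

Definition coef (a : Cinf) (k : Z) : C := tfourier (treal a) k.

Lemma fourier_dmul a v k :
  fourier (dmul a v) k = CsumZ (fun j => coef a (k - j) * fourier v j)%C.
Proof.
  pose proof PI_RGT_0 as Hpi.
  assert (Hpi' : RtoC (2 * PI) <> 0%C) by (intros E0; apply RtoC_inj in E0; lra).
  unfold fourier at 1; simpl; rewrite distr_expansion.
  transitivity (CsumZ (fun j => fourier v j * tfourier (tmul a (texp (- k))) (- j))%C);
    [field; auto|].
  apply CsumZ_ext; intros j; rewrite Cmult_comm; f_equal.
  unfold coef, tfourier.
  assert (E : forall x, (tval (tmul a (texp (- k))) x * tval (texp (- - j)) x =
                tval (treal a) x * tval (texp (- (k - j))) x)%C).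
  { intros x.
    replace (tval (tmul a (texp (- k))) x) with (RtoC (a x) * tval (texp (- k)) x)%C.
    2:{ apply injective_projections; simpl; unfold trig; ring. }
    rewrite tval_treal, !tval_texp.
    replace (- (k - j))%Z with (- k + - - j)%Z by lia.
    rewrite (plus_IZR (- k)), Rmult_plus_distr_r, cos_plus, sin_plus.
    apply injective_projections; simpl; ring. }
  f_equal; f_equal; apply RInt_ext; intros x _; now rewrite E.
Qed.

Definition dirac : distr.
Proof.
  refine (mkDistr (fun phi => tval phi 0) _ _).
  - intros c phi psi; apply tval_tlin.
  - exists 0%nat, 2; intros phi M [H1 H2].
    apply Rle_trans with (1 := Cmod_le_parts _).
    specialize (H1 0%nat 0 (le_n _)); specialize (H2 0%nat 0 (le_n _)); simpl in *; lra.
Defined.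

(** The coefficients of the Dirac mass are constant, so a Fourier multiplier
    applied to it has arbitrary bounded coefficients. *)
Lemma distr_of_coefficients (s : Z -> C) : bounded_symbol s ->
  exists v, forall k, fourier v k = s k.
Proof.
  pose proof PI_RGT_0 as Hpi.
  assert (Hpi' : RtoC (2 * PI) <> 0%C) by (intros E0; apply RtoC_inj in E0; lra).
  intros Hs.
  assert (Hs' : bounded_symbol (fun k => RtoC (2 * PI) * s k)%C).
  { destruct Hs as [B HB]; exists (2 * PI * B); intros k.
    rewrite Cmod_mult, Cmod_R, Rabs_pos_eq by lra; apply Rmult_le_compat_l; auto; lra. }
  exists (dmultiplier _ Hs' dirac); intros k; rewrite fourier_multiplier.
  unfold fourier; change (dirac (texp (- k))) with (tval (texp (- k)) 0).
  rewrite tval_texp, Rmult_0_r, cos_0, sin_0; change (1, 0) with (RtoC 1); field; auto.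
Qed.

Lemma l2_bounded_symbol v : l2 v -> bounded_symbol v.
Proof. intros H; exists (nrm v); intros k; now apply nrm_term. Qed.

(** * Multiplication operators and their commutators with the sign of the frequency *)

Definition jap (k : Z) : R := 1 + Rabs (IZR k).

Lemma jap_ge_1 k : 1 <= jap k.
Proof. unfold jap; pose proof (Rabs_pos (IZR k)); lra. Qed.

Lemma jap_peetre k j : jap k <= jap j * jap (k - j).
Proof.
  unfold jap; rewrite minus_IZR.
  pose proof (Rabs_triang (IZR j) (IZR k - IZR j)) as T.
  replace (IZR j + (IZR k - IZR j)) with (IZR k) in T by ring.
  pose proof (Rabs_pos (IZR j)); pose proof (Rabs_pos (IZR k - IZR j)); nra.
Qed.

Lemma jap_opp k : jap (- k) = jap k.
Proof. unfold jap; now rewrite opp_IZR, Rabs_Ropp. Qed.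

Lemma jap_peetre_l k j : jap j <= jap k * jap (k - j).
Proof.
  pose proof (jap_peetre j k) as H; replace (j - k)%Z with (- (k - j))%Z in H by lia.
  now rewrite jap_opp in H.
Qed.

Lemma coef_decay a : exists M, 0 <= M /\ forall m, Cmod (coef a m) * jap m ^ 2 <= M * qZ m.
Proof.
  destruct (test_bound_exists 4 (treal a)) as [M HM].
  pose proof (test_bound_pos _ _ _ HM) as HM0.
  assert (H0 : test_bound 0 (treal a) M).
  { destruct HM as [M1 M2]; split; apply (ck_bound_le 4 0 _ M M); auto; try lia; lra. }
  exists (32 * M); split; [lra|]; intros m.
  pose proof (tfourier_decay (treal a) m 4 M HM) as D4.
  pose proof (tfourier_decay (treal a) m 0 M H0) as D0; simpl pow in D0 at 1.
  rewrite Rmult_1_l in D0; unfold coef, qZ, jap.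
  rewrite <- (pow2_abs (IZR m)).
  set (F := Cmod (tfourier (treal a) m)) in *; set (t := Rabs (IZR m)) in *.
  assert (HF : 0 <= F) by apply Cmod_ge_0.
  assert (Ht : 0 <= t) by apply Rabs_pos.
  apply (Rmult_le_reg_r (1 + t ^ 2)); [nra|].
  rewrite (Rmult_assoc (32 * M)), Rinv_l, Rmult_1_r by nra.
  assert (P : (1 + t) ^ 2 * (1 + t ^ 2) <= 4 * (1 + t ^ 4)).
  { assert ((1 + t) ^ 2 <= 2 * (1 + t ^ 2)) by (pose proof (pow2_ge_0 (1 - t)); nra).
    assert ((1 + t ^ 2) ^ 2 <= 2 * (1 + t ^ 4)).
    { replace (t ^ 4) with (t ^ 2 * t ^ 2) by ring; pose proof (pow2_ge_0 (1 - t ^ 2)); nra. }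
    apply Rle_trans with (2 * (1 + t ^ 2) * (1 + t ^ 2)); [|lra].
    apply Rmult_le_compat_r; nra. }
  apply Rle_trans with (F * (4 * (1 + t ^ 4))).
  - rewrite Rmult_assoc; now apply Rmult_le_compat_l.
  - lra.
Qed.

Lemma coef_parts a k : coef a k =
  (/ (2 * PI) * trig_int a (- k) 1 0, / (2 * PI) * trig_int a (- k) 0 1).
Proof.
  assert (Z : forall A B, trig_int (cinf_const 0) (- k) A B = 0).
  { intros A B; unfold trig_int.
    rewrite (RInt_lin_Cinf (cinf_const 0) (cinf_const 0) _ 0 0); [ring|].
    intros x; cbn [cinf_mult cinf_fun]; rewrite cinf_const_val; ring. }
  unfold coef; rewrite tfourier_parts; simpl tre; simpl tim; rewrite !Z; f_equal; ring.
Qed.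

Lemma coef_conj a k : Cconj (coef a k) = coef a (- k).
Proof.
  assert (E1 : trig_int a k 1 0 = trig_int a (- k) 1 0).
  { apply RInt_ext; intros x _; simpl; unfold trig; rewrite opp_IZR.
    replace (- IZR k * x) with (- (IZR k * x)) by ring; rewrite cos_neg.
    f_equal; ring. }
  assert (E2 : trig_int a k 0 1 = - trig_int a (- k) 0 1).
  { transitivity (trig_int a k (-1 * 0) (-1 * -1)).
    - f_equal; ring.
    - rewrite trig_int_scal; replace (trig_int a k 0 (-1)) with (trig_int a (- k) 0 1); [ring|].
      apply RInt_ext; intros x _; simpl; unfold trig; rewrite opp_IZR.
      replace (- IZR k * x) with (- (IZR k * x)) by ring; rewrite sin_neg.
      f_equal; ring. }
  rewrite !coef_parts, Z.opp_involutive, E1, E2; apply injective_projections; simpl; ring.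
Qed.

Lemma coef_deriv a k : coef (cinf_deriv a) k = (Ci * RtoC (IZR k) * coef a k)%C.
Proof.
  rewrite !coef_parts.
  pose proof (trig_int_parts a (- k) 1 0) as E1; pose proof (trig_int_parts a (- k) 0 1) as E2.
  replace (trig_int a (- k) (IZR (- k) * 0) (- (IZR (- k) * 1))) with (IZR k * trig_int a (- k) 0 1) in E1.
  2:{ rewrite <- trig_int_scal, opp_IZR; f_equal; ring. }
  replace (trig_int a (- k) (IZR (- k) * 1) (- (IZR (- k) * 0))) with (- IZR k * trig_int a (- k) 1 0) in E2.
  2:{ rewrite <- trig_int_scal, opp_IZR; f_equal; ring. }
  assert (F1 : trig_int (cinf_deriv a) (- k) 1 0 = - (IZR k * trig_int a (- k) 0 1)) by lra.
  assert (F2 : trig_int (cinf_deriv a) (- k) 0 1 = IZR k * trig_int a (- k) 1 0) by lra.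
  rewrite F1, F2; apply injective_projections; simpl; ring.
Qed.

Definition mul_kernel (a : Cinf) (k j : Z) : C := coef a (k - j).

Definition mul_op (a : Cinf) : (Z -> C) -> Z -> C := kop (mul_kernel a).

Definition sgnZ (k : Z) : R := if Z_le_dec 0 k then 1 else -1.

Definition sg : (Z -> C) -> Z -> C := dg (fun k => RtoC (sgnZ k)).

Definition vsub (v w : Z -> C) : Z -> C := fun k => (v k - w k)%C.

Definition comm (a : Cinf) (v : Z -> C) : Z -> C := vsub (mul_op a (sg v)) (sg (mul_op a v)).

Lemma fourier_dmul_op a v : fourier (dmul a v) = mul_op a (fourier v).
Proof. apply seq_ext; intros k; apply fourier_dmul. Qed.

(** Every kernel used below is [coef a (k - j)] times a factor of at most
    quadratic growth in [k - j]. *)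
Lemma kernel_coef_bound a L : 0 <= L -> exists alpha, forall K,
  (forall k j, Cmod (K k j) <= L * (Cmod (coef a (k - j)) * jap (k - j) ^ 2)) ->
  kernel_le K alpha.
Proof.
  intros HL; destruct (coef_decay a) as [M [HM H]].
  exists (fun m => L * (M * qZ m)); intros K HK; split.
  - apply ex_sumZ_scal, ex_sumZ_scal, ex_sumZ_qZ.
  - intros k j; apply Rle_trans with (1 := HK k j), Rmult_le_compat_l; auto.
Qed.

Lemma mul_kernel_le a : exists alpha, kernel_le (mul_kernel a) alpha.
Proof.
  destruct (kernel_coef_bound a 1 Rle_0_1) as [alpha H]; exists alpha; apply H.
  intros k j; unfold mul_kernel; pose proof (jap_ge_1 (k - j)).
  pose proof (Cmod_ge_0 (coef a (k - j))).
  assert (1 <= jap (k - j) ^ 2) by nra; nra.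
Qed.

Lemma l2_mul a v : l2 v -> l2 (mul_op a v).
Proof. destruct (mul_kernel_le a) as [alpha H]; now apply (l2_kop _ alpha). Qed.

Lemma nrm_mul a : exists L, 0 <= L /\ forall v, l2 v -> nrm (mul_op a v) <= L * nrm v.
Proof.
  destruct (mul_kernel_le a) as [alpha H]; exists (sumZ alpha); split.
  - apply sumZ_ge_0; [exact (kernel_ge_0 _ _ H) | apply H].
  - intros v Hv; now apply nrm_kop.
Qed.

Lemma mul_add a v w : l2 v -> l2 w -> mul_op a (vadd v w) = vadd (mul_op a v) (mul_op a w).
Proof. destruct (mul_kernel_le a) as [alpha H]; now apply (kop_add _ alpha). Qed.

Lemma mul_scal a c v : l2 v -> mul_op a (vscal c v) = vscal c (mul_op a v).
Proof. destruct (mul_kernel_le a) as [alpha H]; now apply (kop_scal _ alpha). Qed.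

Lemma mul_adjoint a v w : l2 v -> l2 w -> ip (mul_op a v) w = ip v (mul_op a w).
Proof.
  intros Hv Hw; destruct (mul_kernel_le a) as [alpha H].
  unfold mul_op; rewrite (kop_adjoint _ alpha) by auto.
  do 2 f_equal; apply functional_extensionality; intro k; apply functional_extensionality; intro j.
  unfold mul_kernel; rewrite coef_conj; f_equal; lia.
Qed.

(** Lifting [v] to a distribution makes multiplication operators compose like
    the functions they multiply by. *)
Lemma mul_mult a b v : l2 v -> mul_op (cinf_mult a b) v = mul_op a (mul_op b v).
Proof.
  intros Hv; destruct (distr_of_coefficients v (l2_bounded_symbol v Hv)) as [d Hd].
  assert (E : v = fourier d) by (apply seq_ext; intros k; now rewrite Hd).
  rewrite E, <- !fourier_dmul_op; f_equal.
  apply distr_ext; intros phi; simpl; f_equal; apply test_ext; intros x.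
  apply injective_projections; simpl; ring.
Qed.

Lemma mul_comm a b v : l2 v -> mul_op a (mul_op b v) = mul_op b (mul_op a v).
Proof.
  intros Hv; rewrite <- !mul_mult by auto; f_equal; apply Cinf_ext; intros x; simpl; ring.
Qed.

Lemma sgnZ_abs k : Cmod (RtoC (sgnZ k)) <= 1.
Proof. unfold sgnZ; rewrite Cmod_R; destruct (Z_le_dec 0 k); apply Rabs_le; lra. Qed.

Lemma l2_sg v : l2 v -> l2 (sg v).
Proof. apply (l2_dg _ _ 1 sgnZ_abs). Qed.

Lemma nrm_sg v : l2 v -> nrm (sg v) <= nrm v.
Proof. intros H; pose proof (nrm_dg _ v 1 sgnZ_abs H); unfold sg; lra. Qed.

Lemma ip_sg v w : ip (sg v) w = ip v (sg w).
Proof. apply ip_dg. Qed.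

Definition jinv : (Z -> C) -> Z -> C := dg (fun k => RtoC (/ jap k)).

Lemma jinv_abs k : Cmod (RtoC (/ jap k)) <= 1.
Proof.
  pose proof (jap_ge_1 k); rewrite Cmod_R, Rabs_pos_eq by (apply Rlt_le, Rinv_0_lt_compat; lra).
  rewrite <- Rinv_1; apply Rinv_le_contravar; lra.
Qed.

Lemma l2_jinv v : l2 v -> l2 (jinv v).
Proof. apply (l2_dg _ _ 1 jinv_abs). Qed.

Lemma nrm_jinv v : l2 v -> nrm (jinv v) <= nrm v.
Proof. intros H; rewrite <- (Rmult_1_l (nrm v)); exact (nrm_dg _ v 1 jinv_abs H). Qed.

Lemma comm_kernel a v k : l2 v ->
  comm a v k = CsumZ (fun j => coef a (k - j) * RtoC (sgnZ j - sgnZ k) * v j)%C.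
Proof.
  intros Hv; destruct (mul_kernel_le a) as [alpha H].
  unfold comm, vsub, mul_op, kop, sg, dg.
  transitivity (CsumZ (fun j => mul_kernel a k j * (RtoC (sgnZ j) * v j) +
    - RtoC (sgnZ k) * (mul_kernel a k j * v j))%C).
  - rewrite CsumZ_plus, CsumZ_scal; [ring | | |].
    + now apply (kernel_cabs _ alpha).
    + apply (kernel_cabs _ alpha _ k H (l2_sg v Hv)).
    + now apply cabs_scal, (kernel_cabs _ alpha).
  - apply CsumZ_ext; intros j; unfold mul_kernel; rewrite RtoC_minus; ring.
Qed.

(** Only pairs of opposite signs contribute, and for these both [|k|] and [|j|]
    are at most [|k - j|]. *)
Lemma sgnZ_gap k j : Rabs (sgnZ j - sgnZ k) * (jap k * jap j) <= 2 * jap (k - j) ^ 2.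
Proof.
  pose proof (jap_ge_1 k); pose proof (jap_ge_1 j); pose proof (jap_ge_1 (k - j)).
  assert (E : sgnZ j = sgnZ k \/ (Rabs (sgnZ j - sgnZ k) = 2 /\ jap k <= jap (k - j) /\ jap j <= jap (k - j))).
  { unfold sgnZ, jap; rewrite <- !abs_IZR.
    destruct (Z_le_dec 0 j), (Z_le_dec 0 k); auto; right.
    - replace (1 - -1) with 2 by ring; rewrite Rabs_pos_eq by lra.
      split; [auto|]; split; apply Rplus_le_compat_l, IZR_le; lia.
    - replace (-1 - 1) with (-2) by ring; rewrite Rabs_left by lra.
      split; [ring|]; split; apply Rplus_le_compat_l, IZR_le; lia. }
  destruct E as [->|[-> [E1 E2]]].
  - rewrite Rminus_diag, Rabs_R0; nra.
  - apply Rmult_le_compat_l; [lra|]; replace (jap (k - j) ^ 2) with (jap (k - j) * jap (k - j)) by ring.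
    apply Rmult_le_compat; lra.
Qed.

Lemma comm_kernel_term k j (c : C) x :
  (c * RtoC (sgnZ j - sgnZ k) * x = c * RtoC ((sgnZ j - sgnZ k) * jap j) * (RtoC (/ jap j) * x))%C.
Proof.
  rewrite RtoC_mult; transitivity (c * RtoC (sgnZ j - sgnZ k) * (RtoC (jap j) * RtoC (/ jap j)) * x)%C;
    [|ring].
  rewrite <- RtoC_mult, Rinv_r by (pose proof (jap_ge_1 j); lra); ring.
Qed.

(** By [sgnZ_gap] the kernel absorbs a factor [jap] on each side.  The one-sided
    bound serves the damping coefficient, the two-sided one the multiplier [q],
    where a factor [tau^2] has to be compensated. *)
Lemma nrm_comm a : exists L, 0 <= L /\ forall v, l2 v ->
  l2 (comm a v) /\ nrm (comm a v) <= L * nrm (jinv v) /\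
  Cmod (ip (comm a v) v) <= L * nrm (jinv v) ^ 2.
Proof.
  destruct (kernel_coef_bound a 2 ltac:(lra)) as [alpha H].
  pose (K1 := fun k j => (coef a (k - j) * RtoC ((sgnZ j - sgnZ k) * jap j))%C).
  pose (K2 := fun k j => (RtoC (jap k) * (coef a (k - j) * RtoC ((sgnZ j - sgnZ k) * jap j)))%C).
  assert (H2 : kernel_le K2 alpha).
  { apply H; intros k j; unfold K2; rewrite !Cmod_mult, !Cmod_R, Rabs_mult.
    pose proof (sgnZ_gap k j); pose proof (jap_ge_1 k); pose proof (jap_ge_1 j).
    rewrite !(Rabs_pos_eq (jap _)) by lra.
    pose proof (Cmod_ge_0 (coef a (k - j))); nra. }
  assert (H1 : kernel_le K1 alpha).
  { destruct H2 as [E H2]; split; auto; intros k j; apply Rle_trans with (2 := H2 k j).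
    unfold K1, K2; rewrite (Cmod_mult (RtoC (jap k))), Cmod_R.
    pose proof (jap_ge_1 k); rewrite Rabs_pos_eq by lra.
    pose proof (Cmod_ge_0 (coef a (k - j) * RtoC ((sgnZ j - sgnZ k) * jap j))); nra. }
  assert (H0 : 0 <= sumZ alpha) by (apply sumZ_ge_0; [exact (kernel_ge_0 _ _ H1) | apply H1]).
  exists (sumZ alpha); split; auto; intros v Hv.
  pose proof (l2_jinv v Hv) as Hj.
  assert (E1 : comm a v = kop K1 (jinv v)).
  { apply seq_ext; intros k; rewrite comm_kernel by auto.
    apply CsumZ_ext; intros j; apply comm_kernel_term. }
  rewrite E1; split; [now apply (l2_kop _ alpha)|]; split; [now apply nrm_kop|].
  replace (ip (kop K1 (jinv v)) v) with (ip (kop K2 (jinv v)) (jinv v)).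
  - apply Rle_trans with (nrm (kop K2 (jinv v)) * nrm (jinv v)).
    + apply ip_le; auto; now apply (l2_kop _ alpha).
    + simpl; rewrite Rmult_1_r, <- Rmult_assoc; apply Rmult_le_compat_r; [apply nrm_ge_0|].
      now apply nrm_kop.
  - apply CsumZ_ext; intros k; unfold kop at 1, K2.
    rewrite (CsumZ_ext _ (fun j => RtoC (jap k) * (K1 k j * jinv v j))%C)
      by (intros j; unfold K1; ring).
    rewrite CsumZ_scal by now apply (kernel_cabs _ alpha).
    unfold jinv at 2, dg; rewrite Cmult_conj.
    replace (Cconj (RtoC (/ jap k))) with (RtoC (/ jap k)) by (apply injective_projections; simpl; ring).
    fold (kop K1 (jinv v) k).
    transitivity ((RtoC (jap k) * RtoC (/ jap k)) * (kop K1 (jinv v) k * Cconj (v k)))%C; [ring|].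
    rewrite <- RtoC_mult, Rinv_r by (pose proof (jap_ge_1 k); lra); ring.
Qed.

(** Conjugation by the weight multiplies the kernel by at most
    [L0 * jap (k - j)], which the decay of the coefficients absorbs. *)
Lemma nrm_mul_weight a (om : Z -> R) L0 : 0 <= L0 -> (forall k, 0 < om k) ->
  (forall k j, om k <= L0 * om j * jap (k - j)) ->
  exists L, 0 <= L /\ forall v, l2 v -> l2 (dg (fun k => RtoC (om k)) v) ->
    l2 (dg (fun k => RtoC (om k)) (mul_op a v)) /\
    nrm (dg (fun k => RtoC (om k)) (mul_op a v)) <= L * nrm (dg (fun k => RtoC (om k)) v).
Proof.
  intros HL Hom Hslow; destruct (kernel_coef_bound a L0 HL) as [alpha H].
  pose (K := fun k j => (RtoC (om k) * (coef a (k - j) * RtoC (/ om j)))%C).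
  assert (HK : kernel_le K alpha).
  { apply H; intros k j; unfold K; rewrite !Cmod_mult, !Cmod_R.
    pose proof (Hom k); pose proof (Hom j) as Hj; pose proof (Rinv_0_lt_compat _ Hj).
    rewrite !Rabs_pos_eq by lra.
    pose proof (Cmod_ge_0 (coef a (k - j))); pose proof (jap_ge_1 (k - j)).
    assert (E : om k * / om j <= L0 * jap (k - j)).
    { apply (Rmult_le_reg_r (om j)); auto; rewrite Rmult_assoc, Rinv_l, Rmult_1_r by lra.
      pose proof (Hslow k j); lra. }
    replace (om k * (Cmod (coef a (k - j)) * / om j)) with (Cmod (coef a (k - j)) * (om k * / om j)) by ring.
    replace (L0 * (Cmod (coef a (k - j)) * jap (k - j) ^ 2))
      with (Cmod (coef a (k - j)) * (L0 * jap (k - j) * jap (k - j))) by ring.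
    apply Rmult_le_compat_l; auto; apply Rle_trans with (1 := E).
    rewrite <- (Rmult_1_r (L0 * jap (k - j))) at 1; apply Rmult_le_compat_l; [|lra].
    apply Rmult_le_pos; lra. }
  exists (sumZ alpha); split.
  { apply sumZ_ge_0; [exact (kernel_ge_0 _ _ HK) | apply HK]. }
  intros v Hv Hw.
  replace (dg (fun k => RtoC (om k)) (mul_op a v)) with (kop K (dg (fun k => RtoC (om k)) v)).
  - split; [now apply (l2_kop _ alpha) | now apply nrm_kop].
  - apply seq_ext; intros k; destruct (mul_kernel_le a) as [al Ha].
    unfold mul_op, kop, dg; rewrite <- CsumZ_scal by now apply (kernel_cabs _ al).
    apply CsumZ_ext; intros j; unfold K, mul_kernel.
    transitivity (RtoC (om k) * (coef a (k - j) * (RtoC (/ om j) * RtoC (om j)) * v j))%C; [ring|].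
    rewrite <- RtoC_mult, Rinv_l by (pose proof (Hom j); lra); ring.
Qed.

Definition ddx : (Z -> C) -> Z -> C := dg (fun k => Ci * RtoC (IZR k))%C.

Lemma ddx_mul a v : l2 v -> l2 (ddx v) ->
  ddx (mul_op a v) = vadd (mul_op (cinf_deriv a) v) (mul_op a (ddx v)).
Proof.
  intros Hv Hd; destruct (mul_kernel_le a) as [al Ha], (mul_kernel_le (cinf_deriv a)) as [al' Ha'].
  apply seq_ext; intros k; unfold vadd, mul_op, kop.
  unfold ddx at 1, dg.
  rewrite <- CsumZ_scal by now apply (kernel_cabs _ al).
  rewrite <- CsumZ_plus; [|now apply (kernel_cabs _ al')|now apply (kernel_cabs _ al)].
  apply CsumZ_ext; intros j; unfold mul_kernel, ddx, dg; rewrite coef_deriv, minus_IZR, RtoC_minus; ring.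
Qed.

Lemma is_derive_RInt_Cinf (f : Cinf) x : is_derive (fun y => RInt f 0 y) x (f x).
Proof.
  apply (is_derive_RInt (V := R_NormedModule) f (fun y => RInt f 0 y) 0).
  - exists (mkposreal 1 Rlt_0_1); intros y _.
    apply (RInt_correct (V := R_CompleteNormedModule)), ex_RInt_Cinf.
  - apply Cinf_continuous.
Qed.

(** The primitive [int_0^x f] is periodic because its increment over a period has
    derivative zero and vanishes at [0]. *)
Lemma Cinf_primitive (f : Cinf) : RInt f 0 (2 * PI) = 0 -> exists q, cinf_deriv q = f.
Proof.
  intros H0; set (F := fun y => RInt f 0 y).
  assert (D : forall x, is_derive F x (f x)) by (intros x; apply is_derive_RInt_Cinf).
  assert (DF : forall x, Derive F x = f x) by (intros x; apply is_derive_unique, D).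
  assert (SF : smooth F).
  { intros [|n] x; [exact I|]; apply ex_derive_n_step.
    - intros y; exists (f y); apply D.
    - intros y; apply (ex_derive_n_ext f); [intros z; now rewrite DF | apply cinf_smooth]. }
  assert (PF : forall x, F (x + 2 * PI) = F x).
  { intros x; set (G := fun y => F (y + 2 * PI) - F y).
    assert (DG : forall y, is_derive G y 0).
    { intros y; unfold G.
      replace 0 with (1 * f (y + 2 * PI) - f y) by (rewrite cinf_periodic; ring).
      apply (is_derive_minus (fun y => F (y + 2 * PI)) F); auto.
      apply (is_derive_comp F (fun z => z + 2 * PI)); auto.
      auto_derive; auto; ring. }
    destruct (MVT_gen G 0 x (fun _ => 0)) as [c [_ E]].
    - intros t _; apply DG.
    - intros t _; apply continuity_pt_filterlim, (ex_derive_continuous G); exists 0; apply DG.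
    - assert (G x = 0); [|unfold G in *; lra].
      assert (G 0 = 0); [|lra].
      unfold G; rewrite Rplus_0_l; unfold F at 1; rewrite H0; unfold F; rewrite RInt_point.
      apply Rminus_diag_eq; reflexivity. }
  exists (mkCinf F SF PF); apply Cinf_ext; exact DF.
Qed.

Definition mean (a : Cinf) : R := / (2 * PI) * RInt a 0 (2 * PI).

(** If the mean vanished, [a^2] would have a periodic primitive, which is monotone
    and hence constant. *)
Lemma mean_sqr_pos (a : Cinf) : (exists x, a x <> 0) -> 0 < mean (cinf_sqr a).
Proof.
  pose proof PI_RGT_0 as Hpi; intros [x1 Hx1]; set (f := cinf_sqr a).
  unfold mean; apply Rmult_lt_0_compat; [apply Rinv_0_lt_compat; lra|].
  assert (F0 : forall x, 0 <= f x) by (intros x; change (0 <= a x * a x); nra).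
  assert (I0 : 0 <= RInt f 0 (2 * PI)) by (apply RInt_ge_0; [lra | apply ex_RInt_Cinf | auto]).
  destruct (Req_dec (RInt f 0 (2 * PI)) 0) as [E|E]; [exfalso|lra].
  destruct (Cinf_primitive f E) as [q Hq].
  assert (Dq : forall x, Derive q x = f x) by (intros x; now rewrite <- Hq).
  assert (Inc : forall x y, x <= y -> q x <= q y).
  { intros x y Hxy; destruct (MVT_gen q x y f) as [c [_ Ec]].
    - intros t _; rewrite <- Dq; apply Derive_correct, smooth_ex_derive, cinf_smooth.
    - intros t _; apply Cinf_continuity.
    - pose proof (Rmult_le_pos _ (y - x) (F0 c) ltac:(lra)); lra. }
  assert (Loc : locally x1 (fun y => q y = q x1)).
  { exists (mkposreal (2 * PI) ltac:(lra)); intros y Hy; change (Rabs (y - x1) < 2 * PI) in Hy.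
    apply Rabs_def2 in Hy; pose proof (cinf_periodic q x1); pose proof (cinf_periodic q y).
    pose proof (Inc x1 (y + 2 * PI) ltac:(lra)); pose proof (Inc y (x1 + 2 * PI) ltac:(lra)); lra. }
  apply Hx1; cut (a x1 * a x1 = 0); [nra|].
  change (f x1 = 0); rewrite <- Dq, (Derive_ext_loc _ _ _ Loc); apply Derive_const.
Qed.

(** The multiplier of the energy identity is a primitive of [a^2 - mean]. *)
Lemma exists_multiplier (a : Cinf) : exists q, forall v, l2 v ->
  mul_op (cinf_deriv q) v =
  vadd (mul_op a (mul_op a v)) (vscal (RtoC (- mean (cinf_sqr a))) v).
Proof.
  pose proof PI_RGT_0 as Hpi.
  set (m := mean (cinf_sqr a)).
  set (f := cinf_scal_plus 1 (cinf_sqr a) (- m) (cinf_const 1)).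
  destruct (Cinf_primitive f) as [q Hq].
  { unfold f; rewrite RInt_cinf_scal_plus, RInt_cinf_const; unfold m, mean.
    match goal with |- ?u = ?w => change (@eq R u w) end; field; lra. }
  exists q; intros v Hv; rewrite Hq, <- mul_mult by auto.
  destruct (distr_of_coefficients v (l2_bounded_symbol v Hv)) as [d Hd].
  assert (E : v = fourier d) by (apply seq_ext; intros k; now rewrite Hd).
  rewrite E, <- !fourier_dmul_op; apply seq_ext; intros k.
  unfold vadd, vscal, dg; rewrite Cplus_comm, <- fourier_dlin.
  apply (f_equal (fun w => fourier w k)), distr_ext; intros phi; simpl; rewrite <- distr_linear.
  f_equal; apply test_ext; intros x; rewrite tval_tlin; unfold f, cinf_sqr.
  pose proof (cinf_const_val 1 x) as E1; simpl in E1.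
  apply injective_projections; simpl; rewrite E1; ring.
Qed.

(** * The symbol of the operator P *)

Lemma tanh_exp x : tanh x = 1 - 2 / (exp (2 * x) + 1).
Proof.
  assert (E : exp (2 * x) = exp x * exp x) by (rewrite <- exp_plus; f_equal; ring).
  pose proof (exp_pos x) as P; rewrite E.
  unfold tanh, sinh, cosh; rewrite exp_Ropp; field; split; nra.
Qed.

Lemma tanh_opp x : tanh (- x) = - tanh x.
Proof.
  unfold tanh, sinh, cosh; rewrite Ropp_involutive.
  pose proof (exp_pos x); pose proof (exp_pos (- x)); field; lra.
Qed.

Lemma p_beta_abs beta k : k <> 0%Z -> 0 < beta ->
  p_beta beta k * (beta * Rabs (IZR k)) = tanh (beta * Rabs (IZR k)).
Proof.
  intros Hk Hb; unfold p_beta; destruct (Z.eq_dec k 0); [lia|].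
  assert (Hk' : IZR k <> 0) by now apply not_0_IZR.
  unfold Rabs; destruct (Rcase_abs (IZR k)).
  - replace (beta * - IZR k) with (- (beta * IZR k)) by ring; rewrite tanh_opp; field; lra.
  - field; lra.
Qed.

(** [p_beta] behaves like [1 / (beta |k|)] because [1 - tanh x] is
    [2 / (exp (2 x) + 1)]; of this exponentially small error only the quadratic
    decay is retained. *)
Lemma p_beta_asymptotics beta : 0 < beta -> exists c1 c2 c3, 0 < c1 /\ 0 < c2 /\ 0 < c3 /\ forall k,
  c1 <= p_beta beta k * jap k <= c2 /\
  0 <= 1 - beta * Rabs (IZR k) * p_beta beta k <= c3 * (/ jap k) ^ 2.
Proof.
  intros Hb.
  assert (T0 : forall x, 0 < x -> 0 < tanh x < 1).
  { intros x Hx; rewrite tanh_exp; pose proof (exp_ineq1 (2 * x)) as E.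
    assert (2 < exp (2 * x) + 1) by (specialize (E ltac:(lra)); lra).
    assert (0 < 2 / (exp (2 * x) + 1) < 1); [|lra]; split.
    - apply Rdiv_lt_0_compat; lra.
    - apply (Rmult_lt_reg_r (exp (2 * x) + 1)); [lra|]; unfold Rdiv.
      rewrite Rmult_assoc, Rinv_l by lra; lra. }
  assert (Tm : forall x, beta <= x -> tanh beta <= tanh x).
  { intros x Hx; rewrite !tanh_exp.
    assert (exp (2 * beta) <= exp (2 * x)).
    { destruct Hx as [Hx| ->]; [|lra]; apply Rlt_le, exp_increasing; lra. }
    pose proof (exp_pos (2 * beta)).
    assert (2 / (exp (2 * x) + 1) <= 2 / (exp (2 * beta) + 1)); [|lra].
    apply Rmult_le_compat_l; [lra|]; apply Rinv_le_contravar; lra. }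
  assert (Te : forall t, 0 <= t -> 1 - tanh (beta * t) <= 2 / (1 + beta * t) ^ 2).
  { intros t Ht; rewrite tanh_exp.
    assert (H1 : 1 + beta * t <= exp (beta * t)) by apply exp_ineq1_le.
    assert (E : exp (2 * (beta * t)) = exp (beta * t) * exp (beta * t))
      by (rewrite <- exp_plus; f_equal; ring).
    assert (0 <= beta * t) by nra.
    replace (1 - (1 - 2 / (exp (2 * (beta * t)) + 1))) with (2 / (exp (2 * (beta * t)) + 1)) by ring.
    apply Rmult_le_compat_l; [lra|]; apply Rinv_le_contravar; nra. }
  pose proof (T0 beta Hb) as TB.
  set (th := tanh beta) in *.
  set (d := Rmin 1 beta).
  assert (Hd : 0 < d /\ d <= 1 /\ d <= beta).
  { unfold d; split; [apply Rmin_pos; lra | split; [apply Rmin_l | apply Rmin_r]]. }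
  assert (Hib : 0 < / beta) by (apply Rinv_0_lt_compat; lra).
  exists (Rmin 1 (th / beta)), (Rmax 1 (2 / beta)), (2 / d ^ 2).
  assert (Hd2 : 0 < d ^ 2) by (apply pow_lt; lra).
  assert (Hc1 : 0 < th / beta) by (apply Rdiv_lt_0_compat; lra).
  split; [apply Rmin_pos; lra|]; split; [apply Rlt_le_trans with (2 := Rmax_l _ _); lra|].
  split; [apply Rdiv_lt_0_compat; lra|]; intros k.
  destruct (Z.eq_dec k 0) as [->|Hk].
  - unfold jap, p_beta; destruct (Z.eq_dec 0 0); [|lia].
    rewrite Rabs_R0, Rplus_0_r, Rinv_1, !Rmult_1_r, pow1, Rmult_1_r.
    split; [split; [apply Rmin_l | apply Rmax_l]|].
    split; [lra|].
    assert (1 <= / d ^ 2); [|lra].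
    rewrite <- Rinv_1; apply Rinv_le_contravar; auto; nra.
  - pose proof (p_beta_abs beta k Hk Hb) as E.
    assert (Ht : 1 <= Rabs (IZR k)) by (rewrite <- abs_IZR; apply IZR_le; lia).
    unfold jap; set (t := Rabs (IZR k)) in *; set (p := p_beta beta k) in *.
    assert (Hbt : beta <= beta * t) by nra.
    pose proof (T0 (beta * t) ltac:(lra)) as T1; pose proof (Tm (beta * t) Hbt) as T2.
    pose proof (Te t ltac:(lra)) as T3.
    rewrite <- E in T1, T2, T3.
    assert (Q1 : th / beta <= p * t).
    { apply (Rmult_le_reg_l beta); [lra|]; replace (beta * (th / beta)) with th by (field; lra); lra. }
    assert (Q2 : p * t <= / beta).
    { apply (Rmult_le_reg_l beta); [lra|]; rewrite Rinv_r by lra; lra. }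
    assert (P0 : 0 < p) by nra.
    assert (Q3 : p <= p * t) by nra.
    split; [split|split].
    + apply Rle_trans with (1 := Rmin_r _ _); lra.
    + apply Rle_trans with (2 := Rmax_r _ _); unfold Rdiv; lra.
    + lra.
    + replace (1 - beta * t * p) with (1 - p * (beta * t)) by ring.
      apply Rle_trans with (1 := T3).
      unfold Rdiv; rewrite pow_inv, Rmult_assoc, <- Rinv_mult.
      apply Rmult_le_compat_l; [lra|]; apply Rinv_le_contravar.
      * apply Rmult_lt_0_compat; auto; apply pow_lt; lra.
      * rewrite <- Rpow_mult_distr; apply pow_incr; split; nra.
Qed.

Definition root_p (beta : R) (k : Z) : R := sqrt (p_beta beta k).

(** The consequences of [p_beta_asymptotics] in the form in which they are
    used, all with one constant. *)
Lemma p_beta_bounds beta : 0 < beta -> exists K, 1 <= K /\ forall k,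
  0 < root_p beta k /\ root_p beta k ^ 2 = p_beta beta k /\ root_p beta k <= K /\
  p_beta beta k <= K * / jap k /\ Rabs (IZR k) * p_beta beta k <= K /\
  / jap k <= K * root_p beta k /\
  / root_p beta k <= K * (Rabs (IZR k) * root_p beta k + 1) /\
  Rabs (1 - beta * Rabs (IZR k) * p_beta beta k) <= K * (/ jap k) ^ 2 /\
  forall j, / root_p beta k <= K * / root_p beta j * jap (k - j).
Proof.
  intros Hb; destruct (p_beta_asymptotics beta Hb) as [c1 [c2 [c3 [H1 [H2 [H3 H]]]]]].
  set (s := 1 + c2); set (K := 1 + s + s * / c1 + c3).
  assert (Hs : s = 1 + c2) by reflexivity.
  assert (Hi : 0 < / c1) by now apply Rinv_0_lt_compat.
  assert (Cc : c1 * / c1 = 1) by (apply Rinv_r; lra).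
  assert (Hsi : 0 < s * / c1) by (apply Rmult_lt_0_compat; lra).
  assert (KA : s <= K /\ s * / c1 <= K /\ c3 <= K /\ 1 <= K) by (unfold K; lra).
  assert (Root : forall k, 0 < p_beta beta k /\ 0 < root_p beta k /\ root_p beta k ^ 2 = p_beta beta k /\
    root_p beta k <= s).
  { intros k; destruct (H k) as [[A1 A2] _]; pose proof (jap_ge_1 k).
    assert (P : 0 < p_beta beta k) by nra; split; auto.
    pose proof (sqrt_lt_R0 _ P) as R0; fold (root_p beta k) in R0; split; auto.
    assert (E : root_p beta k ^ 2 = p_beta beta k) by (unfold root_p; rewrite pow2_sqrt; lra).
    split; auto; apply Rnot_lt_le; intros B; nra. }
  exists K; split; [lra|]; intros k; destruct (Root k) as [P [R0 [R1 R2]]].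
  destruct (H k) as [[A1 A2] [A3 A4]]; pose proof (jap_ge_1 k) as J.
  assert (JJ : jap k * / jap k = 1) by (apply Rinv_r; lra).
  assert (Rr : root_p beta k * / root_p beta k = 1) by (apply Rinv_r; lra).
  assert (Ji : 0 < / jap k) by (apply Rinv_0_lt_compat; lra).
  pose proof (Rabs_pos (IZR k)) as T.
  repeat split; auto; try lra.
  - apply Rle_trans with (c2 * / jap k); [|apply Rmult_le_compat_r; lra].
    replace (p_beta beta k) with (p_beta beta k * jap k * / jap k) by (rewrite Rmult_assoc, JJ; ring).
    apply Rmult_le_compat_r; lra.
  - unfold jap in A2; nra.
  - (* [c1 / jap <= p = r^2 <= s r] *)
    apply Rle_trans with (s * / c1 * root_p beta k); [|apply Rmult_le_compat_r; lra].
    apply (Rmult_le_reg_r (jap k)); [lra|]; apply (Rmult_le_reg_l c1); auto.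
    rewrite Rinv_l by lra.
    replace (c1 * (s * / c1 * root_p beta k * jap k)) with (c1 * / c1 * (s * root_p beta k * jap k)) by ring.
    rewrite Cc; assert (root_p beta k ^ 2 <= s * root_p beta k) by nra.
    assert (p_beta beta k * jap k <= s * root_p beta k * jap k) by (apply Rmult_le_compat_r; lra); lra.
  - (* multiply by [r]: [c1 <= p + |k| p], and [p <= s r] *)
    apply (Rmult_le_reg_r (root_p beta k)); auto; rewrite Rinv_l by lra.
    set (t := Rabs (IZR k)) in *; set (z := t * root_p beta k * root_p beta k + root_p beta k).
    assert (Z0 : 0 <= t * root_p beta k * root_p beta k) by (repeat apply Rmult_le_pos; lra).
    assert (B : c1 <= s * z) by (unfold jap in A1; fold t in A1; rewrite <- R1 in A1; unfold z; nra).
    apply Rle_trans with (s * / c1 * z).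
    + apply (Rmult_le_reg_l c1); auto.
      replace (c1 * (s * / c1 * z)) with (c1 * / c1 * (s * z)) by ring; rewrite Cc; lra.
    + replace (K * (t * root_p beta k + 1) * root_p beta k) with (K * z) by (unfold z; ring).
      apply Rmult_le_compat_r; unfold z; lra.
  - rewrite Rabs_pos_eq by lra; apply Rle_trans with (1 := A4).
    apply Rmult_le_compat_r; [apply pow2_ge_0 | lra].
  - (* [p_j <= (c2 / c1) jap (k - j) p_k], then take square roots *)
    intros j; destruct (Root j) as [Pj [S0 [S1 S2]]]; destruct (H j) as [[_ B2] _].
    pose proof (jap_peetre k j) as Pe; pose proof (jap_ge_1 (k - j)) as Jd; pose proof (jap_ge_1 j) as Jj.
    set (z := K * jap (k - j)); assert (Z1 : 1 <= z) by (unfold z; nra).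
    assert (Ineq : p_beta beta j <= z * p_beta beta k).
    { apply (Rmult_le_reg_r (jap j)); [lra|]; apply Rle_trans with (s * / c1 * (p_beta beta k * jap k)).
      - apply Rle_trans with (1 := B2), Rle_trans with (s * / c1 * c1); [|apply Rmult_le_compat_l; lra].
        rewrite Rmult_assoc, (Rmult_comm (/ c1)), Cc; lra.
      - replace (z * p_beta beta k * jap j) with (K * (p_beta beta k * (jap j * jap (k - j))))
          by (unfold z; ring).
        apply Rmult_le_compat; [lra | apply Rmult_le_pos; lra | lra | apply Rmult_le_compat_l; lra]. }
    assert (Sj : root_p beta j * / root_p beta j = 1) by (apply Rinv_r; lra).
    apply (Rmult_le_reg_r (root_p beta j)); auto; apply (Rmult_le_reg_l (root_p beta k)); auto.
    replace (root_p beta k * (K * / root_p beta j * jap (k - j) * root_p beta j)) with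
      (root_p beta k * z * (root_p beta j * / root_p beta j)) by (unfold z; ring).
    rewrite <- Rmult_assoc, Rr, Sj, Rmult_1_l, Rmult_1_r.
    assert (Ineq' : root_p beta j ^ 2 <= (root_p beta k * z) ^ 2).
    { rewrite S1, Rpow_mult_distr, R1; apply Rle_trans with (1 := Ineq).
      assert (z <= z ^ 2) by nra; rewrite Rmult_comm; apply Rmult_le_compat_l; lra. }
    assert (0 <= root_p beta k * z) by (apply Rmult_le_pos; lra).
    apply Rnot_lt_le; intros X; nra.
Qed.

(** * Identities and weak-norm bounds for the resolvent equation *)

Definition rdg (m : Z -> R) : (Z -> C) -> Z -> C := dg (fun k => RtoC (m k)).

Definition pmul (beta : R) := rdg (p_beta beta).
Definition rmul (beta : R) := rdg (root_p beta).
Definition rinv (beta : R) := rdg (fun k => / root_p beta k).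

(** Multiplication by [i omega], [omega = k r(k)]; [omega^2] is the symbol of
    [T_beta d/dx]. *)
Definition omv (beta : R) : (Z -> C) -> Z -> C :=
  dg (fun k => Ci * RtoC (IZR k * root_p beta k))%C.

Lemma l2_rdg m v (B : R) : (forall k, Rabs (m k) <= B) -> l2 v -> l2 (rdg m v).
Proof. intros H; apply (l2_dg _ _ B); intros k; rewrite Cmod_R; auto. Qed.

Lemma Re_le_ip v w : l2 v -> l2 w -> Rabs (Re (ip v w)) <= nrm v * nrm w.
Proof. intros Hv Hw; apply Rle_trans with (1 := re_le_Cmod _), ip_le; auto. Qed.

Lemma Im_le_ip v w : l2 v -> l2 w -> Rabs (Im (ip v w)) <= nrm v * nrm w.
Proof. intros Hv Hw; apply Rle_trans with (1 := im_le_Cmod _), ip_le; auto. Qed.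

Lemma ip_add_r v w w' : l2 v -> l2 w -> l2 w' -> ip v (vadd w w') = (ip v w + ip v w')%C.
Proof. intros; rewrite ip_conj, ip_add_l, Cplus_conj, <- !ip_conj; auto. Qed.

Lemma ip_skew (m : Z -> R) v w :
  l2 v -> l2 w -> l2 (dg (fun k => Ci * RtoC (m k))%C v) -> l2 (dg (fun k => Ci * RtoC (m k))%C w) ->
  ip (dg (fun k => Ci * RtoC (m k))%C v) w = (- ip v (dg (fun k => Ci * RtoC (m k))%C w))%C.
Proof.
  intros Hv Hw Dv Dw.
  transitivity (ip v (vscal (RtoC (-1)) (dg (fun k => Ci * RtoC (m k))%C w))).
  - apply CsumZ_ext; intros k; unfold vscal, dg.
    apply injective_projections; simpl; ring.
  - rewrite ip_conj, ip_scal_l, Cmult_conj, <- ip_conj by auto.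
    apply injective_projections; simpl; ring.
Qed.

Lemma ip_ddx v w : l2 v -> l2 w -> l2 (ddx v) -> l2 (ddx w) -> ip (ddx v) w = (- ip v (ddx w))%C.
Proof. apply ip_skew. Qed.

Lemma vsub_add v w : vsub v w = vadd v (vscal (RtoC (-1)) w).
Proof. apply seq_ext; intros k; unfold vsub, vadd, vscal, dg; ring. Qed.

Lemma l2_sub v w : l2 v -> l2 w -> l2 (vsub v w).
Proof. intros; rewrite vsub_add; auto using l2_add, l2_scal. Qed.

Lemma nrm_sub v w : l2 v -> l2 w -> nrm (vsub v w) <= nrm v + nrm w.
Proof.
  intros Hv Hw; rewrite vsub_add; apply Rle_trans with (1 := nrm_add _ _ Hv (l2_scal _ _ Hw)).
  rewrite nrm_scal, Cmod_R, (Rabs_left (-1)) by lra; lra.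
Qed.

Lemma ip_sub_l v v' w : l2 v -> l2 v' -> l2 w -> ip (vsub v v') w = (ip v w - ip v' w)%C.
Proof. intros; rewrite vsub_add, ip_add_l, ip_scal_l by auto using l2_scal; ring. Qed.

(** The two components of [(lambda - A_d) (h, u)] on the Fourier side, where
    [T_beta] is written as [- d/dx P_beta]. *)
Definition eq1 (beta : R) (a : Cinf) (lam : C) (h u : Z -> C) : Z -> C :=
  vadd (vadd (vscal lam h) (ddx (pmul beta u))) (mul_op a (mul_op a h)).

Definition eq2 (beta : R) (b : Cinf) (lam : C) (h u : Z -> C) : Z -> C :=
  vadd (vadd (vscal lam u) (ddx h)) (mul_op b (mul_op b (pmul beta u))).

Section Apriori.

Variable beta : R.
Hypothesis Hb : 0 < beta.

Lemma l2_pmul v : l2 v -> l2 (pmul beta v).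
Proof.
  destruct (p_beta_bounds beta Hb) as [K [HK B]]; apply (l2_rdg _ _ (K * K)); intros k.
  destruct (B k) as [B1 [B2 [B3 _]]]; rewrite <- B2, Rabs_pos_eq by apply pow2_ge_0.
  simpl; rewrite Rmult_1_r; apply Rmult_le_compat; lra.
Qed.

Lemma l2_rmul v : l2 v -> l2 (rmul beta v).
Proof.
  destruct (p_beta_bounds beta Hb) as [K [HK B]]; apply (l2_rdg _ _ K); intros k.
  destruct (B k) as [B1 [B2 [B3 _]]]; rewrite Rabs_pos_eq; lra.
Qed.

Lemma nrm_rmul : exists K, 0 <= K /\ forall v, l2 v -> nrm (rmul beta v) <= K * nrm v.
Proof.
  destruct (p_beta_bounds beta Hb) as [K [HK B]]; exists K; split; [lra|]; intros v Hv.
  apply nrm_dg; auto; intros k; destruct (B k) as [B1 [B2 [B3 _]]]; rewrite Cmod_R, Rabs_pos_eq; lra.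
Qed.

Lemma l2_ddx_pmul v : l2 v -> l2 (ddx (pmul beta v)).
Proof.
  destruct (p_beta_bounds beta Hb) as [K [HK B]]; apply (l2_le _ _ K); intros k.
  destruct (B k) as [B1 [B2 [_ [_ [B3 _]]]]]; unfold ddx, pmul, rdg, dg.
  rewrite !Cmod_mult, Cmod_Ci, !Cmod_R, (Rabs_pos_eq (p_beta beta k)) by (rewrite <- B2; apply pow2_ge_0).
  rewrite Rmult_1_l, <- Rmult_assoc; apply Rmult_le_compat_r; auto using Cmod_ge_0.
Qed.

Lemma nrm_jinv_ddx_pmul : exists K, 0 <= K /\ forall v, l2 v ->
  nrm (jinv (ddx (pmul beta v))) <= K * nrm (jinv v).
Proof.
  destruct (p_beta_bounds beta Hb) as [K [HK B]]; exists K; split; [lra|]; intros v Hv.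
  apply nrm_le; [lra| |now apply l2_jinv]; intros k.
  destruct (B k) as [B1 [B2 [_ [_ [B3 _]]]]]; unfold jinv, ddx, pmul, rdg, dg.
  rewrite !Cmod_mult, Cmod_Ci, !Cmod_R, (Rabs_pos_eq (p_beta beta k)) by (rewrite <- B2; apply pow2_ge_0).
  rewrite Rmult_1_l.
  replace (Rabs (/ jap k) * (Rabs (IZR k) * (p_beta beta k * Cmod (v k)))) with
    (Rabs (IZR k) * p_beta beta k * (Rabs (/ jap k) * Cmod (v k))) by ring.
  apply Rmult_le_compat_r; auto; apply Rmult_le_pos; auto using Rabs_pos, Cmod_ge_0.
Qed.

Lemma ip_pmul v w : ip v (pmul beta w) = ip (rmul beta v) (rmul beta w).
Proof.
  destruct (p_beta_bounds beta Hb) as [K [HK B]].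
  apply CsumZ_ext; intros k; destruct (B k) as [B1 [B2 _]]; unfold pmul, rmul, rdg, dg.
  rewrite <- B2; apply injective_projections; simpl; ring.
Qed.

Lemma ip_rinv v w : ip v w = ip (rmul beta v) (rinv beta w).
Proof.
  destruct (p_beta_bounds beta Hb) as [K [HK B]].
  apply CsumZ_ext; intros k; destruct (B k) as [B1 [B2 _]]; unfold rinv, rmul, rdg, dg.
  apply injective_projections; simpl; field; lra.
Qed.

Lemma l2_eq1 a lam h u : l2 h -> l2 u -> l2 (eq1 beta a lam h u).
Proof. intros; unfold eq1; auto 6 using l2_add, l2_scal, l2_mul, l2_ddx_pmul. Qed.

Lemma l2_eq2 b lam h u : l2 (ddx h) -> l2 u -> l2 (eq2 beta b lam h u).
Proof. intros; unfold eq2; auto 6 using l2_add, l2_scal, l2_mul, l2_pmul. Qed.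

(** The undamped part is skew-adjoint for the energy pairing, and each damping
    term contributes a square. *)
Lemma energy_identity a b lam h u : l2 h -> l2 (ddx h) -> l2 u ->
  let F := ip (eq1 beta a lam h u) h in
  let G := ip (eq2 beta b lam h u) (pmul beta u) in
  Re F + Re G = Re lam * (nrm h ^ 2 + nrm (rmul beta u) ^ 2) +
    nrm (mul_op a h) ^ 2 + nrm (mul_op b (pmul beta u)) ^ 2 /\
  Im F - Im G = Im lam * (nrm h ^ 2 - nrm (rmul beta u) ^ 2).
Proof.
  intros Hh Hd Hu; pose proof (l2_pmul u Hu) as Hp; pose proof (l2_ddx_pmul u Hu) as Hdp.
  set (z := ip (ddx (pmul beta u)) h).
  assert (EF : ip (eq1 beta a lam h u) h =
    (lam * RtoC (nrm h ^ 2) + z + RtoC (nrm (mul_op a h) ^ 2))%C).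
  { unfold eq1; rewrite !ip_add_l, ip_scal_l, ip_self by auto using l2_add, l2_scal, l2_mul.
    now rewrite mul_adjoint, ip_self by auto using l2_mul. }
  assert (EG : ip (eq2 beta b lam h u) (pmul beta u) =
    (lam * RtoC (nrm (rmul beta u) ^ 2) - Cconj z + RtoC (nrm (mul_op b (pmul beta u)) ^ 2))%C).
  { unfold eq2; rewrite !ip_add_l, ip_scal_l by auto using l2_add, l2_scal, l2_mul.
    rewrite (ip_pmul u u), ip_self by auto using l2_rmul.
    rewrite (mul_adjoint b _ (pmul beta u)), ip_self by auto using l2_mul.
    rewrite ip_ddx by auto; unfold z; rewrite <- ip_conj; ring. }
  cbv zeta; rewrite EF, EG; simpl; unfold Re, Im; split; ring.
Qed.

Lemma ddx_of_eq2 b lam h u :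
  ddx h = vsub (vsub (eq2 beta b lam h u) (vscal lam u)) (mul_op b (mul_op b (pmul beta u))).
Proof.
  apply seq_ext; intros k; unfold eq2, vsub, vadd; ring.
Qed.

(** Solving the second equation for [u] gains a factor [1 / lambda] at the price
    of one derivative; the multiplier [m] allows the estimate to be iterated. *)
Lemma jinv_u_bound b : exists K, 0 <= K /\ forall m lam h u,
  (forall k, Rabs (m k) <= 1) -> l2 h -> l2 (ddx h) -> l2 u ->
  Cmod lam * nrm (jinv (rdg m u)) <=
    K * (nrm (rmul beta (eq2 beta b lam h u)) + nrm (rdg m h) + nrm (mul_op b (pmul beta u))).
Proof.
  destruct (p_beta_bounds beta Hb) as [K [HK B]]; destruct (nrm_mul b) as [L [HL Bm]].
  exists (K + L + 1); split; [lra|]; intros m lam h u Hm Hh Hd Hu.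
  pose proof (l2_eq2 b lam h u Hd Hu) as Hg; pose proof (l2_pmul u Hu) as Hp.
  pose proof (l2_mul b _ Hp) as Hbp; pose proof (l2_mul b _ Hbp) as Hbbp.
  set (g := eq2 beta b lam h u) in *; set (w := mul_op b (mul_op b (pmul beta u))) in *.
  assert (HM : forall v, l2 v -> l2 (rdg m v) /\ nrm (rdg m v) <= nrm v).
  { intros v Hv; split; [exact (l2_rdg m v 1 Hm Hv)|]; rewrite <- (Rmult_1_l (nrm v)).
    apply nrm_dg; auto; intros k; rewrite Cmod_R; auto. }
  assert (Hj : l2 (jinv (ddx (rdg m h)))).
  { replace (ddx (rdg m h)) with (rdg m (ddx h)); [now apply l2_jinv, HM|].
    apply seq_ext; intros k; unfold rdg, ddx, dg; ring. }
  destruct (HM _ (l2_jinv _ Hg)) as [G1 G2], (HM _ (l2_jinv _ Hbbp)) as [W1 W2].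
  assert (E : vscal lam (jinv (rdg m u)) =
    vsub (vsub (rdg m (jinv g)) (jinv (ddx (rdg m h)))) (rdg m (jinv w))).
  { apply seq_ext; intros k; unfold g, w, eq2, vsub, vadd, rdg, jinv, ddx, vscal, dg; ring. }
  rewrite <- nrm_scal, E.
  apply Rle_trans with (1 := nrm_sub _ _ (l2_sub _ _ G1 Hj) W1).
  pose proof (nrm_sub _ _ G1 Hj) as S1.
  assert (S2 : nrm (jinv g) <= K * nrm (rmul beta g)).
  { apply nrm_le; [lra| |now apply l2_rmul]; intros k; destruct (B k) as [B1 [_ [_ [_ [_ [B2 _]]]]]].
    unfold jinv, rmul, rdg, dg; rewrite !Cmod_mult, !Cmod_R, <- Rmult_assoc.
    apply Rmult_le_compat_r; [apply Cmod_ge_0|].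
    pose proof (jap_ge_1 k); rewrite !Rabs_pos_eq; try lra; apply Rlt_le, Rinv_0_lt_compat; lra. }
  assert (S3 : nrm (jinv (ddx (rdg m h))) <= 1 * nrm (rdg m h)).
  { apply nrm_le; [lra| |now apply HM]; intros k; unfold jinv, ddx; set (v := rdg m h); unfold dg.
    rewrite !Cmod_mult, Cmod_Ci, !Cmod_R, Rmult_1_l, <- Rmult_assoc.
    apply Rmult_le_compat_r; [apply Cmod_ge_0|].
    pose proof (jap_ge_1 k) as J; unfold jap in *.
    rewrite Rabs_pos_eq by (apply Rlt_le, Rinv_0_lt_compat; lra).
    apply (Rmult_le_reg_l (1 + Rabs (IZR k))); [lra|].
    rewrite <- Rmult_assoc, Rinv_r by lra; lra. }
  pose proof (nrm_jinv _ Hbbp); pose proof (Bm _ Hbp : nrm w <= _).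
  pose proof (nrm_ge_0 (rmul beta g)); pose proof (nrm_ge_0 (rdg m h)); pose proof (nrm_ge_0 (mul_op b (pmul beta u))).
  nra.
Qed.

(** The same gain for [h] from the first equation, where [T_beta] has order
    zero. *)
Lemma jinv_h_bound a : exists K, 0 <= K /\ forall lam h u, l2 h -> l2 u ->
  Cmod lam * nrm (jinv h) <=
    K * (nrm (eq1 beta a lam h u) + nrm (mul_op a h) + nrm (jinv u)).
Proof.
  destruct nrm_jinv_ddx_pmul as [K [HK B]]; destruct (nrm_mul a) as [L [HL Hm]].
  exists (K + L + 1); split; [lra|]; intros lam h u Hh Hu.
  pose proof (l2_eq1 a lam h u Hh Hu) as Hf; pose proof (l2_ddx_pmul u Hu) as Hp.
  pose proof (l2_mul a _ Hh) as Hah; pose proof (l2_mul a _ Hah) as Haah.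
  set (f := eq1 beta a lam h u) in *.
  assert (E : vscal lam (jinv h) = vsub (vsub (jinv f) (jinv (ddx (pmul beta u)))) (jinv (mul_op a (mul_op a h)))).
  { apply seq_ext; intros k; unfold f, eq1, vsub, vadd, jinv, vscal, dg; ring. }
  rewrite <- nrm_scal, E.
  apply Rle_trans with (1 := nrm_sub _ _ (l2_sub _ _ (l2_jinv _ Hf) (l2_jinv _ Hp)) (l2_jinv _ Haah)).
  pose proof (nrm_sub _ _ (l2_jinv _ Hf) (l2_jinv _ Hp)) as S1.
  pose proof (nrm_jinv f Hf); pose proof (nrm_jinv _ Haah); pose proof (Hm _ Hah); pose proof (B u Hu).
  pose proof (nrm_ge_0 f); pose proof (nrm_ge_0 (mul_op a h)); pose proof (nrm_ge_0 (jinv u)).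
  nra.
Qed.

(** The defect of [beta T_beta = - i sgn(D)], relative to [sgn(D)]. *)
Definition err (k : Z) : R := 1 - beta * Rabs (IZR k) * p_beta beta k.

(** The defect gains two derivatives: one is spent on [jinv_u_bound], the other
    leaves the weak norm of [h]. *)
Lemma err_u_bound b : exists K, 0 <= K /\ forall lam h u, l2 h -> l2 (ddx h) -> l2 u ->
  l2 (rdg err u) /\ Cmod lam * nrm (rdg err u) <=
    K * (nrm (rmul beta (eq2 beta b lam h u)) + nrm (jinv h) + nrm (mul_op b (pmul beta u))).
Proof.
  destruct (p_beta_bounds beta Hb) as [K [HK B]]; destruct (jinv_u_bound b) as [L [HL BL]].
  exists (K * L); split; [apply Rmult_le_pos; lra|]; intros lam h u Hh Hd Hu.
  assert (Dom : forall k, Cmod (rdg err u k) <= K * Cmod (jinv (jinv u) k)).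
  { intros k; destruct (B k) as [_ [_ [_ [_ [_ [_ [_ [B1 _]]]]]]]].
    unfold rdg, jinv, dg; rewrite !Cmod_mult, !Cmod_R, <- !Rmult_assoc.
    apply Rmult_le_compat_r; [apply Cmod_ge_0|]; pose proof (jap_ge_1 k).
    rewrite (Rabs_pos_eq (/ jap k)) by (apply Rlt_le, Rinv_0_lt_compat; lra).
    unfold err; apply Rle_trans with (1 := B1), Req_le; ring. }
  pose proof (l2_jinv _ (l2_jinv _ Hu)) as Hjj.
  split; [exact (l2_le _ _ K Dom Hjj)|].
  apply Rle_trans with (K * (Cmod lam * nrm (jinv (jinv u)))).
  { replace (K * (Cmod lam * nrm (jinv (jinv u)))) with (Cmod lam * (K * nrm (jinv (jinv u)))) by ring.
    apply Rmult_le_compat_l; [apply Cmod_ge_0|]; apply nrm_le; auto; lra. }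
  rewrite Rmult_assoc; apply Rmult_le_compat_l; [lra|].
  apply (BL (fun k => / jap k)); auto.
  intros k; rewrite <- Cmod_R; apply jinv_abs.
Qed.

(** [1 / r] is at most of the order of [|k| r + 1], so [H^(1/2)] regularity is
    control of [omega v] and [v]. *)
Lemma rinv_bound : exists K, 0 <= K /\ forall v, l2 v -> l2 (omv beta v) ->
  l2 (rinv beta v) /\ nrm (rinv beta v) <= K * (nrm (omv beta v) + nrm v).
Proof.
  destruct (p_beta_bounds beta Hb) as [K [HK B]]; exists K; split; [lra|]; intros v Hv Ho.
  set (M := fun v : Z -> C => fun k => RtoC (Cmod (v k))).
  assert (HM : forall v, l2 v -> l2 (M v) /\ nrm (M v) <= nrm v).
  { intros w Hw; assert (D : forall k, Cmod (M w k) <= 1 * Cmod (w k)).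
    { intros k; unfold M; rewrite Cmod_R, Rabs_pos_eq; [lra | apply Cmod_ge_0]. }
    split; [exact (l2_le _ _ 1 D Hw)|]; pose proof (nrm_le _ _ 1 Rle_0_1 D Hw); lra. }
  destruct (HM _ Ho) as [M1 M2]; destruct (HM _ Hv) as [M3 M4].
  assert (Dom : forall k, Cmod (rinv beta v k) <= K * Cmod (vadd (M (omv beta v)) (M v) k)).
  { intros k; destruct (B k) as [B1 [_ [_ [_ [_ [_ [B2 _]]]]]]].
    pose proof (Cmod_ge_0 (omv beta v k)); pose proof (Cmod_ge_0 (v k)).
    unfold vadd, M; rewrite <- RtoC_plus, (Cmod_R (_ + _)), (Rabs_pos_eq (_ + _)) by lra.
    unfold rinv, omv, rdg, dg; rewrite !Cmod_mult, Cmod_Ci, !Cmod_R, Rabs_mult.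
    assert (0 < / root_p beta k) by now apply Rinv_0_lt_compat.
    rewrite (Rabs_pos_eq (/ root_p beta k)), (Rabs_pos_eq (root_p beta k)) by lra.
    replace (1 * (Rabs (IZR k) * root_p beta k) * Cmod (v k) + Cmod (v k)) with
      ((Rabs (IZR k) * root_p beta k + 1) * Cmod (v k)) by ring.
    rewrite <- Rmult_assoc; apply Rmult_le_compat_r; auto. }
  pose proof (l2_add _ _ M1 M3) as M5; split; [exact (l2_le _ _ K Dom M5)|].
  apply Rle_trans with (1 := nrm_le _ _ K ltac:(lra) Dom M5), Rmult_le_compat_l; [lra|].
  apply Rle_trans with (1 := nrm_add _ _ M1 M3); lra.
Qed.

(** [omega h] is read off the second equation.  This is the [H^(1/2)] norm that is
    paired with the [H^(-1/2)] datum [g]. *)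
Lemma rinv_h_bound b : exists K, 0 <= K /\ forall lam h u, l2 h -> l2 (ddx h) -> l2 u ->
  l2 (rinv beta h) /\ nrm (rinv beta h) <=
    K * (nrm (rmul beta (eq2 beta b lam h u)) + Cmod lam * nrm (rmul beta u) +
         nrm (mul_op b (pmul beta u)) + nrm h).
Proof.
  destruct rinv_bound as [K [HK B]]; destruct (nrm_mul b) as [L [HL Hm]].
  destruct nrm_rmul as [Kr [HKr Hr]]; pose proof (Rmult_le_pos _ _ HKr HL) as HKL.
  exists (K * (1 + Kr * L)); split; [apply Rmult_le_pos; lra|]; intros lam h u Hh Hd Hu.
  pose proof (l2_eq2 b lam h u Hd Hu) as Hg; pose proof (l2_pmul u Hu) as Hp.
  pose proof (l2_mul b _ Hp) as Hbp; pose proof (l2_mul b _ Hbp) as Hbbp.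
  set (g := eq2 beta b lam h u) in *.
  assert (Eo : omv beta h = rmul beta (ddx h)).
  { apply seq_ext; intros k; unfold omv, rmul, ddx, rdg, dg; rewrite RtoC_mult; ring. }
  assert (Ho : l2 (omv beta h)) by (rewrite Eo; now apply l2_rmul).
  destruct (B h Hh Ho) as [B1 B2]; split; auto.
  apply Rle_trans with (1 := B2); rewrite Rmult_assoc; apply Rmult_le_compat_l; auto.
  assert (E : omv beta h = vsub (vsub (rmul beta g) (vscal lam (rmul beta u)))
    (rmul beta (mul_op b (mul_op b (pmul beta u))))).
  { rewrite Eo; apply seq_ext; intros k.
    unfold g, eq2, vsub, vadd, rmul, rdg, vscal, dg; ring. }
  pose proof (nrm_sub _ _ (l2_rmul _ Hg) (l2_scal lam _ (l2_rmul _ Hu))) as S1.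
  pose proof (nrm_sub _ _ (l2_sub _ _ (l2_rmul _ Hg) (l2_scal lam _ (l2_rmul _ Hu))) (l2_rmul _ Hbbp)) as S2.
  rewrite <- E in S2; rewrite nrm_scal in S1.
  pose proof (Hr _ Hbbp); pose proof (Rmult_le_compat_l Kr _ _ HKr (Hm _ Hbp)).
  pose proof (nrm_ge_0 (rmul beta g)); pose proof (nrm_ge_0 h); pose proof (nrm_ge_0 (mul_op b (pmul beta u))).
  pose proof (Rmult_le_pos _ _ (Cmod_ge_0 lam) (nrm_ge_0 (rmul beta u))).
  set (x := Kr * L) in *.
  assert (Kr * (L * nrm (mul_op b (pmul beta u))) = x * nrm (mul_op b (pmul beta u))) by (unfold x; ring).
  nra.
Qed.

Lemma sgnZ_IZR k : sgnZ k * IZR k = Rabs (IZR k).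
Proof.
  unfold sgnZ; rewrite <- abs_IZR; destruct (Z_le_dec 0 k).
  - rewrite Z.abs_eq by lia; ring.
  - rewrite Z.abs_neq, opp_IZR by lia; ring.
Qed.

(** The first equation expresses [u] through [sgn(D) h], because
    [beta T_beta = - i sgn(D)] up to a smoothing error. *)
Lemma u_of_h a lam h u : vscal Ci u =
  vadd (vscal (RtoC beta) (vsub (vsub (sg (eq1 beta a lam h u)) (vscal lam (sg h)))
                                (sg (mul_op a (mul_op a h)))))
       (vscal Ci (rdg err u)).
Proof.
  apply seq_ext; intros k.
  unfold eq1, vadd, vsub, vscal, sg, ddx, pmul, rdg, dg, err.
  rewrite <- sgnZ_IZR; apply injective_projections; simpl; ring.
Qed.

End Apriori.

(** * The multiplier estimate *)

(** Moving the derivative off [h] in [<h_x, q h>] returns the conjugate of the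
    pairing together with [<q' h, h>]. *)
Lemma Re_ip_multiplier a q h : l2 h -> l2 (ddx h) ->
  (forall v, l2 v -> mul_op (cinf_deriv q) v =
    vadd (mul_op a (mul_op a v)) (vscal (RtoC (- mean (cinf_sqr a))) v)) ->
  mean (cinf_sqr a) * nrm h ^ 2 = nrm (mul_op a h) ^ 2 + 2 * Re (ip (ddx h) (mul_op q h)).
Proof.
  intros Hh Hd Hq; set (m := mean (cinf_sqr a)) in *.
  pose proof (ddx_mul q h Hh Hd) as E.
  assert (Hq' : l2 (mul_op (cinf_deriv q) h)) by now apply l2_mul.
  assert (Hqd : l2 (mul_op q (ddx h))) by now apply l2_mul.
  assert (Hqh : l2 (mul_op q h)) by now apply l2_mul.
  assert (E1 : ip (ddx h) (mul_op q h) =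
    (- (ip h (mul_op (cinf_deriv q) h) + ip h (mul_op q (ddx h))))%C).
  { rewrite ip_ddx, E, ip_add_r; auto; rewrite E; auto using l2_add. }
  rewrite (ip_conj (mul_op (cinf_deriv q) h) h), <- (mul_adjoint q h (ddx h)), (ip_conj (ddx h) (mul_op q h)) in E1 by auto.
  rewrite Hq, ip_add_l, ip_scal_l, ip_self, mul_adjoint, ip_self in E1 by auto using l2_scal, l2_mul.
  generalize dependent (ip (ddx h) (mul_op q h)); intros z E1.
  apply (f_equal Re) in E1; cbn -[nrm pow m] in E1; unfold Re in *; cbn -[nrm pow m] in E1; lra.
Qed.

(** The commutator measures how far [<sgn(D) h, q h>] is from being real. *)
Lemma Im_ip_sg q h : l2 h ->
  2 * Rabs (Im (ip (sg h) (mul_op q h))) <= Cmod (ip (comm q h) h).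
Proof.
  intros Hh; set (z := ip (sg h) (mul_op q h)).
  assert (E : ip (comm q h) h = (z - Cconj z)%C).
  { unfold comm; rewrite ip_sub_l by auto using l2_sg, l2_mul.
    rewrite (mul_adjoint q (sg h) h), (ip_sg (mul_op q h) h) by auto using l2_sg.
    unfold z at 2; rewrite <- ip_conj; reflexivity. }
  rewrite E; apply Rle_trans with (2 := im_le_Cmod _), Req_le.
  replace (Im (z - Cconj z)%C) with (2 * Im z) by (destruct z; simpl; ring).
  rewrite Rabs_mult, (Rabs_pos_eq 2); lra.
Qed.

Section Multiplier.

Variable beta : R.
Hypothesis Hb : 0 < beta.

(** [h_x] is expressed through the second equation and [u] through the first.  Of
    the six pairings with [q h] that appear, the one with [tau^2] and the one
    with [tau a^2 h] are reduced to commutators with [sgn(D)]. *)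
Lemma multiplier_estimate a b : exists K, 0 <= K /\ forall tau h u,
  l2 h -> l2 (ddx h) -> l2 u ->
  let f := eq1 beta a (Ci * RtoC tau) h u in
  let g := eq2 beta b (Ci * RtoC tau) h u in
  let na := nrm (mul_op a h) in
  l2 (rinv beta h) -> l2 (rdg (err beta) u) ->
  mean (cinf_sqr a) * nrm h ^ 2 <= na ^ 2 + K *
    (nrm (rmul beta g) * nrm (rinv beta h) + nrm (mul_op b (pmul beta u)) * nrm h +
     tau ^ 2 * nrm (jinv h) ^ 2 + Rabs tau * (nrm f * nrm h) + Rabs tau * na ^ 2 +
     Rabs tau * (na * nrm (jinv h)) + Rabs tau * (nrm (rdg (err beta) u) * nrm h)).
Proof.
  destruct (exists_multiplier a) as [q Hq].
  destruct (nrm_mul q) as [Lq [HLq Bq]], (nrm_mul b) as [Lb [HLb Bb]].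
  destruct (nrm_comm q) as [Lc [HLc Bc]], (nrm_comm a) as [La [HLa Ba]].
  destruct (p_beta_bounds beta Hb) as [Kp [HKp BP]].
  destruct (nrm_mul_weight q (fun k => / root_p beta k) Kp) as [Lw [HLw Bw]];
    [lra | intros k; apply Rinv_0_lt_compat, BP | intros k j; apply BP |].
  destruct (nrm_mul_weight q (fun k => / jap k) 1) as [Lj [HLj Bj]]; [lra | | |].
  { intros k; apply Rinv_0_lt_compat; pose proof (jap_ge_1 k); lra. }
  { intros k j; pose proof (jap_ge_1 k); pose proof (jap_ge_1 j).
    pose proof (jap_peetre_l k j); rewrite Rmult_1_l.
    apply (Rmult_le_reg_r (jap k)); [lra|]; apply (Rmult_le_reg_r (jap j)); [lra|].
    rewrite Rinv_l by lra.
    replace (/ jap j * jap (k - j) * jap k * jap j) with (jap k * jap (k - j) * (/ jap j * jap j)) by ring.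
    rewrite Rinv_l by lra; lra. }
  set (L := Lw + Lb * Lq + Lq + Lc + La * Lj).
  assert (P1 : 0 <= Lb * Lq) by now apply Rmult_le_pos.
  assert (P2 : 0 <= La * Lj) by now apply Rmult_le_pos.
  assert (HL : 0 <= L) by (unfold L; lra).
  exists (2 * (1 + beta) * L); split; [apply Rmult_le_pos; lra|]; intros tau h u Hh Hd Hu f g na HX HY.
  pose proof (l2_eq1 beta Hb a (Ci * RtoC tau) h u Hh Hu) as Hf; fold f in Hf.
  pose proof (l2_eq2 beta Hb b (Ci * RtoC tau) h u Hd Hu) as Hg; fold g in Hg.
  pose proof (l2_pmul beta Hb u Hu) as Hp.
  pose proof (l2_mul b _ Hp) as Hbp; pose proof (l2_mul b _ Hbp) as Hbbp.
  pose proof (l2_mul a _ Hh) as Hah; pose proof (l2_mul a _ Hah) as Haah.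
  pose proof (l2_mul q _ Hh) as Hqh; pose proof (l2_mul q _ Hah) as Hqah.
  pose proof (l2_sg _ Hh) as Hsh; pose proof (l2_sg _ Hf) as Hsf; pose proof (l2_sg _ Haah) as Hsa.
  rewrite (Re_ip_multiplier a q h Hh Hd Hq).
  (* the six pairings with [q h] *)
  assert (T1 : Rabs (Re (ip g (mul_op q h))) <= nrm (rmul beta g) * (Lw * nrm (rinv beta h))).
  { destruct (Bw h Hh HX) as [W1 W2]; fold (rdg (fun k => / root_p beta k)) in W1, W2.
    fold (rinv beta) in W1, W2.
    rewrite (ip_rinv beta Hb); apply Rle_trans with (1 := Re_le_ip _ _ (l2_rmul beta Hb _ Hg) W1).
    apply Rmult_le_compat_l; auto using nrm_ge_0. }
  assert (T2 : Rabs (Re (ip (mul_op b (mul_op b (pmul beta u))) (mul_op q h))) <=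
    nrm (mul_op b (pmul beta u)) * (Lb * (Lq * nrm h))).
  { rewrite mul_adjoint by auto; apply Rle_trans with (1 := Re_le_ip _ _ Hbp (l2_mul b _ Hqh)).
    apply Rmult_le_compat_l; [apply nrm_ge_0|]; apply Rle_trans with (1 := Bb _ Hqh).
    apply Rmult_le_compat_l; auto. }
  assert (T3 : Rabs (Re (ip (sg f) (mul_op q h))) <= nrm f * (Lq * nrm h)).
  { apply Rle_trans with (1 := Re_le_ip _ _ Hsf Hqh).
    apply Rmult_le_compat; auto using nrm_ge_0, nrm_sg. }
  assert (T4 : Rabs (Im (ip (sg h) (mul_op q h))) <= Lc * nrm (jinv h) ^ 2).
  { pose proof (Im_ip_sg q h Hh); destruct (Bc h Hh) as [_ [_ B3]].
    pose proof (Rabs_pos (Im (ip (sg h) (mul_op q h)))); lra. }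
  assert (T5 : Rabs (Re (ip (sg (mul_op a (mul_op a h))) (mul_op q h))) <=
    na * (La * (Lj * nrm (jinv h)) + Lq * na)).
  { assert (Hsq : l2 (sg (mul_op q h))) by now apply l2_sg.
    rewrite ip_sg, mul_adjoint by auto.
    assert (EC : mul_op a (sg (mul_op q h)) = vadd (comm a (mul_op q h)) (sg (mul_op q (mul_op a h)))).
    { rewrite (mul_comm q a) by auto; apply seq_ext; intros k.
      unfold comm, vadd, vsub; ring. }
    destruct (Ba _ Hqh) as [C1 [C2 _]].
    assert (Hsqa : l2 (sg (mul_op q (mul_op a h)))) by now apply l2_sg.
    apply Rle_trans with (1 := Re_le_ip _ _ Hah (l2_mul a _ Hsq)).
    apply Rmult_le_compat_l; [apply nrm_ge_0|]; rewrite EC.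
    apply Rle_trans with (1 := nrm_add _ _ C1 Hsqa); apply Rplus_le_compat.
    - apply Rle_trans with (1 := C2); apply Rmult_le_compat_l; auto.
      apply (Bj h Hh); now apply l2_jinv.
    - apply Rle_trans with (1 := nrm_sg _ Hqah); apply Bq; auto. }
  assert (T6 : Rabs (Im (ip (rdg (err beta) u) (mul_op q h))) <= nrm (rdg (err beta) u) * (Lq * nrm h)).
  { apply Rle_trans with (1 := Im_le_ip _ _ HY Hqh).
    apply Rmult_le_compat_l; auto using nrm_ge_0. }
  assert (E1 : ip (ddx h) (mul_op q h) = (ip g (mul_op q h) - ip (vscal (Ci * RtoC tau) u) (mul_op q h)
    - ip (mul_op b (mul_op b (pmul beta u))) (mul_op q h))%C).
  { rewrite (ddx_of_eq2 beta b (Ci * RtoC tau) h u); fold g.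
    rewrite !ip_sub_l by auto using l2_sub, l2_scal; reflexivity. }
  assert (E2 : ip (vscal (Ci * RtoC tau) u) (mul_op q h) = (RtoC tau * (RtoC beta *
    (ip (sg f) (mul_op q h) - Ci * RtoC tau * ip (sg h) (mul_op q h) -
     ip (sg (mul_op a (mul_op a h))) (mul_op q h)) + Ci * ip (rdg (err beta) u) (mul_op q h)))%C).
  { assert (EV : vscal (Ci * RtoC tau) u = vscal (RtoC tau) (vscal Ci u)).
    { apply seq_ext; intros k; unfold vscal, dg; ring. }
    rewrite EV, (u_of_h beta a (Ci * RtoC tau) h u); fold f.
    rewrite ip_scal_l, ip_add_l, !ip_scal_l, !ip_sub_l, ip_scal_l
      by auto 8 using l2_sub, l2_scal, l2_add; reflexivity. }
  rewrite E1, E2.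
  set (x1 := ip g (mul_op q h)) in *.
  set (x2 := ip (mul_op b (mul_op b (pmul beta u))) (mul_op q h)) in *.
  set (x3 := ip (sg f) (mul_op q h)) in *; set (x4 := ip (sg h) (mul_op q h)) in *.
  set (x5 := ip (sg (mul_op a (mul_op a h))) (mul_op q h)) in *.
  set (x6 := ip (rdg (err beta) u) (mul_op q h)) in *.
  assert (E3 : Re (x1 - RtoC tau * (RtoC beta * (x3 - Ci * RtoC tau * x4 - x5) + Ci * x6) - x2)%C =
    Re x1 - Re x2 - beta * (tau * Re x3) - beta * (tau ^ 2 * Im x4) + beta * (tau * Re x5) + tau * Im x6).
  { simpl; unfold Re, Im; ring. }
  rewrite E3; clear E1 E2 E3.
  set (t := Rabs tau).
  assert (Ht : 0 <= t) by apply Rabs_pos.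
  assert (Ab : forall sc c y x B, 0 <= y -> c <= L -> B = c * y -> Rabs x <= B -> sc * x <= Rabs sc * (L * y)).
  { intros sc c y x B Hy Hcl -> Hx; apply Rle_trans with (1 := Rle_abs _); rewrite Rabs_mult.
    apply Rmult_le_compat_l; [apply Rabs_pos|]; apply Rle_trans with (1 := Hx).
    now apply Rmult_le_compat_r. }
  assert (A1 : Rabs 1 = 1) by apply Rabs_R1; assert (A2 : Rabs (-1) = 1) by (rewrite Rabs_left; lra).
  assert (A3 : Rabs (- tau) = t) by apply Rabs_Ropp.
  assert (A4 : Rabs (- tau ^ 2) = tau ^ 2) by (rewrite Rabs_Ropp; apply Rabs_pos_eq, pow2_ge_0).
  assert (NN : forall v w, 0 <= nrm v * nrm w) by (intros; apply Rmult_le_pos; apply nrm_ge_0).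
  assert (Naw : 0 <= na * nrm (jinv h)) by apply NN.
  pose proof (pow2_ge_0 na) as Na2.
  assert (T5' : Rabs (Re x5) <= (Lq + La * Lj) * (na ^ 2 + na * nrm (jinv h))).
  { apply Rle_trans with (1 := T5).
    assert (0 <= Lq * (na * nrm (jinv h))) by now apply Rmult_le_pos.
    assert (0 <= La * Lj * na ^ 2) by now apply Rmult_le_pos.
    replace (na * (La * (Lj * nrm (jinv h)) + Lq * na)) with
      (La * Lj * (na * nrm (jinv h)) + Lq * na ^ 2) by ring; lra. }
  apply (Ab 1 Lw (nrm (rmul beta g) * nrm (rinv beta h))) in T1; [|apply NN | unfold L; lra | ring].
  apply (Ab (-1) (Lb * Lq) (nrm (mul_op b (pmul beta u)) * nrm h)) in T2;
    [|apply NN | unfold L; lra | ring].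
  apply (Ab (- tau) Lq (nrm f * nrm h)) in T3; [|apply NN | unfold L; lra | ring].
  apply (Ab (- tau ^ 2) Lc (nrm (jinv h) ^ 2)) in T4; [|apply pow2_ge_0 | unfold L; lra | ring].
  apply (Ab tau (Lq + La * Lj) (na ^ 2 + na * nrm (jinv h))) in T5'; [|lra | unfold L; lra | ring].
  apply (Ab tau Lq (nrm (rdg (err beta) u) * nrm h)) in T6; [|apply NN | unfold L; lra | ring].
  rewrite A1 in T1; rewrite A2 in T2; rewrite A3 in T3; rewrite A4 in T4; fold t in T5', T6.
  fold na.
  assert (V : beta * (- tau * Re x3 + - tau ^ 2 * Im x4 + tau * Re x5) <=
    beta * (t * (L * (nrm f * nrm h)) + tau ^ 2 * (L * nrm (jinv h) ^ 2) +
            t * (L * (na ^ 2 + na * nrm (jinv h))))) by (apply Rmult_le_compat_l; lra).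
  set (Y1 := nrm (rmul beta g) * nrm (rinv beta h) + nrm (mul_op b (pmul beta u)) * nrm h +
    t * (nrm (rdg (err beta) u) * nrm h)).
  set (Y2 := t * (nrm f * nrm h) + tau ^ 2 * nrm (jinv h) ^ 2 + t * (na ^ 2 + na * nrm (jinv h))).
  assert (Z1 : 0 <= beta * (L * Y1)).
  { pose proof (NN (rmul beta g) (rinv beta h)); pose proof (NN (mul_op b (pmul beta u)) h).
    pose proof (Rmult_le_pos _ _ Ht (NN (rdg (err beta) u) h)).
    repeat apply Rmult_le_pos; unfold Y1; lra. }
  assert (Z2 : 0 <= L * Y2).
  { pose proof (Rmult_le_pos _ _ Ht (NN f h)).
    pose proof (Rmult_le_pos _ _ (pow2_ge_0 tau) (pow2_ge_0 (nrm (jinv h)))).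
    pose proof (Rmult_le_pos t (na ^ 2 + na * nrm (jinv h)) Ht ltac:(lra)).
    apply Rmult_le_pos; unfold Y2; lra. }
  unfold Y1, Y2 in Z1, Z2; lra.
Qed.

End Multiplier.

(** * Absorption of the error terms *)

(** The real-number end of the argument.  If the bound failed, then relative to
    the norm [N] of the solution the data [P], the damping terms [al], [be] and
    the negative norms [Z], [W], [Y] would all be of size [delta], and the
    multiplier inequality would give [N = 0]. *)
Lemma absorption m K : 0 < m -> 1 <= K -> exists C t0, 0 < C /\ 1 <= t0 /\
  forall t P N al be F G nh ny W X Y Z, t0 <= t ->
  0 <= F <= P -> 0 <= G <= P -> 0 <= nh <= N -> 0 <= ny <= N -> N ^ 2 = nh ^ 2 + ny ^ 2 ->
  0 <= al -> 0 <= be -> 0 <= W -> 0 <= X -> 0 <= Y -> 0 <= Z ->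
  al ^ 2 + be ^ 2 <= F * nh + G * ny ->
  t * (ny ^ 2 - nh ^ 2) <= F * nh + G * ny ->
  t * Z <= K * (G + nh + be) ->
  t * W <= K * (F + al + Z) ->
  t * Y <= K * (G + W + be) ->
  X <= K * (G + t * ny + be + nh) ->
  m * nh ^ 2 <= al ^ 2 + K * (G * X + be * nh + t ^ 2 * W ^ 2 + t * (F * nh) + t * al ^ 2 +
    t * (al * W) + t * (Y * nh)) ->
  N <= C * (t * P).
Proof.
  intros Hm HK.
  assert (KP : forall i, 1 <= K ^ i) by (intros; now apply pow_R1_Rle).
  pose proof (KP 2%nat) as K2; pose proof (KP 3%nat) as K3; pose proof (KP 5%nat) as K5.
  set (d := m / (2 * (90 * K ^ 5 + 2 * m))).
  assert (Hd0 : 0 < d) by (apply Rdiv_lt_0_compat; lra).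
  assert (Ed : d * (90 * K ^ 5 + 2 * m) = m / 2) by (unfold d; field; lra).
  assert (Hd1 : d <= 1) by nra.
  assert (Hid : d * / d = 1) by (apply Rinv_r; lra).
  exists (2 / d ^ 2), (/ d); split; [apply Rdiv_lt_0_compat; [lra | now apply pow_lt]|].
  split; [rewrite <- Rinv_1; apply Rinv_le_contravar; lra|].
  intros t P N al be F G nh ny W X Y Z Ht [HF0 HF] [HG0 HG] [Hh0 Hh] [Hy0 Hy] HN Hal Hbe HW HX HY HZ
    E1 E2 E3 E4 E5 E6 E7.
  assert (Htd : 1 <= d * t) by (rewrite <- Hid; apply Rmult_le_compat_l; lra).
  assert (Ht1 : 1 <= t) by nra.
  apply Rnot_lt_le; intros A.
  assert (HtP : t * P <= d ^ 2 / 2 * N).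
  { apply Rlt_le, (Rmult_lt_reg_l (2 / d ^ 2)); [apply Rdiv_lt_0_compat; [lra | now apply pow_lt]|].
    replace (2 / d ^ 2 * (d ^ 2 / 2 * N)) with N by (field; lra); exact A. }
  assert (HP0 : 0 <= P) by lra.
  assert (HN0 : 0 < N).
  { apply Rle_lt_trans with (2 := A); repeat apply Rmult_le_pos; try lra.
    apply Rlt_le, Rinv_0_lt_compat, pow_lt; lra. }
  set (n := d * N).
  assert (Hn : 0 <= n) by (unfold n; nra).
  assert (HnN : n <= N) by (unfold n; nra).
  assert (Hdn : d ^ 2 / 2 * N <= n / 2) by (replace (d ^ 2 / 2 * N) with (d * n / 2) by (unfold n; field); nra).
  assert (HPt : P <= t * P) by nra.
  assert (Sum : F * nh + G * ny <= 2 * (P * N)).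
  { assert (F * nh <= P * N) by (apply Rmult_le_compat; auto).
    assert (G * ny <= P * N) by (apply Rmult_le_compat; auto); lra. }
  assert (Sm : forall z, 0 <= z -> z ^ 2 <= 2 * (P * N) -> t * z ^ 2 <= n * N /\ z <= n).
  { intros z Hz H.
    assert (T : t * z ^ 2 <= n ^ 2).
    { apply Rle_trans with (t * (2 * (P * N))); [apply Rmult_le_compat_l; lra|].
      replace (t * (2 * (P * N))) with (2 * (t * P) * N) by ring.
      replace (n ^ 2) with (2 * (d ^ 2 / 2 * N) * N) by (unfold n; field).
      apply Rmult_le_compat_r; lra. }
    split; [apply Rle_trans with (1 := T); simpl; rewrite Rmult_1_r; now apply Rmult_le_compat_l|].
    apply Rnot_lt_le; intros B; assert (z ^ 2 <= t * z ^ 2) by (pose proof (pow2_ge_0 z); nra); nra. }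
  destruct (Sm al Hal) as [A1 A2]; [pose proof (pow2_ge_0 be); lra|].
  destruct (Sm be Hbe) as [_ B2]; [pose proof (pow2_ge_0 al); lra|].
  assert (Z1 : Z <= 3 * K * n).
  { apply Rle_trans with (d * (t * Z)); [rewrite <- Rmult_assoc; nra|].
    replace (3 * K * n) with (d * (K * (3 * N))) by (unfold n; ring).
    apply Rmult_le_compat_l; [lra|]; apply Rle_trans with (1 := E3), Rmult_le_compat_l; lra. }
  assert (Kn : n <= K * n) by nra.
  assert (W1 : t * W <= 5 * K ^ 2 * n).
  { apply Rle_trans with (1 := E4); replace (5 * K ^ 2 * n) with (K * (5 * (K * n))) by ring.
    apply Rmult_le_compat_l; lra. }
  assert (W2 : W <= 5 * K ^ 2 * n) by nra.
  assert (K2n : n <= K ^ 2 * n) by nra.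
  assert (Y1 : t * Y <= 7 * K ^ 3 * n).
  { apply Rle_trans with (1 := E5); replace (7 * K ^ 3 * n) with (K * (7 * (K ^ 2 * n))) by ring.
    apply Rmult_le_compat_l; lra. }
  assert (NN : 0 <= n * N) by (apply Rmult_le_pos; lra).
  assert (nn : n * n <= n * N) by now apply Rmult_le_compat_l.
  assert (T1 : G * X <= 2 * K * (n * N)).
  { apply Rle_trans with (P * (4 * K * (t * N))).
    - apply Rmult_le_compat; auto; apply Rle_trans with (1 := E6).
      replace (4 * K * (t * N)) with (K * (4 * (t * N))) by ring; apply Rmult_le_compat_l; [lra|].
      assert (t * ny <= t * N) by (apply Rmult_le_compat_l; lra); nra.
    - replace (P * (4 * K * (t * N))) with (4 * K * (t * P * N)) by ring.
      replace (2 * K * (n * N)) with (4 * K * (n / 2 * N)) by field.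
      apply Rmult_le_compat_l; [lra|]; apply Rmult_le_compat_r; lra. }
  assert (T2 : be * nh <= n * N) by (apply Rmult_le_compat; auto).
  assert (HtW : 0 <= t * W) by (apply Rmult_le_pos; lra).
  assert (T3 : t ^ 2 * W ^ 2 <= 25 * K ^ 4 * (n * N)).
  { rewrite <- Rpow_mult_distr; apply Rle_trans with ((5 * K ^ 2 * n) ^ 2); [apply pow_incr; lra|].
    replace ((5 * K ^ 2 * n) ^ 2) with (25 * K ^ 4 * (n * n)) by ring.
    apply Rmult_le_compat_l; auto; pose proof (KP 4%nat); lra. }
  assert (T4 : t * (F * nh) <= n * N).
  { rewrite <- Rmult_assoc; apply Rmult_le_compat; auto; [apply Rmult_le_pos; lra|].
    assert (t * F <= t * P) by (apply Rmult_le_compat_l; lra); lra. }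
  assert (T5 : t * (al * W) <= 5 * K ^ 2 * (n * N)).
  { replace (t * (al * W)) with (al * (t * W)) by ring.
    apply Rle_trans with (n * (5 * K ^ 2 * n)); [apply Rmult_le_compat; auto|]; nra. }
  assert (T6 : t * (Y * nh) <= 7 * K ^ 3 * (n * N)).
  { rewrite <- !Rmult_assoc; rewrite (Rmult_assoc (7 * K ^ 3)), <- (Rmult_assoc (7 * K ^ 3)).
    apply Rmult_le_compat; auto; apply Rmult_le_pos; lra. }
  assert (Mn : forall i, (i <= 5)%nat -> K ^ i * (n * N) <= K ^ 5 * (n * N)).
  { intros i Hi; apply Rmult_le_compat_r; auto; apply Rle_pow; auto. }
  pose proof (Mn 0%nat ltac:(lia)) as M0; pose proof (Mn 1%nat ltac:(lia)) as M1.
  pose proof (Mn 2%nat ltac:(lia)) as M2; pose proof (Mn 3%nat ltac:(lia)) as M3.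
  pose proof (Mn 4%nat ltac:(lia)) as M4; rewrite pow_O in M0; rewrite pow_1 in M1.
  assert (Main : m * nh ^ 2 <= 45 * K ^ 5 * (n * N)).
  { apply Rle_trans with (n * N + K * (2 * K * (n * N) + n * N + 25 * K ^ 4 * (n * N) + n * N + n * N +
      5 * K ^ 2 * (n * N) + 7 * K ^ 3 * (n * N))).
    - apply Rle_trans with (1 := E7), Rplus_le_compat; [pose proof (pow2_ge_0 al); nra|].
      apply Rmult_le_compat_l; lra.
    - replace (n * N + K * (2 * K * (n * N) + n * N + 25 * K ^ 4 * (n * N) + n * N + n * N +
        5 * K ^ 2 * (n * N) + 7 * K ^ 3 * (n * N))) with (n * N + 2 * (K ^ 2 * (n * N)) +
        3 * (K * (n * N)) + 25 * (K ^ 5 * (n * N)) + 5 * (K ^ 3 * (n * N)) + 7 * (K ^ 4 * (n * N)))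
        by ring; lra. }
  assert (Gap : ny ^ 2 - nh ^ 2 <= n * N).
  { destruct (Rle_dec (ny ^ 2 - nh ^ 2) 0); [lra|].
    apply Rle_trans with (t * (ny ^ 2 - nh ^ 2)); [nra|]; apply Rle_trans with (1 := E2).
    apply Rle_trans with (1 := Sum); nra. }
  (* [m N^2 <= d (90 K^5 + 2 m) N^2 = m N^2 / 2] *)
  assert (Fin : m * N ^ 2 <= m / 2 * N ^ 2).
  { rewrite <- Ed, HN at 1; unfold n in *; nra. }
  assert (0 < m * N ^ 2) by (apply Rmult_lt_0_compat; [lra | now apply pow_lt]); lra.
Qed.

(** * The a priori estimate for regular states; completeness and perturbation *)

Lemma Cmod_Ci_R tau : Cmod (Ci * RtoC tau) = Rabs tau.
Proof. rewrite Cmod_mult, Cmod_Ci, Cmod_R; ring. Qed.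

Definition pnrm (x : (Z -> C) * (Z -> C)) : R := sqrt (nrm (fst x) ^ 2 + nrm (snd x) ^ 2).

Lemma pnrm_sqr x : pnrm x ^ 2 = nrm (fst x) ^ 2 + nrm (snd x) ^ 2.
Proof.
  unfold pnrm; apply pow2_sqrt; pose proof (pow2_ge_0 (nrm (fst x)));
    pose proof (pow2_ge_0 (nrm (snd x))); lra.
Qed.

Lemma pnrm_ge_0 x : 0 <= pnrm x.
Proof. apply sqrt_pos. Qed.

Lemma nrm_le_pnrm x : nrm (fst x) <= pnrm x /\ nrm (snd x) <= pnrm x.
Proof.
  pose proof (pnrm_sqr x); pose proof (pnrm_ge_0 x).
  pose proof (nrm_ge_0 (fst x)); pose proof (nrm_ge_0 (snd x)).
  split; apply Rnot_lt_le; intros A; nra.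
Qed.

Lemma pnrm_le_sum x : pnrm x <= nrm (fst x) + nrm (snd x).
Proof.
  pose proof (pnrm_sqr x); pose proof (pnrm_ge_0 x).
  pose proof (nrm_ge_0 (fst x)); pose proof (nrm_ge_0 (snd x)).
  apply Rnot_lt_le; intros A; nra.
Qed.

(** For [h_x] and [u] square-summable all pairings are inner products. *)
Lemma apriori_regular beta (a b : Cinf) : 0 < beta -> (exists x, a x <> 0) ->
  exists K t0, 0 < K /\ 1 <= t0 /\ forall tau h u, t0 <= Rabs tau ->
  l2 h -> l2 (ddx h) -> l2 u ->
  pnrm (h, rmul beta u) <= K * (Rabs tau *
    pnrm (eq1 beta a (Ci * RtoC tau) h u, rmul beta (eq2 beta b (Ci * RtoC tau) h u))).
Proof.
  intros Hb Ha.
  destruct (jinv_u_bound beta Hb b) as [K1 [HK1 B1]], (jinv_h_bound beta Hb a) as [K2 [HK2 B2]].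
  destruct (err_u_bound beta Hb b) as [K3 [HK3 B3]], (rinv_h_bound beta Hb b) as [K4 [HK4 B4]].
  destruct (multiplier_estimate beta Hb a b) as [K5 [HK5 B5]].
  set (K := 1 + K1 + K2 + K3 + K4 + K5).
  destruct (absorption (mean (cinf_sqr a)) K) as [C [t0 [HC [Ht0 H]]]].
  { now apply mean_sqr_pos. }
  { unfold K; lra. }
  exists C, t0; split; auto; split; auto; intros tau h u Ht Hh Hd Hu.
  pose proof (l2_eq1 beta Hb a (Ci * RtoC tau) h u Hh Hu) as Hf.
  pose proof (l2_eq2 beta Hb b (Ci * RtoC tau) h u Hd Hu) as Hg.
  pose proof (l2_rmul beta Hb _ Hg) as Hrg; pose proof (l2_rmul beta Hb _ Hu) as Hru.
  destruct (energy_identity beta Hb a b (Ci * RtoC tau) h u Hh Hd Hu) as [I1 I2].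
  pose proof (B1 (fun _ => 1) (Ci * RtoC tau)%C h u (fun _ => Req_le _ _ Rabs_R1) Hh Hd Hu) as B1'; specialize (B2 (Ci * RtoC tau)%C h u Hh Hu).
  destruct (B3 (Ci * RtoC tau)%C h u Hh Hd Hu) as [HY B3'].
  destruct (B4 (Ci * RtoC tau)%C h u Hh Hd Hu) as [HX B4'].
  specialize (B5 tau h u Hh Hd Hu HX HY); cbv zeta in B5.
  assert (Id : forall v, rdg (fun _ => 1) v = v)
    by (intros v; apply seq_ext; intros k; unfold rdg, dg; ring).
  rewrite !Id in B1'; clear B1; rewrite Cmod_Ci_R in *.
  set (f := eq1 beta a (Ci * RtoC tau) h u) in *; set (g := eq2 beta b (Ci * RtoC tau) h u) in *.
  destruct (nrm_le_pnrm (f, rmul beta g)) as [N1 N2]; destruct (nrm_le_pnrm (h, rmul beta u)) as [N3 N4].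
  pose proof (Re_le_ip f h Hf Hh) as R1; pose proof (Im_le_ip f h Hf Hh) as R2.
  pose proof (Re_le_ip _ _ Hrg Hru) as R3; pose proof (Im_le_ip _ _ Hrg Hru) as R4.
  rewrite <- (ip_pmul beta Hb) in R3, R4.
  pose proof (fun v => nrm_ge_0 v) as P.
  assert (Mono : forall k x y, k <= K -> 0 <= x -> y <= k * x -> y <= K * x).
  { intros k x y Hk Hx Hy; apply Rle_trans with (1 := Hy), Rmult_le_compat_r; auto. }
  apply (H (Rabs tau) (pnrm (f, rmul beta g)) (pnrm (h, rmul beta u)) (nrm (mul_op a h))
    (nrm (mul_op b (pmul beta u))) (nrm f) (nrm (rmul beta g)) (nrm h) (nrm (rmul beta u))
    (nrm (jinv h)) (nrm (rinv beta h)) (nrm (rdg (err beta) u)) (nrm (jinv u))); auto.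
  - apply pnrm_sqr.
  - replace (Re (Ci * RtoC tau)%C) with 0 in I1 by (simpl; ring).
    apply Rabs_le_between in R1; apply Rabs_le_between in R3; lra.
  - replace (Im (Ci * RtoC tau)%C) with tau in I2 by (simpl; ring).
    assert (E : Rabs tau * (nrm (rmul beta u) ^ 2 - nrm h ^ 2) <= Rabs (tau * (nrm h ^ 2 - nrm (rmul beta u) ^ 2))).
    { rewrite Rabs_mult, (Rabs_minus_sym (nrm h ^ 2)).
      apply Rmult_le_compat_l; [apply Rabs_pos | apply Rle_abs]. }
    apply Rle_trans with (1 := E); rewrite <- I2; unfold Rminus.
    apply Rle_trans with (1 := Rabs_triang _ _); rewrite Rabs_Ropp; lra.
  - apply (Mono K1); [unfold K; lra | | exact B1'].
    pose proof (P (rmul beta g)); pose proof (P h); pose proof (P (mul_op b (pmul beta u))); lra.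
  - apply (Mono K2); [unfold K; lra | | exact B2].
    pose proof (P f); pose proof (P (mul_op a h)); pose proof (P (jinv u)); lra.
  - apply (Mono K3); [unfold K; lra | | exact B3'].
    pose proof (P (rmul beta g)); pose proof (P (jinv h)); pose proof (P (mul_op b (pmul beta u))); lra.
  - apply (Mono K4); [unfold K; lra | | exact B4'].
    pose proof (P (rmul beta g)); pose proof (P h); pose proof (P (mul_op b (pmul beta u))).
    assert (0 <= Rabs tau * nrm (rmul beta u)) by (apply Rmult_le_pos; auto using Rabs_pos); lra.
  - rewrite pow2_abs; apply Rle_trans with (1 := B5); apply Rplus_le_compat_l.
    apply Rmult_le_compat_r; [|unfold K; lra].
    repeat apply Rplus_le_le_0_compat;
      repeat first [apply pow2_ge_0 | apply Rabs_pos | apply nrm_ge_0 | apply Rmult_le_pos].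
Qed.

(** Coordinatewise limits exist by comparison with a geometric series, and the
    bounds pass to the limit through finite sums. *)
Lemma l2_complete (v : nat -> Z -> C) c kappa : 0 <= kappa < 1 -> 0 <= c ->
  (forall n, l2 (v n)) -> (forall n, nrm (vsub (v (S n)) (v n)) <= c * kappa ^ n) ->
  exists w, l2 w /\ forall n, nrm (vsub w (v n)) <= c * kappa ^ n / (1 - kappa).
Proof.
  intros Hk Hc Hv Hd.
  assert (Tail : forall n m, nrm (vsub (v (n + m)%nat) (v n)) <= c * kappa ^ n / (1 - kappa)).
  { intros n m.
    assert (nrm (vsub (v (n + m)%nat) (v n)) <= c * kappa ^ n * ((1 - kappa ^ m) / (1 - kappa))).
    { induction m as [|m IH].
      - rewrite Nat.add_0_r; replace (vsub (v n) (v n)) with (vscal (RtoC 0) (v n))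
          by (apply seq_ext; intros k; unfold vsub, vscal, dg; ring).
        rewrite nrm_scal, Cmod_0; simpl; apply Req_le; field; lra.
      - replace (vsub (v (n + S m)%nat) (v n)) with
          (vadd (vsub (v (S (n + m))) (v (n + m)%nat)) (vsub (v (n + m)%nat) (v n))).
        2:{ rewrite Nat.add_succ_r; apply seq_ext; intros k; unfold vsub, vadd; ring. }
        apply Rle_trans with (1 := nrm_add _ _ (l2_sub _ _ (Hv _) (Hv _)) (l2_sub _ _ (Hv _) (Hv _))).
        specialize (Hd (n + m)%nat); rewrite pow_add in Hd.
        replace (c * kappa ^ n * ((1 - kappa ^ S m) / (1 - kappa))) with
          (c * (kappa ^ n * kappa ^ m) + c * kappa ^ n * ((1 - kappa ^ m) / (1 - kappa)))
          by (simpl; field; lra).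
        lra. }
    apply Rle_trans with (1 := H); unfold Rdiv; rewrite Rmult_assoc, Rmult_assoc.
    pose proof (pow_le kappa n (proj1 Hk)); pose proof (pow_le kappa m (proj1 Hk)).
    apply Rmult_le_compat_l; auto; apply Rmult_le_compat_l; auto.
    rewrite <- (Rmult_1_l (/ (1 - kappa))) at 2; apply Rmult_le_compat_r; [|lra].
    apply Rlt_le, Rinv_0_lt_compat; lra. }
  assert (Lim : forall P : C -> R, (forall z z', P (z - z')%C = P z - P z') ->
    (forall z, Rabs (P z) <= Cmod z) ->
    forall k, is_lim_seq (fun n => P (v n k)) (real (Lim_seq (fun n => P (v n k))))).
  { intros P PL PB k; apply Lim_seq_correct'.
    set (d := fun n => P (v (S n) k) - P (v n k)).
    assert (E : ex_series d).
    { apply (ex_series_le (V := R_CompleteNormedModule) _ (fun n => c * kappa ^ n)).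
      - intros n; change (Rabs (d n) <= c * kappa ^ n); unfold d; rewrite <- PL.
        apply Rle_trans with (1 := PB _), Rle_trans with (2 := Hd n).
        exact (nrm_term (vsub (v (S n)) (v n)) k (l2_sub _ _ (Hv _) (Hv _))).
      - apply (ex_series_scal_l (V := R_NormedModule) c), ex_series_geom; rewrite Rabs_pos_eq; lra. }
    destruct E as [l Hl]; exists (P (v 0%nat k) + l); apply is_lim_seq_incr_1.
    apply (is_lim_seq_ext (fun n => P (v 0%nat k) + sum_n d n)).
    - induction n as [|n IH]; rewrite sum_n_Reals in *; [simpl; unfold d; ring|].
      rewrite tech5, <- Rplus_assoc, IH; unfold d; ring.
    - apply is_lim_seq_plus'; [apply is_lim_seq_const | exact Hl]. }
  set (w := fun k => (real (Lim_seq (fun n => Re (v n k))), real (Lim_seq (fun n => Im (v n k))))).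
  assert (LR : forall k, is_lim_seq (fun n => Re (v n k)) (Re (w k)))
    by (apply (Lim Re); [intros; reflexivity | apply re_le_Cmod]).
  assert (LI : forall k, is_lim_seq (fun n => Im (v n k)) (Im (w k)))
    by (apply (Lim Im); [intros; reflexivity | apply im_le_Cmod]).
  assert (Sq : forall z : C, Cmod z ^ 2 = Re z * Re z + Im z * Im z)
    by (intros z; rewrite Cmod2_alt; ring).
  assert (Key : forall n, l2 (vsub w (v n)) /\ nrm (vsub w (v n)) <= c * kappa ^ n / (1 - kappa)).
  { intros n; apply nrm_le_of_zsum.
    { apply Rle_trans with (1 := nrm_ge_0 _) (2 := Tail n 0%nat). }
    intros p.
    assert (LS : is_lim_seq (fun m => zsum p (fun k => Cmod (vsub (v (m + n)%nat) (v n) k) ^ 2))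
      (zsum p (fun k => Cmod (vsub w (v n) k) ^ 2))).
    { assert (L1 : forall k, is_lim_seq (fun m => Cmod (vsub (v (m + n)%nat) (v n) k) ^ 2)
        (Cmod (vsub w (v n) k) ^ 2)).
      { intros k; rewrite Sq; eapply is_lim_seq_ext; [intros m; symmetry; apply Sq|].
        assert (LR' := proj1 (is_lim_seq_incr_n _ n _) (LR k)).
        assert (LI' := proj1 (is_lim_seq_incr_n _ n _) (LI k)).
        apply is_lim_seq_plus'; apply is_lim_seq_mult'; unfold vsub;
          (apply is_lim_seq_minus'; [auto | apply is_lim_seq_const]). }
      induction p as [|p IH]; cbn [zsum]; [apply L1|].
      apply is_lim_seq_plus'; auto; apply is_lim_seq_plus'; apply L1. }
    refine (is_lim_seq_le _ (fun _ => (c * kappa ^ n / (1 - kappa)) ^ 2)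
      (Finite _) (Finite ((c * kappa ^ n / (1 - kappa)) ^ 2)) _ LS (is_lim_seq_const _)).
    intros m; apply Rle_trans with (1 := zsum_le_nrm _ p (l2_sub _ _ (Hv _) (Hv _))).
    apply pow_incr; split; [apply nrm_ge_0|]; rewrite Nat.add_comm; apply Tail. }
  exists w; split; [|intros n; apply Key].
  replace w with (vadd (vsub w (v 0%nat)) (v 0%nat))
    by (apply seq_ext; intros k; unfold vadd, vsub; ring).
  apply l2_add; auto; apply Key.
Qed.

Definition pl2 (x : (Z -> C) * (Z -> C)) : Prop := l2 (fst x) /\ l2 (snd x).

Definition padd (x y : (Z -> C) * (Z -> C)) := (vadd (fst x) (fst y), vadd (snd x) (snd y)).

Definition pscal (c : C) (x : (Z -> C) * (Z -> C)) := (vscal c (fst x), vscal c (snd x)).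

Definition psub (x y : (Z -> C) * (Z -> C)) := (vsub (fst x) (fst y), vsub (snd x) (snd y)).

Lemma pair_ext (x y : (Z -> C) * (Z -> C)) :
  (forall k, fst x k = fst y k) -> (forall k, snd x k = snd y k) -> x = y.
Proof.
  intros H1 H2; apply injective_projections; apply seq_ext; auto.
Qed.

Lemma pl2_sub x y : pl2 x -> pl2 y -> pl2 (psub x y).
Proof. intros [] []; split; now apply l2_sub. Qed.

Lemma pl2_add x y : pl2 x -> pl2 y -> pl2 (padd x y).
Proof. intros [] []; split; now apply l2_add. Qed.

Lemma pl2_scal c x : pl2 x -> pl2 (pscal c x).
Proof. intros []; split; now apply l2_scal. Qed.

Lemma pnrm_scal c x : pnrm (pscal c x) = Cmod c * pnrm x.
Proof.
  unfold pnrm, pscal; simpl fst; simpl snd; rewrite !nrm_scal.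
  replace ((Cmod c * nrm (fst x)) ^ 2 + (Cmod c * nrm (snd x)) ^ 2) with
    (Cmod c ^ 2 * (nrm (fst x) ^ 2 + nrm (snd x) ^ 2)) by ring.
  rewrite sqrt_mult_alt, sqrt_pow2; auto using Cmod_ge_0, pow2_ge_0.
Qed.

Lemma cauchy_schwarz_pair x y :
  nrm (fst x) * nrm (fst y) + nrm (snd x) * nrm (snd y) <= pnrm x * pnrm y.
Proof.
  pose proof (pnrm_sqr x) as Ex; pose proof (pnrm_sqr y) as Ey.
  pose proof (Rmult_le_pos _ _ (pnrm_ge_0 x) (pnrm_ge_0 y)) as P.
  set (a1 := nrm (fst x)) in *; set (a2 := nrm (snd x)) in *.
  set (b1 := nrm (fst y)) in *; set (b2 := nrm (snd y)) in *.
  assert ((a1 * b1 + a2 * b2) ^ 2 <= (pnrm x * pnrm y) ^ 2).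
  { rewrite Rpow_mult_distr, Ex, Ey; pose proof (pow2_ge_0 (a1 * b2 - a2 * b1)); nra. }
  apply Rnot_lt_le; intros B; nra.
Qed.

Lemma pnrm_add x y : pl2 x -> pl2 y -> pnrm (padd x y) <= pnrm x + pnrm y.
Proof.
  intros [X1 X2] [Y1 Y2].
  pose proof (nrm_add _ _ X1 Y1) as A1; pose proof (nrm_add _ _ X2 Y2) as A2.
  pose proof (pnrm_sqr (padd x y)) as E; simpl fst in E; simpl snd in E.
  pose proof (pnrm_sqr x) as Ex; pose proof (pnrm_sqr y) as Ey.
  pose proof (pnrm_ge_0 x); pose proof (pnrm_ge_0 y); pose proof (cauchy_schwarz_pair x y).
  assert (S1 := pow_incr _ _ 2 (conj (nrm_ge_0 _) A1)).
  assert (S2 := pow_incr _ _ 2 (conj (nrm_ge_0 _) A2)).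
  apply Rnot_lt_le; intros B; nra.
Qed.

Lemma psub_add x y : psub x y = padd x (pscal (RtoC (-1)) y).
Proof. apply injective_projections; apply vsub_add. Qed.

Lemma pnrm_sub x y : pl2 x -> pl2 y -> pnrm (psub x y) <= pnrm x + pnrm y.
Proof.
  intros Hx Hy; rewrite psub_add; apply Rle_trans with (1 := pnrm_add _ _ Hx (pl2_scal _ _ Hy)).
  rewrite pnrm_scal, Cmod_R, (Rabs_left (-1)) by lra; lra.
Qed.

Lemma pnrm_0_eq x y : pl2 x -> pl2 y -> pnrm (psub x y) <= 0 -> x = y.
Proof.
  intros Hx Hy H0; destruct (pl2_sub _ _ Hx Hy) as [H1 H2].
  destruct (nrm_le_pnrm (psub x y)) as [N1 N2].
  assert (Z : forall z z' : C, Cmod (z - z')%C <= 0 -> z = z').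
  { intros z z' Hz; assert (E : (z - z')%C = 0%C)
      by (apply Cmod_eq_0, Rle_antisym; auto using Cmod_ge_0).
    replace z with (z - z' + z')%C by ring; rewrite E; ring. }
  apply pair_ext; intros k; apply Z.
  - pose proof (nrm_term _ k H1) as T; unfold psub, vsub in *; simpl in *; lra.
  - pose proof (nrm_term _ k H2) as T; unfold psub, vsub in *; simpl in *; lra.
Qed.

Lemma contraction_fixed_point (Phi : (Z -> C) * (Z -> C) -> (Z -> C) * (Z -> C)) kappa :
  0 <= kappa < 1 -> (forall x, pl2 x -> pl2 (Phi x)) ->
  (forall x y, pl2 x -> pl2 y -> pnrm (psub (Phi x) (Phi y)) <= kappa * pnrm (psub x y)) ->
  exists x, pl2 x /\ Phi x = x.
Proof.
  intros Hk Hst Hc.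
  set (x := fix x (n : nat) : (Z -> C) * (Z -> C) :=
    match n with O => (fun _ => RtoC 0, fun _ => RtoC 0) | S m => Phi (x m) end).
  assert (H0 : l2 (fun _ => RtoC 0)).
  { apply (ex_sumZ_ext (fun k => 0 * qZ k)); [|apply ex_sumZ_scal, ex_sumZ_qZ].
    intros k; rewrite Cmod_0; ring. }
  assert (Hx : forall n, pl2 (x n)) by (induction n as [|n IH]; [split; auto | apply Hst, IH]).
  set (c := pnrm (psub (x 1%nat) (x 0%nat))).
  assert (Hcp : 0 <= c) by apply pnrm_ge_0.
  assert (D : forall n, pnrm (psub (x (S n)) (x n)) <= c * kappa ^ n).
  { induction n as [|n IH]; [simpl; unfold c; simpl; lra|].
    apply Rle_trans with (1 := Hc _ _ (Hx (S n)) (Hx n)).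
    replace (c * kappa ^ S n) with (kappa * (c * kappa ^ n)) by (simpl; ring).
    apply Rmult_le_compat_l; lra. }
  destruct (l2_complete (fun n => fst (x n)) c kappa Hk Hcp) as [h [Hh Lh]].
  { intros n; apply Hx. }
  { intros n; apply Rle_trans with (2 := D n); apply (nrm_le_pnrm (psub (x (S n)) (x n))). }
  destruct (l2_complete (fun n => snd (x n)) c kappa Hk Hcp) as [y [Hy Ly]].
  { intros n; apply Hx. }
  { intros n; apply Rle_trans with (2 := D n); apply (nrm_le_pnrm (psub (x (S n)) (x n))). }
  set (z := (h, y)).
  assert (Hz : pl2 z) by now split.
  exists z; split; auto.
  set (M := 2 * c / (1 - kappa)).
  assert (HM : 0 <= M) by (apply Rmult_le_pos; [lra | apply Rlt_le, Rinv_0_lt_compat; lra]).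
  assert (L : forall n, pnrm (psub z (x n)) <= M * kappa ^ n).
  { intros n; apply Rle_trans with (1 := pnrm_le_sum _).
    specialize (Lh n); specialize (Ly n); simpl fst; simpl snd.
    replace (M * kappa ^ n) with (c * kappa ^ n / (1 - kappa) + c * kappa ^ n / (1 - kappa))
      by (unfold M; field; lra); lra. }
  assert (B : forall n, pnrm (psub (Phi z) z) <= 2 * M * kappa ^ n).
  { intros n.
    replace (psub (Phi z) z) with (psub (psub (Phi z) (x (S n))) (psub z (x (S n)))).
    2:{ apply pair_ext; intros k; unfold psub, vsub; simpl fst; simpl snd; ring. }
    apply Rle_trans with (1 := pnrm_sub _ _ (pl2_sub _ _ (Hst _ Hz) (Hx _)) (pl2_sub _ _ Hz (Hx _))).
    pose proof (Hc z (x n) Hz (Hx n)) as C1; pose proof (L n) as L1; pose proof (L (S n)) as L2.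
    change (Phi (x n)) with (x (S n)) in C1; pose proof (pow_le kappa n (proj1 Hk)) as Hp.
    assert (0 <= M * kappa ^ n) by now apply Rmult_le_pos.
    replace (M * kappa ^ S n) with (kappa * (M * kappa ^ n)) in L2 by (simpl; ring).
    assert (kappa * (M * kappa ^ n) <= 1 * (M * kappa ^ n)) by (apply Rmult_le_compat_r; lra).
    assert (kappa * pnrm (psub z (x n)) <= kappa * (M * kappa ^ n)) by (apply Rmult_le_compat_l; lra).
    lra. }
  apply pnrm_0_eq; auto.
  apply (is_lim_seq_le (fun _ => pnrm (psub (Phi z) z)) (fun n => 2 * M * kappa ^ n)
    (pnrm (psub (Phi z) z)) 0 B); [apply is_lim_seq_const|].
  replace (Finite 0) with (Rbar_mult (2 * M) 0) by (simpl; f_equal; ring).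
  apply is_lim_seq_scal_l, is_lim_seq_geom; rewrite Rabs_pos_eq; lra.
Qed.

(** Surjectivity is stable under perturbations smaller than the lower bound:
    [L + K] is inverted by solving [z = y - K (L^-1 z)]. *)
Lemma perturb_onto (Dom : (Z -> C) * (Z -> C) -> Prop) L K M delta :
  0 <= M -> 0 <= delta -> delta * M < 1 ->
  (forall x, Dom x -> pl2 x) ->
  (forall x y, Dom x -> Dom y -> Dom (psub x y) /\ L (psub x y) = psub (L x) (L y)) ->
  (forall x, Dom x -> pnrm x <= M * pnrm (L x)) ->
  (forall y, pl2 y -> exists x, Dom x /\ L x = y) ->
  (forall x, pl2 x -> pl2 (K x) /\ pnrm (K x) <= delta * pnrm x) ->
  (forall x y, pl2 x -> pl2 y -> K (psub x y) = psub (K x) (K y)) ->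
  forall y, pl2 y -> exists x, Dom x /\ padd (L x) (K x) = y.
Proof.
  intros HM Hd HdM HDom HL Hlow Honto HK HKs y Hy.
  pose (R := fun z => epsilon (inhabits z) (fun x => pl2 z -> Dom x /\ L x = z)).
  assert (HR : forall z, pl2 z -> Dom (R z) /\ L (R z) = z).
  { intros z Hz; refine (epsilon_spec (inhabits z) (fun x => pl2 z -> Dom x /\ L x = z) _ Hz).
    destruct (Honto z Hz) as [x Hx]; exists x; auto. }
  destruct (contraction_fixed_point (fun z => psub y (K (R z))) (delta * M)) as [z [Hz E]].
  - split; auto; now apply Rmult_le_pos.
  - intros z Hz; apply pl2_sub; auto; apply HK, HDom, HR, Hz.
  - intros z z' Hz Hz'; destruct (HR z Hz) as [D1 E1], (HR z' Hz') as [D2 E2].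
    replace (psub (psub y (K (R z))) (psub y (K (R z')))) with (psub (K (R z')) (K (R z)))
      by (apply pair_ext; intros k; unfold psub, vsub; simpl; ring).
    rewrite <- HKs by auto.
    destruct (HL _ _ D2 D1) as [D3 E3]; rewrite E1, E2 in E3.
    apply Rle_trans with (1 := proj2 (HK _ (HDom _ D3))).
    rewrite Rmult_assoc; apply Rmult_le_compat_l; auto.
    apply Rle_trans with (1 := Hlow _ D3); rewrite E3; apply Rmult_le_compat_l; auto.
    replace (psub z' z) with (pscal (RtoC (-1)) (psub z z'))
      by (apply pair_ext; intros k; unfold psub, pscal, vscal, dg, vsub; simpl fst; simpl snd; ring).
    rewrite pnrm_scal, Cmod_R, (Rabs_left (-1)) by lra; lra.
  - destruct (HR z Hz) as [D1 E1]; exists (R z); split; auto; rewrite E1.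
    rewrite <- E at 1; apply pair_ext; intros k; unfold psub, padd, vsub, vadd; simpl fst; simpl snd; ring.
Qed.

(** * The symmetrised generator and its resolvent *)

Lemma trunc_abs n k : Cmod (RtoC (if Z_le_dec (Z.abs k) (Z.of_nat n) then 1 else 0)) <= 1.
Proof. rewrite Cmod_R; destruct (Z_le_dec _ _); apply Rabs_le; lra. Qed.

Definition trunc (n : nat) : (Z -> C) -> Z -> C :=
  rdg (fun k => if Z_le_dec (Z.abs k) (Z.of_nat n) then 1 else 0).

Lemma l2_trunc n v : l2 v -> l2 (trunc n v).
Proof. apply (l2_dg _ _ 1 (trunc_abs n)). Qed.

Lemma trunc_in n v k : (Z.abs k <= Z.of_nat n)%Z -> trunc n v k = v k.
Proof. intros H; unfold trunc, rdg, dg; destruct (Z_le_dec _ _); [ring | lia]. Qed.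

Lemma trunc_out n v k : (Z.of_nat n < Z.abs k)%Z -> trunc n v k = 0%C.
Proof. intros H; unfold trunc, rdg, dg; destruct (Z_le_dec _ _); [lia | ring]. Qed.

Lemma trunc_tail v : l2 v -> forall eps, 0 < eps ->
  exists N, forall n, (N <= n)%nat -> nrm (vsub v (trunc n v)) <= eps.
Proof.
  intros Hv eps He.
  destruct (proj2 (is_lim_seq_spec _ _) (zsum_lim _ Hv) (mkposreal (eps ^ 2) (pow_lt _ 2 He))) as [N HN].
  exists N; intros n Hn; specialize (HN n Hn); simpl in HN; apply Rabs_def2 in HN.
  pose proof (l2_trunc n v Hv) as Ht; pose proof (l2_sub _ _ Hv Ht) as Hs.
  assert (E : sumZ (fun k => Cmod (v k) ^ 2) =
    sumZ (fun k => Cmod (vsub v (trunc n v) k) ^ 2) + sumZ (fun k => Cmod (trunc n v k) ^ 2)).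
  { rewrite <- sumZ_plus by auto; apply sumZ_ext; intros k; unfold vsub.
    destruct (Z_le_gt_dec (Z.abs k) (Z.of_nat n)) as [A|A].
    - rewrite trunc_in by auto; replace (v k - v k)%C with (RtoC 0) by ring; rewrite Cmod_0; ring.
    - rewrite trunc_out by lia; replace (v k - 0)%C with (v k) by ring; rewrite Cmod_0; ring. }
  assert (Z : zsum n (fun k => Cmod (v k) ^ 2) <= sumZ (fun k => Cmod (trunc n v k) ^ 2)).
  { apply Rle_trans with (2 := zsum_le_sumZ _ n (fun k => pow2_ge_0 _) Ht), Req_le.
    assert (G : forall p, (p <= n)%nat -> zsum p (fun k => Cmod (v k) ^ 2) =
      zsum p (fun k => Cmod (trunc n v k) ^ 2)).
    { induction p as [|p IH]; intros Hp; cbn [zsum].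
      - rewrite trunc_in by lia; reflexivity.
      - rewrite IH, !trunc_in by lia; reflexivity. }
    apply G; lia. }
  pose proof (nrm_sqr _ Hs) as Q; pose proof (nrm_ge_0 (vsub v (trunc n v))).
  apply Rnot_lt_le; intros B; simpl in *; nra.
Qed.

(** [lambda - A_d] without damping in the variables [h] and [y = P^(1/2) u]:
    apart from [lambda], it is the swap of the components times [i omega]. *)
Definition free_op (beta : R) (lam : C) (x : (Z -> C) * (Z -> C)) : (Z -> C) * (Z -> C) :=
  (vadd (vscal lam (fst x)) (omv beta (snd x)), vadd (vscal lam (snd x)) (omv beta (fst x))).

Definition damp_op (beta : R) (a b : Cinf) (x : (Z -> C) * (Z -> C)) : (Z -> C) * (Z -> C) :=
  (mul_op a (mul_op a (fst x)), rmul beta (mul_op b (mul_op b (rmul beta (snd x))))).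

Definition full_op (beta : R) (a b : Cinf) (lam : C) (x : (Z -> C) * (Z -> C)) : (Z -> C) * (Z -> C) :=
  padd (free_op beta lam x) (damp_op beta a b x).

Definition op_dom (beta : R) (x : (Z -> C) * (Z -> C)) : Prop :=
  pl2 x /\ l2 (omv beta (fst x)) /\ l2 (omv beta (snd x)).

Definition pip (x y : (Z -> C) * (Z -> C)) : C := (ip (fst x) (fst y) + ip (snd x) (snd y))%C.

Lemma Re_pip_le x y : pl2 x -> pl2 y -> Re (pip x y) <= pnrm x * pnrm y.
Proof.
  intros [X1 X2] [Y1 Y2]; apply Rle_trans with (2 := cauchy_schwarz_pair x y).
  pose proof (Re_le_ip _ _ X1 Y1) as A1; pose proof (Re_le_ip _ _ X2 Y2) as A2.
  apply Rabs_le_between in A1; apply Rabs_le_between in A2.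
  unfold pip; rewrite re_plus; lra.
Qed.

Lemma coercive_lower x y s : 0 < s -> pl2 x -> pl2 y -> s * pnrm x ^ 2 <= Re (pip y x) ->
  pnrm x <= / s * pnrm y.
Proof.
  intros Hs Hx Hy H; pose proof (Re_pip_le y x Hy Hx) as U.
  pose proof (pnrm_ge_0 x) as P; pose proof (pnrm_ge_0 y).
  apply (Rmult_le_reg_l s); auto; rewrite <- Rmult_assoc, Rinv_r, Rmult_1_l by lra.
  apply Rnot_lt_le; intros B; destruct (Req_dec (pnrm x) 0) as [E|E]; [rewrite E in *; lra|].
  assert (pnrm y * pnrm x < s * pnrm x * pnrm x) by (apply Rmult_lt_compat_r; lra).
  replace (s * pnrm x ^ 2) with (s * pnrm x * pnrm x) in H by ring; lra.
Qed.

Section Generator.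

Variable beta : R.
Hypothesis Hb : 0 < beta.
Variables a b : Cinf.

Lemma op_dom_sub x y : op_dom beta x -> op_dom beta y -> op_dom beta (psub x y).
Proof.
  intros [X1 [X2 X3]] [Y1 [Y2 Y3]]; split; [now apply pl2_sub|].
  assert (E : forall v w, omv beta (vsub v w) = vsub (omv beta v) (omv beta w)).
  { intros v w; apply seq_ext; intros k; unfold omv, vsub, dg; ring. }
  unfold psub; simpl fst; simpl snd; rewrite !E; split; now apply l2_sub.
Qed.

Lemma free_op_sub lam x y : free_op beta lam (psub x y) = psub (free_op beta lam x) (free_op beta lam y).
Proof.
  apply pair_ext; intros k; unfold free_op, psub, omv, vadd, vsub, vscal, dg; simpl fst; simpl snd; ring.
Qed.

Lemma pl2_free_op lam x : op_dom beta x -> pl2 (free_op beta lam x).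
Proof. intros [[X1 X2] [X3 X4]]; split; apply l2_add; auto using l2_scal. Qed.

Lemma mul_sub c v w : l2 v -> l2 w -> mul_op c (vsub v w) = vsub (mul_op c v) (mul_op c w).
Proof.
  intros; rewrite !vsub_add, mul_add, mul_scal; auto using l2_scal.
Qed.

Lemma rmul_sub v w : rmul beta (vsub v w) = vsub (rmul beta v) (rmul beta w).
Proof. apply seq_ext; intros k; unfold rmul, rdg, dg, vsub; ring. Qed.

Lemma damp_op_sub x y : pl2 x -> pl2 y ->
  damp_op beta a b (psub x y) = psub (damp_op beta a b x) (damp_op beta a b y).
Proof.
  intros [X1 X2] [Y1 Y2]; unfold damp_op, psub; simpl fst; simpl snd.
  rewrite rmul_sub, !mul_sub, rmul_sub; auto using l2_mul, l2_rmul.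
Qed.

Lemma damp_op_bound : exists L, 0 <= L /\ forall x, pl2 x ->
  pl2 (damp_op beta a b x) /\ pnrm (damp_op beta a b x) <= L * pnrm x.
Proof.
  destruct (nrm_mul a) as [La [HLa Ba]], (nrm_mul b) as [Lb [HLb Bb]], (nrm_rmul beta Hb) as [Lr [HLr Br]].
  assert (H1 : 0 <= La * La) by nra.
  assert (H2 : 0 <= Lr * (Lb * (Lb * Lr))) by (repeat apply Rmult_le_pos; auto).
  exists (La * La + Lr * (Lb * (Lb * Lr))); split; [lra|]; intros x [X1 X2].
  pose proof (l2_mul a _ X1) as A1; pose proof (l2_mul a _ A1) as A2.
  pose proof (l2_rmul beta Hb _ X2) as B1; pose proof (l2_mul b _ B1) as B2.
  pose proof (l2_mul b _ B2) as B3; pose proof (l2_rmul beta Hb _ B3) as B4.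
  split; [split; auto|].
  destruct (nrm_le_pnrm x) as [N1 N2].
  apply Rle_trans with (1 := pnrm_le_sum _); unfold damp_op; simpl fst; simpl snd.
  rewrite Rmult_plus_distr_r; apply Rplus_le_compat.
  - apply Rle_trans with (1 := Ba _ A1); rewrite Rmult_assoc; apply Rmult_le_compat_l; auto.
    apply Rle_trans with (1 := Ba _ X1); apply Rmult_le_compat_l; auto.
  - apply Rle_trans with (1 := Br _ B3); rewrite Rmult_assoc; apply Rmult_le_compat_l; auto.
    apply Rle_trans with (1 := Bb _ B2); rewrite Rmult_assoc; apply Rmult_le_compat_l; auto.
    apply Rle_trans with (1 := Bb _ B1); rewrite Rmult_assoc; apply Rmult_le_compat_l; auto.
    apply Rle_trans with (1 := Br _ X2); apply Rmult_le_compat_l; auto.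
Qed.

Lemma Re_free_op lam x : op_dom beta x -> Re (pip (free_op beta lam x) x) = Re lam * pnrm x ^ 2.
Proof.
  intros [[X1 X2] [X3 X4]].
  assert (E : pip (free_op beta lam x) x = (lam * RtoC (pnrm x ^ 2) +
    (ip (omv beta (snd x)) (fst x) - Cconj (ip (omv beta (snd x)) (fst x))))%C).
  { unfold pip, free_op; simpl fst; simpl snd.
    rewrite !ip_add_l, !ip_scal_l, !ip_self by auto using l2_scal.
    rewrite (ip_skew (fun k => IZR k * root_p beta k) (fst x) (snd x) X1 X2 X3 X4 : ip (omv beta (fst x)) (snd x) =
      (- ip (fst x) (omv beta (snd x)))%C).
    rewrite (ip_conj (omv beta (snd x)) (fst x)), pnrm_sqr, RtoC_plus; ring. }
  rewrite E; generalize (ip (omv beta (snd x)) (fst x)); intros z.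
  cbn -[pnrm pow]; unfold Re; ring.
Qed.

Lemma Re_damp_op x : pl2 x -> 0 <= Re (pip (damp_op beta a b x) x).
Proof.
  intros [X1 X2]; unfold pip, damp_op; simpl fst; simpl snd.
  pose proof (l2_mul a _ X1) as A1; pose proof (l2_mul a _ A1) as A2.
  pose proof (l2_rmul beta Hb _ X2) as B1; pose proof (l2_mul b _ B1) as B2.
  pose proof (l2_mul b _ B2) as B3.
  unfold rmul at 1, rdg; rewrite ip_dg; change (dg _ (snd x)) with (rmul beta (snd x)).
  rewrite (mul_adjoint a _ (fst x)), (mul_adjoint b _ (rmul beta (snd x))), !ip_self by auto; rewrite <- RtoC_plus, re_RtoC.
  apply Rplus_le_le_0_compat; apply pow2_ge_0.
Qed.

Lemma pl2_full_op lam x : op_dom beta x -> pl2 (full_op beta a b lam x).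
Proof.
  intros H; destruct damp_op_bound as [L [_ BL]]; apply pl2_add; [now apply pl2_free_op | apply BL, H].
Qed.

Lemma full_op_sub lam x y : op_dom beta x -> op_dom beta y ->
  full_op beta a b lam (psub x y) = psub (full_op beta a b lam x) (full_op beta a b lam y).
Proof.
  intros [X _] [Y _]; unfold full_op; rewrite free_op_sub, damp_op_sub by auto.
  apply pair_ext; intros k; unfold padd, psub, vadd, vsub; simpl fst; simpl snd; ring.
Qed.

Lemma pip_add_l x x' y : pl2 x -> pl2 x' -> pl2 y -> pip (padd x x') y = (pip x y + pip x' y)%C.
Proof. intros [] [] []; unfold pip, padd; simpl fst; simpl snd; rewrite !ip_add_l by auto; ring. Qed.

Lemma free_op_lower lam x : 0 < Re lam -> op_dom beta x -> pnrm x <= / Re lam * pnrm (free_op beta lam x).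
Proof.
  intros Hl Hx; apply coercive_lower; auto; [apply Hx | now apply pl2_free_op | rewrite Re_free_op; auto; lra].
Qed.

Lemma full_op_lower lam x : 0 < Re lam -> op_dom beta x -> pnrm x <= / Re lam * pnrm (full_op beta a b lam x).
Proof.
  intros Hl Hx; destruct damp_op_bound as [L [_ BL]].
  apply coercive_lower; auto; [apply Hx | now apply pl2_full_op |].
  unfold full_op; rewrite pip_add_l; [|now apply pl2_free_op | apply BL, Hx | apply Hx].
  rewrite re_plus, Re_free_op by auto; pose proof (Re_damp_op x (proj1 Hx)); lra.
Qed.

(** The sum and the difference of the components decouple. *)
Lemma free_op_onto lam y : 0 < Re lam -> pl2 y -> exists x, op_dom beta x /\ free_op beta lam x = y.
Proof.
  intros Hl [Y1 Y2].
  set (om := fun k => IZR k * root_p beta k).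
  set (P := fun k => (/ (lam + Ci * RtoC (om k)))%C); set (M := fun k => (/ (lam - Ci * RtoC (om k)))%C).
  assert (Low : forall w : R, Re lam <= Cmod (lam + Ci * RtoC w)%C).
  { intros w; apply Rle_trans with (2 := re_le_Cmod _).
    replace (Re (lam + Ci * RtoC w)%C) with (Re lam) by (simpl; unfold Re; ring); apply Rle_abs. }
  assert (NP : forall w : R, (lam + Ci * RtoC w)%C <> 0%C).
  { intros w E; specialize (Low w); rewrite E, Cmod_0 in Low; lra. }
  assert (BI : forall w : R, Cmod (/ (lam + Ci * RtoC w))%C <= / Re lam).
  { intros w; rewrite Cmod_inv by apply NP; apply Rinv_le_contravar; auto. }
  assert (EM : forall k, (lam - Ci * RtoC (om k))%C = (lam + Ci * RtoC (- om k))%C)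
    by (intros k; rewrite RtoC_opp; ring).
  assert (NM : forall k, (lam - Ci * RtoC (om k))%C <> 0%C) by (intros; rewrite EM; apply NP).
  set (s := dg P (vadd (fst y) (snd y))); set (d := dg M (vsub (fst y) (snd y))).
  assert (Hs : l2 s) by (apply (l2_dg _ _ (/ Re lam)); [intros k; apply BI | now apply l2_add]).
  assert (Hd : l2 d) by (apply (l2_dg _ _ (/ Re lam));
    [intros k; unfold M; rewrite EM; apply BI | now apply l2_sub]).
  set (c := (/ RtoC 2)%C).
  assert (N2 : RtoC 2 <> 0%C) by (intros E; apply RtoC_inj in E; lra).
  set (x := (vscal c (vadd s d), vscal c (vsub s d))).
  assert (Hx : pl2 x) by (split; apply l2_scal; [now apply l2_add | now apply l2_sub]).
  assert (E : free_op beta lam x = y).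
  { assert (ES : forall k, ((lam + Ci * RtoC (om k)) * s k = fst y k + snd y k)%C).
    { intros k; unfold s, dg, P, vadd; field; apply NP. }
    assert (ED : forall k, ((lam - Ci * RtoC (om k)) * d k = fst y k - snd y k)%C).
    { intros k; unfold d, dg, M, vsub; field; apply NM. }
    apply pair_ext; intros k; specialize (ES k); specialize (ED k);
      unfold x, free_op, vadd, vsub, vscal, omv, dg; simpl fst; simpl snd; fold (om k).
    - transitivity (c * ((lam + Ci * RtoC (om k)) * s k + (lam - Ci * RtoC (om k)) * d k))%C; [ring|].
      rewrite ES, ED; unfold c; field; auto.
    - transitivity (c * ((lam + Ci * RtoC (om k)) * s k - (lam - Ci * RtoC (om k)) * d k))%C; [ring|].
      rewrite ES, ED; unfold c; field; auto. }
  exists x; split; auto; split; auto.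
  (* [omega x] is read off the equations *)
  rewrite <- E in Y1, Y2; destruct Hx as [X1 X2].
  split; [replace (omv beta (fst x)) with (vsub (snd (free_op beta lam x)) (vscal lam (snd x)))
         |replace (omv beta (snd x)) with (vsub (fst (free_op beta lam x)) (vscal lam (fst x)))];
    auto using l2_sub, l2_scal; apply seq_ext; intros k;
    unfold free_op, vsub, vadd; simpl fst; simpl snd; ring.
Qed.

Lemma full_op_shift lam mu x : padd (full_op beta a b lam x) (pscal mu x) = full_op beta a b (lam + mu)%C x.
Proof.
  apply pair_ext; intros k; unfold full_op, free_op, padd, pscal, vadd, vscal, dg; simpl fst; simpl snd; ring.
Qed.

Lemma full_op_shift_onto lam (mu : R) M : 0 <= M -> Rabs mu * M < 1 ->
  (forall x, op_dom beta x -> pnrm x <= M * pnrm (full_op beta a b lam x)) ->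
  (forall y, pl2 y -> exists x, op_dom beta x /\ full_op beta a b lam x = y) ->
  forall y, pl2 y -> exists x, op_dom beta x /\ full_op beta a b (lam + RtoC mu)%C x = y.
Proof.
  intros HM Hmu Hlow Honto y Hy.
  destruct (perturb_onto (op_dom beta) (full_op beta a b lam) (pscal (RtoC mu)) M (Rabs mu)) with (y := y)
    as [x [Dx Ex]]; auto using Rabs_pos.
  - intros x Hx; apply Hx.
  - intros x x' Hx Hx'; split; [now apply op_dom_sub | now apply full_op_sub].
  - intros x Hx; split; [now apply pl2_scal|]; rewrite pnrm_scal, Cmod_R; lra.
  - intros x x' _ _; apply pair_ext; intros k; unfold pscal, psub, vsub, vscal, dg; simpl fst; simpl snd; ring.
  - exists x; split; auto; rewrite <- full_op_shift; auto.
Qed.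

(** For large real part the damping is a small perturbation of the undamped
    resolvent; dissipativity then carries surjectivity to the whole half-plane. *)
Lemma full_op_onto lam : 0 < Re lam ->
  forall y, pl2 y -> exists x, op_dom beta x /\ full_op beta a b lam x = y.
Proof.
  intros Hl; destruct damp_op_bound as [L [HL BL]].
  set (s := L + Re lam + 1).
  set (lam0 := (lam + RtoC (s - Re lam))%C).
  assert (R0 : Re lam0 = s) by (unfold lam0; simpl; unfold Re; ring).
  assert (Hs : 0 < s) by (unfold s; lra).
  assert (Hsi : s * / s = 1) by (apply Rinv_r; lra).
  assert (Hi : 0 < / s) by now apply Rinv_0_lt_compat.
  assert (Onto0 : forall y, pl2 y -> exists x, op_dom beta x /\ full_op beta a b lam0 x = y).
  { intros y Hy; apply (perturb_onto (op_dom beta) (free_op beta lam0) (damp_op beta a b) (/ s) L); auto.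
    - lra.
    - apply (Rmult_lt_reg_r s); auto; rewrite Rmult_assoc, Rinv_l by lra; unfold s; lra.
    - intros x Hx; apply Hx.
    - intros x x' Hx Hx'; split; [now apply op_dom_sub | apply free_op_sub].
    - intros x Hx; rewrite <- R0; apply free_op_lower; auto; lra.
    - intros z Hz; apply free_op_onto; auto; lra.
    - apply damp_op_sub. }
  intros y Hy.
  replace lam with (lam0 + RtoC (- (s - Re lam)))%C by (unfold lam0; rewrite RtoC_opp; ring).
  apply (full_op_shift_onto lam0 _ (/ s)); auto; [lra | |].
  - rewrite Rabs_Ropp, Rabs_pos_eq by (unfold s; lra).
    apply (Rmult_lt_reg_r s); auto; rewrite Rmult_assoc, Rinv_l by lra; lra.
  - intros x Hx; rewrite <- R0; apply full_op_lower; auto; lra.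
Qed.

(** A lower bound on the imaginary axis makes the resolvent set reach it from
    the right half-plane. *)
Lemma full_op_onto_axis tau M : 0 < M ->
  (forall x, op_dom beta x -> pnrm x <= M * pnrm (full_op beta a b (Ci * RtoC tau) x)) ->
  forall y, pl2 y -> exists x, op_dom beta x /\ full_op beta a b (Ci * RtoC tau) x = y.
Proof.
  intros HM Hlow y Hy; set (s := / (4 * M)).
  assert (Hs : 0 < s) by (apply Rinv_0_lt_compat; lra).
  assert (HsM : s * M = / 4) by (unfold s; field; lra).
  replace (Ci * RtoC tau)%C with (Ci * RtoC tau + RtoC s + RtoC (- s))%C by (rewrite RtoC_opp; ring).
  apply (full_op_shift_onto _ _ (2 * M)); auto; [lra | | |].
  - rewrite Rabs_Ropp, Rabs_pos_eq by lra; lra.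
  - intros x Hx; specialize (Hlow x Hx).
    replace (full_op beta a b (Ci * RtoC tau) x) with
      (padd (full_op beta a b (Ci * RtoC tau + RtoC s) x) (pscal (RtoC (- s)) x)) in Hlow.
    2:{ rewrite full_op_shift; f_equal; rewrite RtoC_opp; ring. }
    pose proof (pnrm_add _ _ (pl2_full_op (Ci * RtoC tau + RtoC s) x Hx) (pl2_scal (RtoC (- s)) _ (proj1 Hx))) as T.
    rewrite pnrm_scal, Cmod_R, Rabs_Ropp, (Rabs_pos_eq s) in T by lra.
    apply (Rmult_le_compat_l M) in T; [|lra].
    pose proof (pnrm_ge_0 x).
    replace (M * (pnrm (full_op beta a b (Ci * RtoC tau + RtoC s) x) + s * pnrm x)) with
      (M * pnrm (full_op beta a b (Ci * RtoC tau + RtoC s) x) + / 4 * pnrm x) in T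
      by (rewrite <- HsM; ring).
    lra.
  - apply full_op_onto; simpl; unfold Re; simpl; lra.
Qed.

Lemma omv_trunc n v : omv beta (trunc n v) = trunc n (omv beta v).
Proof. apply seq_ext; intros k; unfold omv, trunc, rdg, dg; ring. Qed.

Lemma eq1_full_op lam h u : eq1 beta a lam h u = fst (full_op beta a b lam (h, rmul beta u)).
Proof.
  destruct (p_beta_bounds beta Hb) as [K [_ B]].
  apply seq_ext; intros k; destruct (B k) as [_ [B1 _]].
  unfold eq1, full_op, free_op, damp_op, padd, vadd, vscal, ddx, pmul, rmul, omv, rdg, dg; simpl fst.
  rewrite <- B1; apply injective_projections; simpl; ring.
Qed.

Lemma eq2_full_op lam h u : rmul beta (eq2 beta b lam h u) = snd (full_op beta a b lam (h, rmul beta u)).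
Proof.
  destruct (p_beta_bounds beta Hb) as [K [_ B]].
  assert (E : pmul beta u = rmul beta (rmul beta u)).
  { apply seq_ext; intros k; destruct (B k) as [_ [B1 _]].
    unfold pmul, rmul, rdg, dg; rewrite <- B1; apply injective_projections; simpl; ring. }
  unfold eq2, full_op, free_op, damp_op, padd; rewrite E; simpl fst; simpl snd.
  generalize (mul_op b (mul_op b (rmul beta (rmul beta u)))); intros w.
  apply seq_ext; intros k.
  unfold vadd, vscal, ddx, omv, rmul, rdg, dg; rewrite RtoC_mult; ring.
Qed.

Lemma rmul_rinv v : rmul beta (rinv beta v) = v.
Proof.
  destruct (p_beta_bounds beta Hb) as [K [_ B]].
  apply seq_ext; intros k; destruct (B k) as [B1 _].
  unfold rmul, rinv, rdg, dg; rewrite Cmult_assoc, <- RtoC_mult, Rinv_r by lra; ring.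
Qed.

Lemma l2_ddx_trunc n v : l2 v -> l2 (ddx (trunc n v)).
Proof.
  apply (l2_le _ _ (INR n)); intros k; unfold ddx, dg.
  rewrite !Cmod_mult, Cmod_Ci, Cmod_R, Rmult_1_l.
  destruct (Z_le_gt_dec (Z.abs k) (Z.of_nat n)) as [A|A].
  - rewrite trunc_in by auto; apply Rmult_le_compat_r; [apply Cmod_ge_0|].
    rewrite <- abs_IZR, INR_IZR_INZ; now apply IZR_le.
  - rewrite trunc_out, Cmod_0, Rmult_0_r by lia; apply Rmult_le_pos; auto using pos_INR, Cmod_ge_0.
Qed.

(** Truncations are dense in the domain for the graph norm. *)
Lemma apriori : (exists x, a x <> 0) -> exists K t0, 0 < K /\ 1 <= t0 /\
  forall tau x, t0 <= Rabs tau -> op_dom beta x ->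
  pnrm x <= K * Rabs tau * pnrm (full_op beta a b (Ci * RtoC tau) x).
Proof.
  intros Ha; destruct (apriori_regular beta a b Hb Ha) as [K [t0 [HK [Ht0 H]]]].
  destruct damp_op_bound as [L [HL BL]].
  exists K, t0; split; auto; split; auto; intros tau x Ht Hx.
  set (t := Rabs tau) in *; set (lam := (Ci * RtoC tau)%C) in *.
  set (c := 2 + K * t * (2 * t + 2 + 2 * L)).
  assert (Kt : 0 < K * t) by (apply Rmult_lt_0_compat; lra).
  assert (Hc : 0 < c) by (unfold c; nra).
  apply le_epsilon; intros eps Heps.
  set (e := eps / c).
  assert (He : 0 < e) by now apply Rdiv_lt_0_compat.
  destruct x as [h y]; destruct Hx as [[X1 X2] [X3 X4]]; simpl fst in *; simpl snd in *.
  destruct (trunc_tail h X1 e He) as [N1 T1], (trunc_tail y X2 e He) as [N2 T2].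
  destruct (trunc_tail _ X3 e He) as [N3 T3], (trunc_tail _ X4 e He) as [N4 T4].
  set (n := (N1 + N2 + N3 + N4)%nat).
  specialize (T1 n ltac:(unfold n; lia)); specialize (T2 n ltac:(unfold n; lia)).
  specialize (T3 n ltac:(unfold n; lia)); specialize (T4 n ltac:(unfold n; lia)).
  set (xn := (trunc n h, trunc n y)).
  assert (Dx : op_dom beta (h, y)) by (repeat split; auto).
  assert (Dn : op_dom beta xn).
  { repeat split; simpl fst; simpl snd; rewrite ?omv_trunc; now apply l2_trunc. }
  destruct (rinv_bound beta Hb) as [Kr [_ Br]].
  assert (Hrn : l2 (rinv beta (trunc n y))) by (apply Br; apply Dn).
  specialize (H tau (trunc n h) (rinv beta (trunc n y)) Ht (l2_trunc n h X1)
    (l2_ddx_trunc n h X1) Hrn).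
  rewrite eq1_full_op, eq2_full_op, rmul_rinv in H; fold xn in H; fold t lam in H.
  rewrite <- surjective_pairing in H.
  set (z := psub (h, y) xn).
  assert (Dz : op_dom beta z) by now apply op_dom_sub.
  assert (Pz : pnrm z <= 2 * e).
  { apply Rle_trans with (1 := pnrm_le_sum _); simpl fst; simpl snd; lra. }
  assert (Ex : (h, y) = padd xn z).
  { apply pair_ext; intros k; unfold z, xn, padd, psub, vadd, vsub; simpl fst; simpl snd; ring. }
  assert (A1 : pnrm (h, y) <= pnrm xn + pnrm z).
  { rewrite Ex at 1; apply pnrm_add; [apply Dn | apply Dz]. }
  assert (Es : full_op beta a b lam xn = psub (full_op beta a b lam (h, y)) (full_op beta a b lam z)).
  { rewrite <- full_op_sub by auto; f_equal.
    apply pair_ext; intros k; unfold z, xn, psub, vsub; simpl fst; simpl snd; ring. }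
  assert (A2 : pnrm (full_op beta a b lam xn) <= pnrm (full_op beta a b lam (h, y)) + pnrm (full_op beta a b lam z)).
  { rewrite Es; apply pnrm_sub; now apply pl2_full_op. }
  assert (A3 : pnrm (full_op beta a b lam z) <= (2 * t + 2 + 2 * L) * e).
  { unfold full_op; apply Rle_trans with (1 := pnrm_add _ _ (pl2_free_op lam z Dz) (proj1 (BL z (proj1 Dz)))).
    pose proof (proj2 (BL z (proj1 Dz))) as C1.
    assert (C2 : pnrm (free_op beta lam z) <= 2 * t * e + 2 * e).
    { assert (Ef : free_op beta lam z = padd (pscal lam z) (omv beta (snd z), omv beta (fst z))) by reflexivity.
      rewrite Ef; apply Rle_trans with (pnrm (pscal lam z) + pnrm (omv beta (snd z), omv beta (fst z))).
      - apply pnrm_add; [apply pl2_scal, Dz | split; apply Dz].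
      - rewrite pnrm_scal; unfold lam at 1; rewrite Cmod_Ci_R; fold t; apply Rplus_le_compat.
        + replace (2 * t * e) with (t * (2 * e)) by ring; apply Rmult_le_compat_l; lra.
        + apply Rle_trans with (1 := pnrm_le_sum _); simpl fst; simpl snd.
          assert (Eo : forall v, omv beta (vsub v (trunc n v)) = vsub (omv beta v) (trunc n (omv beta v))).
          { intros v; rewrite <- omv_trunc; apply seq_ext; intros k.
            unfold omv, vsub, dg; ring. }
          rewrite !Eo; lra. }
    assert (L * pnrm z <= L * (2 * e)) by (apply Rmult_le_compat_l; auto); lra. }
  assert (A4 : K * (t * pnrm (full_op beta a b lam xn)) <=
    K * t * (pnrm (full_op beta a b lam (h, y)) + (2 * t + 2 + 2 * L) * e)).
  { rewrite <- Rmult_assoc; apply Rmult_le_compat_l; lra. }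
  replace eps with (c * e) by (unfold e; field; lra).
  unfold c; lra.
Qed.

End Generator.

(** * From sequences back to distributions *)

(** The scaling of the second component makes the energy norm a multiple of the
    norm of [l2 x l2]. *)
Definition coords (beta : R) (x : state) : (Z -> C) * (Z -> C) :=
  (fourier (fst x), rmul beta (fourier (snd x))).

Lemma Cmod_mult_R (m : R) (z : C) : Cmod (RtoC m * z) ^ 2 = m ^ 2 * Cmod z ^ 2.
Proof. rewrite Cmod_mult, Cmod_R, Rpow_mult_distr, pow2_abs; reflexivity. Qed.

Lemma sobolev_weight_comparable (w w' : Z -> R) c v : (forall k, 0 <= w k) ->
  (forall k, w k <= c * w' k) -> ex_sumZ (fun k => w' k * Cmod (v k) ^ 2) ->
  ex_sumZ (fun k => w k * Cmod (v k) ^ 2).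
Proof.
  intros H0 H E; apply (ex_sumZ_le _ (fun k => c * (w' k * Cmod (v k) ^ 2)));
    [|now apply ex_sumZ_scal].
  intros k; rewrite Rabs_pos_eq by (apply Rmult_le_pos; auto using pow2_ge_0).
  rewrite <- Rmult_assoc; apply Rmult_le_compat_r; auto using pow2_ge_0.
Qed.

Lemma L2_iff v : L2 v <-> l2 (fourier v).
Proof.
  assert (E : forall k, Rpower (1 + IZR k ^ 2) 0 * Cmod (fourier v k) ^ 2 = Cmod (fourier v k) ^ 2).
  { intros k; rewrite Rpower_O by (pose proof (pow2_ge_0 (IZR k)); lra); ring. }
  split; apply ex_sumZ_ext; auto.
Qed.

Lemma sqrt_jap k : sqrt (1 + IZR k ^ 2) <= jap k <= 2 * sqrt (1 + IZR k ^ 2).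
Proof.
  unfold jap; rewrite <- (pow2_abs (IZR k)); set (t := Rabs (IZR k)).
  assert (Ht : 0 <= t) by apply Rabs_pos.
  pose proof (sqrt_pos (1 + t ^ 2)) as P; pose proof (pow2_sqrt (1 + t ^ 2) ltac:(nra)) as E.
  pose proof (pow2_ge_0 (1 - t)).
  split; apply Rnot_lt_le; intros A; nra.
Qed.

Lemma Rpower_half k : Rpower (1 + IZR k ^ 2) (1 / 2) = sqrt (1 + IZR k ^ 2).
Proof.
  replace (1 / 2) with (/ 2) by field; apply Rpower_sqrt; pose proof (pow2_ge_0 (IZR k)); lra.
Qed.

Lemma Rpower_mhalf k : Rpower (1 + IZR k ^ 2) (- (1 / 2)) = / sqrt (1 + IZR k ^ 2).
Proof. rewrite Rpower_Ropp, Rpower_half; reflexivity. Qed.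

Section Translation.

Variable beta : R.
Hypothesis Hb : 0 < beta.
Variables a b : Cinf.

Lemma rmul_sqr v k : Cmod (rmul beta v k) ^ 2 = p_beta beta k * Cmod (v k) ^ 2.
Proof.
  destruct (p_beta_bounds beta Hb) as [K [_ B]]; destruct (B k) as [_ [B1 _]].
  unfold rmul, rdg, dg; now rewrite Cmod_mult_R, B1.
Qed.

Lemma omv_sqr v k : Cmod (omv beta v k) ^ 2 = IZR k ^ 2 * p_beta beta k * Cmod (v k) ^ 2.
Proof.
  destruct (p_beta_bounds beta Hb) as [K [_ B]]; destruct (B k) as [_ [B1 _]].
  unfold omv, dg; rewrite !Cmod_mult, Cmod_Ci, Cmod_R, Rmult_1_l.
  rewrite Rpow_mult_distr, pow2_abs, Rpow_mult_distr, B1; ring.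
Qed.

Lemma energy_space_iff x : energy_space x <-> pl2 (coords beta x).
Proof.
  destruct (p_beta_asymptotics beta Hb) as [c1 [c2 [c3 [H1 [H2 [_ H]]]]]].
  unfold energy_space, pl2, coords; simpl fst; simpl snd; rewrite L2_iff.
  assert (J : forall k, 0 < sqrt (1 + IZR k ^ 2)).
  { intros k; apply sqrt_lt_R0; pose proof (pow2_ge_0 (IZR k)); lra. }
  assert (P : forall k, 0 <= p_beta beta k).
  { intros k; destruct (H k) as [[A _] _]; pose proof (jap_ge_1 k); nra. }
  assert (W : sobolev (- (1 / 2)) (snd x) <-> l2 (rmul beta (fourier (snd x)))); [|tauto].
  unfold sobolev, l2; split; intros E.
  - apply (ex_sumZ_ext (fun k => p_beta beta k * Cmod (fourier (snd x) k) ^ 2));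
      [intros k; symmetry; apply rmul_sqr|].
    refine (sobolev_weight_comparable _ _ c2 _ P _ E); intros k; rewrite Rpower_mhalf.
    destruct (H k) as [[_ A] _]; destruct (sqrt_jap k) as [A1 _]; specialize (J k); specialize (P k).
    apply (Rmult_le_reg_r (sqrt (1 + IZR k ^ 2))); auto.
    rewrite Rmult_assoc, Rinv_l by lra; nra.
  - refine (sobolev_weight_comparable _ (p_beta beta) (2 * / c1) _ _ _ _).
    + intros k; rewrite Rpower_mhalf; apply Rlt_le, Rinv_0_lt_compat, J.
    + intros k; rewrite Rpower_mhalf.
      destruct (H k) as [[A _] _]; destruct (sqrt_jap k) as [_ A1]; specialize (J k); specialize (P k).
      apply (Rmult_le_reg_r (sqrt (1 + IZR k ^ 2))); auto; rewrite Rinv_l by lra.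
      apply (Rmult_le_reg_l c1); auto.
      replace (c1 * (2 * / c1 * p_beta beta k * sqrt (1 + IZR k ^ 2))) with
        (p_beta beta k * (2 * sqrt (1 + IZR k ^ 2))) by (field; lra); nra.
    + apply (ex_sumZ_ext (fun k => Cmod (rmul beta (fourier (snd x)) k) ^ 2)); auto.
      intros k; apply rmul_sqr.
Qed.

Lemma Ad_domain_iff x : Ad_domain x <-> op_dom beta (coords beta x).
Proof.
  destruct (p_beta_bounds beta Hb) as [K [HK B]].
  destruct (p_beta_asymptotics beta Hb) as [c1 [c2 [c3 [H1 [_ [_ H]]]]]].
  destruct (rinv_bound beta Hb) as [Kr [_ Br]].
  unfold Ad_domain, op_dom, pl2, coords; simpl fst; simpl snd; rewrite L2_iff.
  assert (J : forall k, 1 <= sqrt (1 + IZR k ^ 2)).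
  { intros k; rewrite <- sqrt_1 at 1; apply sqrt_le_1_alt; pose proof (pow2_ge_0 (IZR k)); lra. }
  assert (T : forall k, Rabs (IZR k) ^ 2 = IZR k ^ 2) by (intros; apply pow2_abs).
  assert (W1 : sobolev (1 / 2) (fst x) <-> l2 (fourier (fst x)) /\ l2 (omv beta (fourier (fst x)))).
  { unfold sobolev; split.
    - intros E; split.
      + apply (ex_sumZ_ext (fun k => 1 * Cmod (fourier (fst x) k) ^ 2)); [intros; ring|].
        refine (sobolev_weight_comparable (fun _ => 1) _ 1 _ _ _ E); intros k; [lra|].
        rewrite Rpower_half; specialize (J k); lra.
      + apply (ex_sumZ_ext (fun k => IZR k ^ 2 * p_beta beta k * Cmod (fourier (fst x) k) ^ 2));
          [intros k; symmetry; apply omv_sqr|].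
        refine (sobolev_weight_comparable _ _ K _ _ _ E); intros k;
          destruct (B k) as [B1 [B2 [_ [_ [B3 _]]]]].
        * rewrite <- B2; apply Rmult_le_pos; apply pow2_ge_0.
        * rewrite Rpower_half, <- T; destruct (sqrt_jap k) as [A1 A2].
          pose proof (Rabs_pos (IZR k)) as R0.
          replace (Rabs (IZR k) ^ 2 * p_beta beta k) with (Rabs (IZR k) * p_beta beta k * Rabs (IZR k)) by ring.
          apply Rmult_le_compat; auto.
          { rewrite <- B2; apply Rmult_le_pos; auto using pow2_ge_0. }
          rewrite T, <- sqrt_Rsqr_abs; apply sqrt_le_1_alt; unfold Rsqr; lra.
    - intros [E1 E2]; refine (sobolev_weight_comparable _ (fun k => / p_beta beta k) c2 _ _ _ _).
      + intros k; rewrite Rpower_half; apply sqrt_pos.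
      + intros k; rewrite Rpower_half; destruct (sqrt_jap k) as [A1 _]; destruct (H k) as [[A2 A3] _].
        apply Rle_trans with (1 := A1); pose proof (jap_ge_1 k).
        assert (P : 0 < p_beta beta k) by nra.
        apply (Rmult_le_reg_l (p_beta beta k)); auto.
        replace (p_beta beta k * (c2 * / p_beta beta k)) with c2 by (field; lra); lra.
      + apply (ex_sumZ_ext (fun k => Cmod (rinv beta (fourier (fst x)) k) ^ 2)); [|now apply Br].
        intros k; destruct (B k) as [_ [B2 _]].
        unfold rinv, rdg, dg; now rewrite Cmod_mult_R, pow_inv, B2. }
  assert (W2 : l2 (fourier (snd x)) <-> l2 (rmul beta (fourier (snd x))) /\
    l2 (omv beta (rmul beta (fourier (snd x))))).
  { split.
    - intros E; split; [now apply l2_rmul|].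
      apply (l2_le _ _ K) with (2 := E); intros k; destruct (B k) as [B1 [B2 [_ [_ [B3 _]]]]].
      unfold omv, rmul, rdg, dg; rewrite !Cmod_mult, Cmod_Ci, !Cmod_R, Rabs_mult.
      rewrite (Rabs_pos_eq (root_p beta k)) by lra.
      replace (1 * (Rabs (IZR k) * root_p beta k) * (root_p beta k * Cmod (fourier (snd x) k))) with
        (Rabs (IZR k) * root_p beta k ^ 2 * Cmod (fourier (snd x) k)) by ring.
      rewrite B2; apply Rmult_le_compat_r; auto using Cmod_ge_0.
    - intros [E1 E2].
      replace (fourier (snd x)) with (rinv beta (rmul beta (fourier (snd x)))); [now apply Br|].
      apply seq_ext; intros k; destruct (B k) as [B1 _].
      unfold rinv, rmul, rdg, dg; rewrite Cmult_assoc, <- RtoC_mult, Rinv_l by lra; ring. }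
  tauto.
Qed.

Lemma energy_norm_coords x : pl2 (coords beta x) -> energy_norm beta x = sqrt (2 * PI) * pnrm (coords beta x).
Proof.
  pose proof PI_RGT_0 as Hpi; intros [H1 H2]; unfold coords in H1, H2; simpl fst in *; simpl snd in *.
  unfold energy_norm, pnrm; rewrite <- sqrt_mult_alt by lra; f_equal.
  unfold coords; simpl fst; simpl snd; rewrite (nrm_sqr _ H1), (nrm_sqr _ H2).
  assert (E1 : CsumZ (fun k => fourier (fst x) k * Cconj (fourier (fst x) k))%C =
    RtoC (sumZ (fun k => Cmod (fourier (fst x) k) ^ 2))).
  { rewrite <- CsumZ_RtoC; apply CsumZ_ext; intros k; now rewrite Cmod2_conj. }
  assert (E2 : CsumZ (fun k => RtoC (p_beta beta k) * fourier (snd x) k * Cconj (fourier (snd x) k))%C =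
    RtoC (sumZ (fun k => Cmod (rmul beta (fourier (snd x)) k) ^ 2))).
  { rewrite <- CsumZ_RtoC; apply CsumZ_ext; intros k.
    rewrite rmul_sqr, RtoC_mult, Cmod2_conj; ring. }
  unfold energy_inner; rewrite E1, E2, <- !RtoC_mult, <- RtoC_plus, re_RtoC; ring.
Qed.

Lemma m_beta_p k : m_beta beta k = IZR k * p_beta beta k.
Proof.
  unfold m_beta, p_beta; destruct (Z.eq_dec k 0) as [->|Hk].
  - replace (tanh (beta * 0)) with 0 by (rewrite Rmult_0_r; unfold tanh, sinh; rewrite Ropp_0; unfold Rdiv; ring).
    field; lra.
  - assert (IZR k <> 0) by now apply not_0_IZR.
    field; split; lra.
Qed.

Lemma coords_Ad lam y : Ad_domain y ->
  coords beta (sminus (sscal lam y) (Ad beta a b y)) = full_op beta a b lam (coords beta y).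
Proof.
  intros Hy; assert (Hh : l2 (fourier (fst y))).
  { apply Ad_domain_iff in Hy; destruct Hy as [[H _] _]; exact H. }
  assert (Hu : l2 (fourier (snd y))) by (destruct Hy as [_ H]; now apply L2_iff).
  unfold coords at 2; rewrite (surjective_pairing (full_op _ _ _ _ _)).
  rewrite <- (eq1_full_op beta Hb), <- (eq2_full_op beta Hb a b).
  assert (EP : fourier (P_op beta (snd y)) = pmul beta (fourier (snd y))).
  { apply seq_ext; intros k; unfold P_op; rewrite fourier_multiplier; reflexivity. }
  unfold coords; f_equal; [|f_equal]; apply seq_ext; intros k;
    unfold sminus, sscal, Ad, cinf_sqr; simpl fst; simpl snd; rewrite !fourier_dminus, !fourier_dscal.
  - unfold T_op; rewrite fourier_multiplier, fourier_dmul_op, mul_mult by auto.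
    unfold eq1, vadd, vscal, ddx, pmul, rdg, dg, T_symbol; rewrite m_beta_p, RtoC_mult; ring.
  - rewrite fourier_dderiv, fourier_dmul_op, EP, mul_mult by now apply l2_pmul.
    unfold eq2, vadd, vscal, ddx, dg; ring.
Qed.

Lemma coords_inj x y : coords beta x = coords beta y -> x = y.
Proof.
  intros E; destruct (p_beta_bounds beta Hb) as [K [_ B]]; unfold coords in E; injection E as E1 E2.
  apply injective_projections; apply fourier_inj; intros k; [now rewrite E1|].
  destruct (B k) as [B1 _]; apply (f_equal (fun v => v k)) in E2; unfold rmul, rdg, dg in E2.
  transitivity (RtoC (/ root_p beta k) * (RtoC (root_p beta k) * fourier (snd x) k))%C.
  - rewrite Cmult_assoc, <- RtoC_mult, Rinv_l by lra; ring.
  - rewrite E2, Cmult_assoc, <- RtoC_mult, Rinv_l by lra; ring.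
Qed.

(** Both sequences of coefficients are bounded, as [u] is square-summable for
    states in the domain. *)
Lemma coords_onto z : op_dom beta z -> exists x, coords beta x = z.
Proof.
  intros [[Z1 Z2] [_ Z4]]; destruct (rinv_bound beta Hb) as [Kr [_ Br]].
  destruct (Br _ Z2 Z4) as [Hu _].
  destruct (distr_of_coefficients _ (l2_bounded_symbol _ Z1)) as [h Hh].
  destruct (distr_of_coefficients _ (l2_bounded_symbol _ Hu)) as [u Hu'].
  exists (h, u); unfold coords; simpl fst; simpl snd.
  rewrite (surjective_pairing z); f_equal.
  - apply seq_ext; auto.
  - rewrite <- (rmul_rinv beta Hb (snd z)); f_equal; apply seq_ext; auto.
Qed.

End Translation.

Theorem theorem5p8 (beta : R) (a b : Cinf)
  (hbeta : 0 < beta)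
  (ha : forall x : R, 0 <= a x) (hb : forall x : R, 0 <= b x)
  (ha0 : exists x : R, a x <> 0) (hb0 : exists x : R, b x <> 0) :
  exists K tau0 : R, 0 < K /\ 0 < tau0 /\
    forall tau : R, tau0 <= Rabs tau ->
      exists Res : state -> state,
        is_resolvent beta a b (Ci * RtoC tau)%C Res /\
        Rbar_le (op_norm beta Res) (Finite (K * Rabs tau)).
Proof.
  pose proof PI_RGT_0 as Hpi.
  destruct (apriori beta hbeta a b ha0) as [K [t0 [HK [Ht0 H]]]].
  exists K, t0; split; auto; split; [lra|]; intros tau Ht.
  assert (HKt : 0 < K * Rabs tau) by (apply Rmult_lt_0_compat; lra).
  set (lam := (Ci * RtoC tau)%C).
  assert (Low : forall x, op_dom beta x -> pnrm x <= K * Rabs tau * pnrm (full_op beta a b lam x))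
    by (intros x; now apply H).
  assert (Onto := full_op_onto_axis beta hbeta a b tau (K * Rabs tau) HKt Low); fold lam in Onto.
  set (A := fun y => sminus (sscal lam y) (Ad beta a b y)).
  assert (Solve : forall x, energy_space x -> exists y, Ad_domain y /\ A y = x).
  { intros x Hx; apply (energy_space_iff beta hbeta) in Hx.
    destruct (Onto _ Hx) as [z [Dz Ez]]; destruct (coords_onto beta hbeta z Dz) as [y Ey].
    assert (Dy : Ad_domain y) by (apply (Ad_domain_iff beta hbeta); now rewrite Ey).
    exists y; split; auto; apply (coords_inj beta hbeta); unfold A.
    now rewrite (coords_Ad beta hbeta a b), Ey. }
  pose (Res := fun x => epsilon (inhabits x) (fun y => energy_space x -> Ad_domain y /\ A y = x)).
  assert (HRes : forall x, energy_space x -> Ad_domain (Res x) /\ A (Res x) = x).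
  { intros x Hx.
    refine (epsilon_spec (inhabits x) (fun y => energy_space x -> Ad_domain y /\ A y = x) _ Hx).
    destruct (Solve x Hx) as [y Hy]; exists y; auto. }
  assert (Maps : forall y, Ad_domain y -> energy_space (A y)).
  { intros y Hy; apply (energy_space_iff beta hbeta); unfold A; rewrite (coords_Ad beta hbeta) by auto.
    now apply pl2_full_op, (Ad_domain_iff beta hbeta). }
  exists Res; split; [split; [exact HRes|]|].
  - intros y Hy; destruct (HRes _ (Maps y Hy)) as [Dr Er]; change (Res (A y) = y).
    set (z := Res (A y)) in *; clearbody z.
    apply (f_equal (coords beta)) in Er; unfold A in Er.
    rewrite !(coords_Ad beta hbeta) in Er by auto.
    apply (coords_inj beta hbeta).
    apply (Ad_domain_iff beta hbeta) in Dr; apply (Ad_domain_iff beta hbeta) in Hy.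
    apply pnrm_0_eq; [apply Dr | apply Hy |].
    apply Rle_trans with (1 := Low _ (op_dom_sub beta _ _ Dr Hy)).
    rewrite (full_op_sub beta hbeta) by auto; rewrite Er.
    replace (psub (full_op beta a b lam (coords beta y)) (full_op beta a b lam (coords beta y))) with
      (pscal (RtoC 0) (full_op beta a b lam (coords beta y))).
    + rewrite pnrm_scal, Cmod_0; apply Req_le; ring.
    + apply pair_ext; intros k; unfold pscal, psub, vscal, vsub, dg; simpl fst; simpl snd; ring.
  - apply (proj2 (Lub_Rbar_correct _)); intros r [x [Hx [Nx ->]]]; simpl.
    destruct (HRes x Hx) as [Dr Er].
    assert (Hs : pl2 (coords beta (Res x))) by (apply (Ad_domain_iff beta hbeta) in Dr; apply Dr).
    assert (Hs' : pl2 (coords beta x)) by now apply (energy_space_iff beta hbeta).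
    rewrite (energy_norm_coords beta hbeta) in Nx |- * by auto.
    pose proof (Low _ (proj1 (Ad_domain_iff beta hbeta _) Dr)) as L.
    rewrite <- (coords_Ad beta hbeta a b) in L by auto; fold (A (Res x)) in L; rewrite Er in L.
    pose proof (sqrt_pos (2 * PI)) as S0.
    apply Rle_trans with (sqrt (2 * PI) * (K * Rabs tau * pnrm (coords beta x))).
    { now apply Rmult_le_compat_l. }
    replace (sqrt (2 * PI) * (K * Rabs tau * pnrm (coords beta x))) with
      (K * Rabs tau * (sqrt (2 * PI) * pnrm (coords beta x))) by ring.
    rewrite <- (Rmult_1_r (K * Rabs tau)) at 2; apply Rmult_le_compat_l; lra.
Qed.
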